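(* The following statements are provably equivalent over $\mathsf{RCA}_0$ (all notions being formalized in the language $L_2$ of second-order arithmetic): (a) The schema of Arithmetical Comprehension $\mathrm{ACA}$. (b) Every bounded monotone sequence $(x_n)_{n\in\mathbb{N}}$ of reals in $[0,1]$ converges to a limit. (c) If $(x_n)_{n\in\mathbb{N}}$ is a Cauchy sequence of reals, then $\lim_{n\to\infty}x_n$ exists. (d) If $(x_n)_{n\in\mathbb{N}}$ is a bounded sequence of reals, then $\sup(\{x_n : n\in\mathbb{N}\})$ exists. (e) If $C$ is a (code for a) nonempty closed subset of $[0,1]$, then the infimum $\inf(C)$ exists. (f) If $O$ is a (code for a) nonempty open subset of $[0,1]$, then the supremum $\sup(O)$ exists. (g) The schema $\mathrm{OI}_1(\Psi)$ for all $\Sigma^0_1$-formulas $\Psi(x)$. (h) The schema $\mathrm{OI}_3(\Psi)$ for all $\Sigma^0_1$-formulas $\Psi(x)$. (i) The statement $\mathrm{OI}_4$.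
   Context: Language and systems. $L_2$ is the language of second-order arithmetic: number variables $n,m,\ldots$, symbols $0,+,\times,<$, and set variables $X,Y,\ldots$ ranging over sets of natural numbers. $\mathsf{PA}^-$ denotes the usual basic axioms of arithmetic without induction. $\mathsf{RCA}_0$ consists of $\mathsf{PA}^-$ together with: - $\Sigma^0_1$-induction: for every $\varphi(n)\equiv(\exists m)\psi(n,m)$ with $\psi$ containing only bounded quantifiers, $[\varphi(0)\wedge(\forall n)(\varphi(n)\to\varphi(n+1))]\to(\forall m)\varphi(m)$; - $\Delta^0_1$-comprehension: for $\varphi(n,m),\psi(n,k)$ with only bounded quantifiers, if $(\forall n)[(\exists m)\varphi(n,m)\leftrightarrow(\forall k)\psi(n,k)]$ then $\exists X(\forall n)(n\in X\leftrightarrow(\forall k)\psi(n,k))$. The schema $\mathrm{ACA}$: for every $L_2$-formula $\varphi(n,k)$ with number quantifiers and second-order parameters but no set quantifiers, $\exists X(\forall n)(n\in X\leftrightarrow(\forall k)\varphi(n,k))$. Following the standard conventions of reverse mathematics, formulas in schemas may contain number and set parameters. Coding. Rationals are coded by natural numbers. A real number $x$ is coded by a sequence of rationals $q_0,q_1,q_2,\ldots$ with $\forall k\,\forall i\,(|q_k-q_{k+i}|\le 2^{-k})$, with the usual definitions of equality and order of reals. A sequence of reals is coded by a doubly indexed sequence of rationals. A code for an open set of reals is given by two sequences of rationals $q_0,q_1,\ldots$ and $q_0',q_1',\ldots$; it represents $\bigcup_{n\in\mathbb{N}}(q_n,q_n')\subseteq\mathbb{R}$. Open subsets of $[0,1]$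 are understood relative to $[0,1]$, i.e. as the intersection of a coded open set with $[0,1]$ (so, e.g., $[0,x)$ with $0<x\le 1$ is open in $[0,1]$); closed subsets of $[0,1]$ are complements in $[0,1]$ of such open sets, and are coded by a code of the complement. A $\Sigma^0_1$-formula $\Psi(x)$ is applied to (codes for) reals $x$. Abbreviations for a formula $\Psi(x)$ about reals: - $\mathrm{Open}(\Psi)$: $\forall x\big(\Psi(x)\to\exists\varepsilon>0\,\forall y(x-\varepsilon<y<x+\varepsilon\to\Psi(y))\big)$, where $x,y$ range over reals. - $\mathrm{Prog}^{[0,1]}(\Psi)$: $\forall x\in[0,1]\big((\forall y\in[0,1])(y<x\to\Psi(y))\to\Psi(x)\big)$. - $\mathrm{LCC}^{[0,1]}_{\mathrm{seq}}(\Psi)$: for any $x\in[0,1]$ and any sequence $(x_n)_{n\in\mathbb{N}}$ of reals in $[0,x]$ with $\lim_{n\to\infty}x_n=x$, if $\Psi(x_n)$ for all $n\in\mathbb{N}$, then $\Psi(x)$. - $\mathrm{OI}_1(\Psi)$: $(\mathrm{Open}(\Psi)\wedge\mathrm{Prog}^{[0,1]}(\Psi))\to(\forall x\in[0,1])\Psi(x)$. - $\mathrm{OI}_3(\Psi)$: $(\mathrm{Open}(\Psi)\wedge\Psi(0)\wedge\mathrm{LCC}^{[0,1]}_{\mathrm{seq}}(\Psi))\to(\forall x\in[0,1])\Psi(x)$. - $\mathrm{OI}_4$: for any (code for an) open set $O\subseteq[0,1]$, if $\forall y\in[0,1]\big((\forall z\in[0,1])(z<y\to z\in O)\to y\in O\big)$,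 then $(\forall x\in[0,1])(x\in O)$. *)

(* Defs.v *)
From Stdlib Require Import List.
Import ListNotations.

(** * Second-order arithmetic: syntax *)

(** Number variables and set variables are two independent families of
    de Bruijn indices: [AllNum], [ExNum] bind number index 0 and [AllSet], [ExSet] bind
    set index 0.  Only numbers are compared by [Eq]. *)

Inductive term : Type :=
| TVar (i : nat)
| TZero
| TOne
| TAdd (s t : term)
| TMul (s t : term).

Inductive form : Type :=
| Eq (s t : term)
| Lt (s t : term)
| Mem (t : term) (X : nat)
| Bot
| Imp (p q : form)
| And (p q : form)
| Or (p q : form)
| AllNum (p : form)
| ExNum (p : form)
| AllSet (p : form)
| ExSet (p : form).

Definition Not (p : form) : form := Imp p Bot.

Definition scons {A : Type} (a : A) (f : nat -> A) (i : nat) : A :=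
  match i with 0 => a | S j => f j end.

Fixpoint tsubst (sg : nat -> term) (t : term) : term :=
  match t with
  | TVar i => sg i
  | TZero => TZero
  | TOne => TOne
  | TAdd s t => TAdd (tsubst sg s) (tsubst sg t)
  | TMul s t => TMul (tsubst sg s) (tsubst sg t)
  end.

Definition tshift : term -> term := tsubst (fun i => TVar (S i)).

(** Simultaneous capture-avoiding substitution of terms for number variables and
    of set variables for set variables. *)
Fixpoint subst (sg : nat -> term) (rh : nat -> nat) (p : form) : form :=
  match p with
  | Eq s t => Eq (tsubst sg s) (tsubst sg t)
  | Lt s t => Lt (tsubst sg s) (tsubst sg t)
  | Mem t X => Mem (tsubst sg t) (rh X)
  | Bot => Bot
  | Imp p q => Imp (subst sg rh p) (subst sg rh q)
  | And p q => And (subst sg rh p) (subst sg rh q)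
  | Or p q => Or (subst sg rh p) (subst sg rh q)
  | AllNum p => AllNum (subst (scons (TVar 0) (fun i => tshift (sg i))) rh p)
  | ExNum p => ExNum (subst (scons (TVar 0) (fun i => tshift (sg i))) rh p)
  | AllSet p => AllSet (subst sg (scons 0 (fun j => S (rh j))) p)
  | ExSet p => ExSet (subst sg (scons 0 (fun j => S (rh j))) p)
  end.

Definition shiftN : form -> form := subst (fun i => TVar (S i)) (fun j => j).
Definition shiftS : form -> form := subst TVar S.
Definition instN (t : term) : form -> form := subst (scons t TVar) (fun j => j).
Definition instS (X : nat) : form -> form := subst TVar (scons X (fun j => j)).

(** * Classical two-sorted first-order provability *)

Definition theory : Type := form -> Prop.

(** Members of the theory [T] may have free variables (the parameters of schemas)
    and stand for their universal closures; this is why [T] is not shifted in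
    the rules [AllNum_I], [ExNum_E], [AllSet_I] and [ExSet_E]. *)
Inductive prv (T : theory) : list form -> form -> Prop :=
| Axiom_ G p : T p -> prv T G p
| Hyp G p : In p G -> prv T G p
| Imp_I G p q : prv T (p :: G) q -> prv T G (Imp p q)
| Imp_E G p q : prv T G (Imp p q) -> prv T G p -> prv T G q
| And_I G p q : prv T G p -> prv T G q -> prv T G (And p q)
| And_E1 G p q : prv T G (And p q) -> prv T G p
| And_E2 G p q : prv T G (And p q) -> prv T G q
| Or_I1 G p q : prv T G p -> prv T G (Or p q)
| Or_I2 G p q : prv T G q -> prv T G (Or p q)
| Or_E G p q r :
    prv T G (Or p q) -> prv T (p :: G) r -> prv T (q :: G) r -> prv T G r
| Contradiction G p : prv T (Not p :: G) Bot -> prv T G p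
| AllNum_I G p : prv T (map shiftN G) p -> prv T G (AllNum p)
| AllNum_E G p t : prv T G (AllNum p) -> prv T G (instN t p)
| ExNum_I G p t : prv T G (instN t p) -> prv T G (ExNum p)
| ExNum_E G p q :
    prv T G (ExNum p) -> prv T (p :: map shiftN G) (shiftN q) -> prv T G q
| AllSet_I G p : prv T (map shiftS G) p -> prv T G (AllSet p)
| AllSet_E G p X : prv T G (AllSet p) -> prv T G (instS X p)
| ExSet_I G p X : prv T G (instS X p) -> prv T G (ExSet p)
| ExSet_E G p q :
    prv T G (ExSet p) -> prv T (p :: map shiftS G) (shiftS q) -> prv T G q
| Eq_refl G t : prv T G (Eq t t)
| Eq_subst G p s t : prv T G (Eq s t) -> prv T G (instN s p) -> prv T G (instN t p).

Definition extend (T S : theory) : theory := fun p => T p \/ S p.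
Definition proves (T S : theory) : Prop := forall p, S p -> prv T [] p.
Definition provably_equivalent_over (T S S' : theory) : Prop :=
  proves (extend T S) S' /\ proves (extend T S') S.

(** * Formula classes *)

Inductive Delta0 : form -> Prop :=
| Delta0_Eq s t : Delta0 (Eq s t)
| Delta0_Lt s t : Delta0 (Lt s t)
| Delta0_Mem t X : Delta0 (Mem t X)
| Delta0_Bot : Delta0 Bot
| Delta0_Imp p q : Delta0 p -> Delta0 q -> Delta0 (Imp p q)
| Delta0_And p q : Delta0 p -> Delta0 q -> Delta0 (And p q)
| Delta0_Or p q : Delta0 p -> Delta0 q -> Delta0 (Or p q)
| Delta0_AllNum t p : Delta0 p -> Delta0 (AllNum (Imp (Lt (TVar 0) (tshift t)) p))
| Delta0_ExNum t p : Delta0 p -> Delta0 (ExNum (And (Lt (TVar 0) (tshift t)) p)).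

Definition Sigma1 (p : form) : Prop := exists q, Delta0 q /\ p = ExNum q.

Fixpoint Arithmetical (p : form) : Prop :=
  match p with
  | Eq _ _ | Lt _ _ | Mem _ _ | Bot => True
  | Imp p q | And p q | Or p q => Arithmetical p /\ Arithmetical q
  | AllNum p | ExNum p => Arithmetical p
  | AllSet _ | ExSet _ => False
  end.

(** * Named notation for de Bruijn formulas *)

(** An [hterm] (resp. [hset], [hform]) yields a term (resp. set variable,
    formula) once it is told how many number and set quantifiers enclose it.  A
    variable bound under [d] quantifiers of its sort has index [d' - S d] when it
    is used under [d'] of them, so Rocq's own binders can be used for those of
    the object language and no abbreviation can capture a variable. *)

Definition hterm : Type := nat -> term.
Definition hset : Type := nat -> nat.
Definition hform : Type := nat -> nat -> form.

Definition close (p : hform) : form := p 0 0.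

Definition hzero : hterm := fun _ => TZero.
Definition hone : hterm := fun _ => TOne.
Definition hadd (s t : hterm) : hterm := fun d => TAdd (s d) (t d).
Definition hmul (s t : hterm) : hterm := fun d => TMul (s d) (t d).

Definition heq (s t : hterm) : hform := fun d _ => Eq (s d) (t d).
Definition hlt (s t : hterm) : hform := fun d _ => Lt (s d) (t d).
Definition hmem (t : hterm) (X : hset) : hform := fun d e => Mem (t d) (X e).
Definition hbot : hform := fun _ _ => Bot.
Definition himp (p q : hform) : hform := fun d e => Imp (p d e) (q d e).
Definition hand (p q : hform) : hform := fun d e => And (p d e) (q d e).
Definition hor (p q : hform) : hform := fun d e => Or (p d e) (q d e).
Definition hallN (p : hterm -> hform) : hform :=
  fun d e => AllNum (p (fun d' => TVar (d' - S d)) (S d) e).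
Definition hexN (p : hterm -> hform) : hform :=
  fun d e => ExNum (p (fun d' => TVar (d' - S d)) (S d) e).
Definition hallS (p : hset -> hform) : hform :=
  fun d e => AllSet (p (fun e' => e' - S e) d (S e)).
Definition hexS (p : hset -> hform) : hform :=
  fun d e => ExSet (p (fun e' => e' - S e) d (S e)).

Declare Scope hterm_scope.
Delimit Scope hterm_scope with ht.
Bind Scope hterm_scope with hterm.
Declare Scope hform_scope.
Delimit Scope hform_scope with hf.
Bind Scope hform_scope with hform.
Open Scope hform_scope.

Notation "0" := hzero : hterm_scope.
Notation "1" := hone : hterm_scope.
Notation "2" := (hadd hone hone) : hterm_scope.
Notation "s + t" := (hadd s t) : hterm_scope.
Notation "s * t" := (hmul s t) : hterm_scope.
Notation "s = t" := (heq s%ht t%ht) : hform_scope.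
Notation "s < t" := (hlt s%ht t%ht) : hform_scope.
Notation "s <= t" := (hor (hlt s%ht t%ht) (heq s%ht t%ht)) : hform_scope.
Notation "t '\in' X" := (hmem t%ht X) (at level 70) : hform_scope.
Notation "~ p" := (himp p hbot) : hform_scope.
Notation "p -> q" := (himp p q) : hform_scope.
Notation "p /\ q" := (hand p q) : hform_scope.
Notation "p \/ q" := (hor p q) : hform_scope.
Notation "p <-> q" := (hand (himp p q) (himp q p)) : hform_scope.
Notation "'allN' x .. y , p" := (hallN (fun x => .. (hallN (fun y => p%hf)) ..))
  (at level 200, x binder, y binder, right associativity) : hform_scope.
Notation "'exN' x .. y , p" := (hexN (fun x => .. (hexN (fun y => p%hf)) ..))
  (at level 200, x binder, y binder, right associativity) : hform_scope.
Notation "'allS' X .. Y , p" := (hallS (fun X => .. (hallS (fun Y => p%hf)) ..))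
  (at level 200, X binder, Y binder, right associativity) : hform_scope.
Notation "'exS' X .. Y , p" := (hexS (fun X => .. (hexS (fun Y => p%hf)) ..))
  (at level 200, X binder, Y binder, right associativity) : hform_scope.

(** [plug p [t0; ..; ta] [X0; ..; Xb]] is [p(t0, .., ta, X0, .., Xb)]: the first
    free variables of [p] of each sort are its arguments, in order, and the
    remaining ones are parameters, which become the free variables 0, 1, .. of the
    schema instance in which [plug] occurs. *)
Definition plug (p : form) (ts : list hterm) (Xs : list hset) : hform :=
  fun d e =>
    subst (fold_right scons (fun i => TVar (i + d)) (map (fun t => t d) ts))
          (fold_right scons (fun j => j + e) (map (fun X => X e) Xs)) p.

(** * The system RCA0 and arithmetical comprehension *)

Definition PA_minus : list form := map close
  [ (allN x y z, (x + y) + z = x + (y + z));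
    (allN x y, x + y = y + x);
    (allN x y z, (x * y) * z = x * (y * z));
    (allN x y, x * y = y * x);
    (allN x y z, x * (y + z) = x * y + x * z);
    (allN x, x + 0 = x /\ x * 0 = 0);
    (allN x, x * 1 = x);
    (allN x y z, x < y /\ y < z -> x < z);
    (allN x, ~ x < x);
    (allN x y, x < y \/ x = y \/ y < x);
    (allN x y z, x < y -> x + z < y + z);
    (allN x y z, 0 < z /\ x < y -> x * z < y * z);
    (allN x y, x < y -> exN z, x + z = y);
    (0 < 1 /\ allN x, 0 < x -> 1 <= x);
    (allN x, 0 <= x) ].

Definition Sigma1_induction (psi : form) : form := close
  ((exN m, plug psi [hzero; m] []) /\
   (allN n, (exN m, plug psi [n; m] []) -> exN m, plug psi [hadd n hone; m] []) ->
   allN n, exN m, plug psi [n; m] []).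

Definition Delta1_comprehension (phi psi : form) : form := close
  ((allN n, (exN m, plug phi [n; m] []) <-> (allN k, plug psi [n; k] [])) ->
   exS X, allN n, n \in X <-> allN k, plug psi [n; k] []).

Inductive RCA0 : theory :=
| RCA0_basic p : In p PA_minus -> RCA0 p
| RCA0_induction psi : Delta0 psi -> RCA0 (Sigma1_induction psi)
| RCA0_comprehension phi psi :
    Delta0 phi -> Delta0 psi -> RCA0 (Delta1_comprehension phi psi).

Definition arithmetical_comprehension (phi : form) : form := close
  (exS X, allN n, n \in X <-> allN k, plug phi [n; k] []).

(** * Rationals *)

Definition hpair (s t : hterm) : hterm := ((s + t) * (s + t) + s)%ht.

(** [Rat a b d] stands for the rational (a - b) / d. *)
Record rat : Type := Rat { rpos : hterm; rneg : hterm; rden : hterm }.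

Definition ratN (t : hterm) : rat := Rat t 0 1.
Definition ratInv (t : hterm) : rat := Rat 1 0 t.

Definition radd (r s : rat) : rat :=
  Rat (rpos r * rden s + rpos s * rden r)
      (rneg r * rden s + rneg s * rden r)
      (rden r * rden s).
Definition rsub (r s : rat) : rat := radd r (Rat (rneg s) (rpos s) (rden s)).

Definition rlt (r s : rat) : hform :=
  rpos r * rden s + rneg s * rden r < rpos s * rden r + rneg r * rden s.
Definition rle (r s : rat) : hform :=
  rpos r * rden s + rneg s * rden r <= rpos s * rden r + rneg r * rden s.

(** The number <<a,b>,c> is a code of the rational (a - b) / (c + 1); a rational
    has several codes.  In [exQ q r, p], [q] is a code and [r] is the rational
    which it codes. *)
Notation "'exQ' q r , p" :=
  (exN a b c, (fun (q : hterm) (r : rat) => p%hf) (hpair (hpair a b) c) (Rat a b (c + 1)))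
  (at level 200, q name, r name, right associativity) : hform_scope.

(** The graph of k |-> 2^k is, as far as codes of pairs are concerned, the unique
    set [E] with [is_exp2 E], and it exists by primitive recursion; [with_exp2 k p]
    says that [p] holds of 2^k. *)
Definition is_exp2 (E : hset) : hform :=
  (allN p, hpair 0 p \in E <-> p = 1) /\
  (allN k p, hpair (k + 1) p \in E <-> exN r, hpair k r \in E /\ p = 2 * r).
Definition with_exp2 (k : hterm) (p : hterm -> hform) : hform :=
  exS E, is_exp2 E /\ exN t, hpair k t \in E /\ p t.

(** * Reals *)

(** A sequence of rationals given by a formula: [u k p] says that [p] holds of the
    k-th term of [u]. *)
Definition ratseq : Type := hterm -> (rat -> hform) -> hform.

Definition const_seq (r : rat) : ratseq := fun _ p => p r.
(** The sequence coded by the function [X] from N to Q. *)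
Definition set_seq (X : hset) : ratseq :=
  fun k p => exQ q r, hpair k q \in X /\ p r.
(** The [n]-th row of the function [X] from N x N to Q. *)
Definition row (X : hset) (n : hterm) : ratseq :=
  fun k p => exQ q r, hpair (hpair n k) q \in X /\ p r.
Coercion set_seq : hset >-> ratseq.

(** Addition and subtraction of reals shift the index to keep the modulus 2^-k. *)
Definition add_seq (u v : ratseq) : ratseq :=
  fun k p => u (k + 1)%ht (fun r => v (k + 1)%ht (fun s => p (radd r s))).
Definition sub_seq (u v : ratseq) : ratseq :=
  fun k p => u (k + 1)%ht (fun r => v (k + 1)%ht (fun s => p (rsub r s))).

Definition modulus (u : ratseq) : hform :=
  allN k i, with_exp2 k (fun t => u k (fun r => u (k + i)%ht (fun s =>
    rle r (radd s (ratInv t)) /\ rle s (radd r (ratInv t))))).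

Definition is_ratseq (X : hset) : hform :=
  (allN z, z \in X -> exN k, exQ q r, z = hpair k q) /\
  (allN k, exQ q r, hpair k q \in X) /\
  (allN k q q', hpair k q \in X /\ hpair k q' \in X -> q = q').

Definition is_real (X : hset) : hform := is_ratseq X /\ modulus X.

Definition is_realseq (X : hset) : hform :=
  (allN z, z \in X -> exN n k, exQ q r, z = hpair (hpair n k) q) /\
  (allN n k, exQ q r, hpair (hpair n k) q \in X) /\
  (allN n k q q', hpair (hpair n k) q \in X /\ hpair (hpair n k) q' \in X -> q = q') /\
  (allN n, modulus (row X n)).

Notation "'allR' x , p" := (hallS (fun x : hset => himp (is_real x) p%hf))
  (at level 200, x name, right associativity) : hform_scope.
Notation "'exR' x , p" := (hexS (fun x : hset => hand (is_real x) p%hf))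
  (at level 200, x name, right associativity) : hform_scope.

(** u <= v iff u_k <= v_k + 2 * 2^-k for all k, and u < v is its negation with [u]
    and [v] exchanged. *)
Definition le_real (u v : ratseq) : hform :=
  allN k, with_exp2 k (fun t => u k (fun r => v k (fun s =>
    rle r (radd s (Rat 2 0 t))))).
Definition lt_real (u v : ratseq) : hform :=
  exN k, with_exp2 k (fun t => u k (fun r => v k (fun s =>
    rlt (radd r (Rat 2 0 t)) s))).

Declare Scope ratseq_scope.
Delimit Scope ratseq_scope with rs.
Bind Scope ratseq_scope with ratseq.
Notation "0" := (const_seq (ratN hzero)) : ratseq_scope.
Notation "1" := (const_seq (ratN hone)) : ratseq_scope.
Notation "u + v" := (add_seq u v) : ratseq_scope.
Notation "u - v" := (sub_seq u v) : ratseq_scope.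
Notation "u <R v" := (lt_real u%rs v%rs) (at level 70) : hform_scope.
Notation "u <=R v" := (le_real u%rs v%rs) (at level 70) : hform_scope.
Notation "u <R v <R w" := (hand (lt_real u%rs v%rs) (lt_real v%rs w%rs))
  (at level 70, v at next level) : hform_scope.
Notation "u <=R v <=R w" := (hand (le_real u%rs v%rs) (le_real v%rs w%rs))
  (at level 70, v at next level) : hform_scope.

Definition in01 (u : ratseq) : hform := 0 <=R u <=R 1.

Definition eq_real (u v : ratseq) : hform := u <=R v /\ v <=R u.

(** |u - v| < eps *)
Definition near (u v eps : ratseq) : hform := v - eps <R u <R v + eps.

Definition bounded (X : hset) : hform :=
  exR a, exR b, allN n, a <=R row X n <=R b.

Definition monotone (X : hset) : hform :=
  (allN m n, m < n -> row X m <=R row X n) \/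
  (allN m n, m < n -> row X n <=R row X m).

Definition cauchy (X : hset) : hform :=
  allR eps, 0 <R eps ->
    exN k, allN m n, k <= m -> k <= n -> near (row X m) (row X n) eps.

Definition limit (X x : hset) : hform :=
  allR eps, 0 <R eps -> exN k, allN n, k <= n -> near (row X n) x eps.

(** [s] is the supremum, resp. infimum, of the class of reals [P]. *)
Definition is_sup (P : hset -> hform) (s : hset) : hform :=
  (allR x, P x -> x <=R s) /\ (allR y, (allR x, P x -> x <=R y) -> s <=R y).
Definition is_inf (P : hset -> hform) (s : hset) : hform :=
  (allR x, P x -> s <=R x) /\ (allR y, (allR x, P x -> y <=R x) -> y <=R s).

(** The real coded by [x] is the n-th real of the sequence [X], with the same code. *)
Definition is_row (X : hset) (n : hterm) (x : hset) : hform :=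
  is_real x /\ allN k q, hpair k q \in x <-> hpair (hpair n k) q \in X.

(** The open set coded by the sequences [Q], [Q'] is the union of the intervals
    (Q_n, Q'_n). *)
Definition in_open (Q Q' : hset) (u : ratseq) : hform :=
  exN n, set_seq Q n (fun r => set_seq Q' n (fun r' =>
    const_seq r <R u <R const_seq r')).

(** The open subset of [0,1], resp. the closed subset, coded by [Q], [Q']. *)
Definition in_open01 (Q Q' : hset) (u : ratseq) : hform :=
  in01 u /\ in_open Q Q' u.
Definition in_closed01 (Q Q' : hset) (u : ratseq) : hform :=
  in01 u /\ ~ in_open Q Q' u.

(** * The statements *)

Definition monotone_convergence : form := close
  (allS X, is_realseq X -> bounded X -> monotone X ->
     (allN n, in01 (row X n)) -> exR x, limit X x).

Definition cauchy_convergence : form := close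
  (allS X, is_realseq X -> cauchy X -> exR x, limit X x).

Definition sequence_sup : form := close
  (allS X, is_realseq X -> bounded X ->
     exR s, is_sup (fun x => exN n, eq_real x (row X n)) s).

Definition closed_inf : form := close
  (allS Q Q', is_ratseq Q -> is_ratseq Q' -> (exR x, in_closed01 Q Q' x) ->
     exR s, is_inf (in_closed01 Q Q') s).

Definition open_sup : form := close
  (allS Q Q', is_ratseq Q -> is_ratseq Q' -> (exR x, in_open01 Q Q' x) ->
     exR s, is_sup (in_open01 Q Q') s).

Definition Open (Psi : form) : hform :=
  allR x, plug Psi [] [x] ->
    exR eps, 0 <R eps /\ allR y, x - eps <R y <R x + eps -> plug Psi [] [y].

Definition Prog (Psi : form) : hform :=
  allR x, in01 x ->
    (allR y, in01 y -> y <R x -> plug Psi [] [y]) -> plug Psi [] [x].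

Definition LCC_seq (Psi : form) : hform :=
  allR x, in01 x -> allS X, is_realseq X ->
    (allN n, 0 <=R row X n <=R x) -> limit X x ->
    (allN n, exS y, is_row X n y /\ plug Psi [] [y]) -> plug Psi [] [x].

(** Psi(0), for the code of 0 which is the constant sequence with value the code
    <<0,0>,0> of 0. *)
Definition holds_at_zero (Psi : form) : hform :=
  exR z, (allN k, hpair k (hpair (hpair 0 0) 0) \in z) /\ plug Psi [] [z].

Definition OI1 (Psi : form) : form := close
  (Open Psi /\ Prog Psi -> allR x, in01 x -> plug Psi [] [x]).

Definition OI3 (Psi : form) : form := close
  (Open Psi /\ holds_at_zero Psi /\ LCC_seq Psi ->
   allR x, in01 x -> plug Psi [] [x]).

Definition OI4 : form := close
  (allS Q Q', is_ratseq Q -> is_ratseq Q' ->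
     (allR y, in01 y ->
        (allR z, in01 z -> z <R y -> in_open01 Q Q' z) -> in_open01 Q Q' y) ->
     allR x, in01 x -> in_open01 Q Q' x).

Definition sentence (p : form) : theory := fun q => @eq form q p.
Definition schema (C : form -> Prop) (F : form -> form) : theory :=
  fun q => ex (fun p => and (C p) (@eq form q (F p))).

Close Scope hform_scope.

(* Main.v *)
(** By completeness of the calculus it suffices to work in a model M of RCA0. Its
    numbers embed in an ordered field, in which coded rationals and the entries of
    coded reals take their values, and primitive recursion inside M comes from
    coding finite sets by divisibility. All statements turn out to be equivalent
    in M to comprehension for Sigma^0_1 sets.

    Comprehension follows from suprema of increasing sequences x by Specker's
    sequence: the n-th binary digit of x_s tells whether n has been enumerated by
    stage s, so a close approximation of sup x from below decides whether n is in
    the set. If such an x had no supremum, the open set of the y below some x_n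
    would violate each of the statements on open and closed sets.

    Conversely, comprehension is iterated to arithmetical comprehension, which gives
    limits of Cauchy sequences. For open induction one needs the least real outside
    a Sigma^0_1 class P. Call a binary string bad if the matrix of P holds of the
    real it starts, and covered if all its extensions of some length are bad; the
    leftmost path through the strings that are not covered is that real. *)

Require Import Defs.
From Stdlib Require Import List Lia ClassicalEpsilon FunctionalExtensionality
  PropExtensionality Cantor Arith.
Import ListNotations.

(** * Completeness *)

(** The model may be nonstandard, so induction on its numbers holds only for Sigma^0_1 formulas, and
    a set exists only once it has a Delta^0_1 definition. Hence every induction and every
    construction carries a proof of definability: [isD0], [isS1] and [isD1] track predicates, [isR]
    functions with values in the numbers, [isK] functions with values in the field. The field opens
    estimates to linear arithmetic, yet its elements are exactly the rationals coded in the model.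

    Two obstacles shape the search for the least real outside P. First, P is a formula about codes,
    not about reals; openness makes it respect equality, so each real may be replaced by a canonical
    binary code. Second, a search along leftmost paths must not quantify over paths. A bounded
    formula inspects only a bounded part of a code, so badness is a property of strings; and, as
    compactness suggests, covering asks for a single length at which all extensions are bad. That is
    a Sigma^0_1 condition on badness, within reach of comprehension. *)

Definition up (sg : nat -> term) : nat -> term :=
  scons (TVar 0) (fun i => tshift (sg i)).
Definition upS (rh : nat -> nat) : nat -> nat := scons 0 (fun j => S (rh j)).

Lemma tsubst_comp sg sg' t :
  tsubst sg (tsubst sg' t) = tsubst (fun i => tsubst sg (sg' i)) t.
Proof. induction t; simpl; congruence. Qed.

Lemma tsubst_id t : tsubst TVar t = t.
Proof. induction t; simpl; congruence. Qed.

Lemma up_comp sg sg' :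
  (fun i => tsubst (up sg) (up sg' i)) = up (fun i => tsubst sg (sg' i)).
Proof.
  extensionality i; destruct i; simpl; trivial.
  unfold tshift; now rewrite !tsubst_comp.
Qed.

Lemma up_id : up TVar = TVar.
Proof. extensionality i; now destruct i. Qed.

Lemma upS_comp rh rh' : (fun j => upS rh (upS rh' j)) = upS (fun j => rh (rh' j)).
Proof. extensionality j; now destruct j. Qed.

Lemma upS_id : upS (fun j => j) = (fun j => j).
Proof. extensionality j; now destruct j. Qed.

Lemma subst_comp p : forall sg sg' rh rh',
  subst sg rh (subst sg' rh' p)
  = subst (fun i => tsubst sg (sg' i)) (fun j => rh (rh' j)) p.
Proof.
  induction p; intros; simpl; rewrite ?tsubst_comp, ?IHp1, ?IHp2; trivial.
  all: f_equal; rewrite IHp.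
  - exact (f_equal (fun s => subst s _ p) (up_comp sg sg')).
  - exact (f_equal (fun s => subst s _ p) (up_comp sg sg')).
  - exact (f_equal (fun r => subst _ r p) (upS_comp rh rh')).
  - exact (f_equal (fun r => subst _ r p) (upS_comp rh rh')).
Qed.

Lemma subst_id p : subst TVar (fun j => j) p = p.
Proof.
  induction p; simpl; rewrite ?tsubst_id; trivial; try congruence.
  all: f_equal; rewrite <- IHp at 2; f_equal; trivial using up_id, upS_id.
Qed.

Fixpoint tbound (t : term) : nat :=
  match t with
  | TVar i => S i
  | TZero | TOne => 0
  | TAdd s t | TMul s t => Nat.max (tbound s) (tbound t)
  end.

(** Exceeds every free number index; [pred] accounts for the index bound by a quantifier. As
    contexts are finite, such bounds supply fresh variables. *)
Fixpoint nbound (p : form) : nat :=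
  match p with
  | Eq s t | Lt s t => Nat.max (tbound s) (tbound t)
  | Mem t _ => tbound t
  | Bot => 0
  | Imp p q | And p q | Or p q => Nat.max (nbound p) (nbound q)
  | AllNum p | ExNum p => pred (nbound p)
  | AllSet p | ExSet p => nbound p
  end.

Fixpoint sbound (p : form) : nat :=
  match p with
  | Eq _ _ | Lt _ _ | Bot => 0
  | Mem _ X => S X
  | Imp p q | And p q | Or p q => Nat.max (sbound p) (sbound q)
  | AllNum p | ExNum p => sbound p
  | AllSet p | ExSet p => pred (sbound p)
  end.

Lemma tsubst_ext t sg sg' :
  (forall i, i < tbound t -> sg i = sg' i) -> tsubst sg t = tsubst sg' t.
Proof.
  induction t; simpl; intros H; trivial; try (apply H; lia).
  all: f_equal; (apply IHt1 || apply IHt2); intros; apply H; lia.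
Qed.

Lemma subst_ext p : forall sg sg' rh rh',
  (forall i, i < nbound p -> sg i = sg' i) ->
  (forall j, j < sbound p -> rh j = rh' j) -> subst sg rh p = subst sg' rh' p.
Proof.
  induction p; simpl; intros sg sg' rh rh' H1 H2; trivial.
  1,2: f_equal; apply tsubst_ext; intros; apply H1; lia.
  1: f_equal; [apply tsubst_ext; intros; apply H1; lia | apply H2; lia].
  1-3: f_equal; (apply IHp1 || apply IHp2); intros; (apply H1 || apply H2); lia.
  1,2: f_equal; apply IHp; trivial; intros [|i] Hi; simpl; trivial; rewrite H1; trivial; lia.
  1,2: f_equal; apply IHp; trivial; intros [|i] Hi; simpl; trivial; rewrite H2; trivial; lia.
Qed.

(** * Weakening, substitution and fresh variables in the calculus *)

Section Calculus.
Variable T : theory.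

Lemma prv_weaken G p : prv T G p -> forall G', incl G G' -> prv T G' p.
Proof.
  induction 1; intros G' HG.
  - now apply Axiom_.
  - apply Hyp; auto.
  - apply Imp_I, IHprv. intros x [|]; [left|right]; auto.
  - eapply Imp_E; eauto.
  - apply And_I; auto.
  - eapply And_E1; eauto.
  - eapply And_E2; eauto.
  - apply Or_I1; auto.
  - apply Or_I2; auto.
  - eapply Or_E; eauto; [apply IHprv2 | apply IHprv3]; intros x [|]; [left|right|left|right]; auto.
  - apply Contradiction, IHprv; intros x [|]; [left|right]; auto.
  - apply AllNum_I, IHprv; now apply incl_map.
  - apply AllNum_E; auto.
  - eapply ExNum_I; eauto.
  - eapply ExNum_E; eauto. apply IHprv2; intros x [|]; [left|right]; auto.
    now apply (incl_map shiftN HG).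
  - apply AllSet_I, IHprv; now apply incl_map.
  - apply AllSet_E; auto.
  - eapply ExSet_I; eauto.
  - eapply ExSet_E; eauto. apply IHprv2; intros x [|]; [left|right]; auto.
    now apply (incl_map shiftS HG).
  - apply Eq_refl.
  - eapply Eq_subst; eauto.
Qed.

Lemma instN_subst t p sg rh :
  subst sg rh (instN t p) = instN (tsubst sg t) (subst (up sg) rh p).
Proof.
  unfold instN; rewrite !subst_comp; f_equal.
  extensionality i; destruct i; simpl; trivial.
  unfold tshift; rewrite tsubst_comp; simpl; now rewrite tsubst_id.
Qed.

Lemma instS_subst X p sg rh :
  subst sg rh (instS X p) = instS (rh X) (subst sg (upS rh) p).
Proof.
  unfold instS; rewrite !subst_comp; f_equal.
  - extensionality i; simpl; now rewrite tsubst_id.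
  - extensionality j; now destruct j.
Qed.

Lemma shiftN_subst p sg rh : subst (up sg) rh (shiftN p) = shiftN (subst sg rh p).
Proof. unfold shiftN; now rewrite !subst_comp. Qed.

Lemma shiftS_subst p sg rh : subst sg (upS rh) (shiftS p) = shiftS (subst sg rh p).
Proof.
  unfold shiftS; rewrite !subst_comp; f_equal.
  extensionality i; simpl; now rewrite tsubst_id.
Qed.

Lemma instN_up t sg rh p :
  instN t (subst (up sg) rh p) = subst (scons t sg) rh p.
Proof.
  unfold instN; rewrite subst_comp; f_equal.
  extensionality i; destruct i; simpl; trivial.
  unfold tshift; rewrite tsubst_comp; apply tsubst_id.
Qed.

Lemma instS_up X sg rh p :
  instS X (subst sg (upS rh) p) = subst sg (scons X rh) p.
Proof.
  unfold instS; rewrite subst_comp; f_equal.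
  - extensionality i; apply tsubst_id.
  - extensionality j; now destruct j.
Qed.

Definition cons_list {A} (f : nat -> A) : nat -> (nat -> A) -> nat -> A :=
  fun n g i => if i <? n then f i else g (i - n).

Lemma cons_list_S {A} (f : nat -> A) n g :
  cons_list f (S n) g = cons_list f n (scons (f n) g).
Proof.
  extensionality i; unfold cons_list.
  destruct (Nat.ltb_spec i (S n)), (Nat.ltb_spec i n); try lia; trivial.
  - now replace (i - n) with 0 by lia; replace n with i by lia.
  - now replace (i - n) with (S (i - S n)) by lia.
Qed.

(** The outermost of [n] quantifiers binds index [n - 1] of the matrix, so successive eliminations
    instantiate the indices downwards; [cons_list] collects these instances. *)
Lemma prv_all_inst n sg p : forall G tau rh,
  prv T G (subst tau rh (Nat.iter n AllNum p)) ->
  prv T G (subst (cons_list sg n tau) rh p).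
Proof.
  induction n as [|n IH]; intros G tau rh H.
  - replace (cons_list sg 0 tau) with tau; trivial.
    extensionality i; unfold cons_list; simpl; f_equal; lia.
  - rewrite cons_list_S. apply IH. rewrite <- instN_up. now apply AllNum_E.
Qed.

Lemma prv_allS_inst n rh p : forall G tau sg,
  prv T G (subst sg tau (Nat.iter n AllSet p)) ->
  prv T G (subst sg (cons_list rh n tau) p).
Proof.
  induction n as [|n IH]; intros G tau sg H.
  - replace (cons_list rh 0 tau) with tau; trivial.
    extensionality i; unfold cons_list; simpl; f_equal; lia.
  - rewrite cons_list_S. apply IH. rewrite <- instS_up. now apply AllSet_E.
Qed.

(** The rules leave [T] unshifted, so the variables of an axiom can be generalised in any context
    and the closure instantiated at will. This makes provability stable under substitution although
    [T] itself need not be. *)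
Lemma prv_ax_subst p G sg rh : T p -> prv T G (subst sg rh p).
Proof.
  intros Hp. set (n := nbound p). set (m := sbound p).
  assert (H1 : forall k q, (forall G, prv T G q) -> forall G, prv T G (Nat.iter k AllNum q)).
  { induction k; simpl; intros q Hq G'; auto. apply AllNum_I; auto. }
  assert (H2 : forall k q, (forall G, prv T G q) -> forall G, prv T G (Nat.iter k AllSet q)).
  { induction k; simpl; intros q Hq G'; auto. apply AllSet_I; auto. }
  assert (H3 : prv T G (subst TVar (fun j => j) (Nat.iter n AllNum (Nat.iter m AllSet p)))).
  { rewrite subst_id. apply H1, H2. intros; now apply Axiom_. }
  apply (prv_all_inst n sg), (prv_allS_inst m rh) in H3.
  erewrite subst_ext; [exact H3 | |]; intros i Hi; unfold cons_list.
  - now destruct (Nat.ltb_spec i n); [|unfold n in *; lia].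
  - now destruct (Nat.ltb_spec i m); [|unfold m in *; lia].
Qed.

Lemma prv_subst G p : prv T G p -> forall sg rh,
  prv T (map (subst sg rh) G) (subst sg rh p).
Proof.
  assert (HN : forall G sg rh, map (subst (up sg) rh) (map shiftN G)
                = map shiftN (map (subst sg rh) G)).
  { intros; rewrite !map_map; apply map_ext; intros; apply shiftN_subst. }
  assert (HS : forall G sg rh, map (subst sg (upS rh)) (map shiftS G)
                = map shiftS (map (subst sg rh) G)).
  { intros; rewrite !map_map; apply map_ext; intros; apply shiftS_subst. }
  induction 1; intros sg rh; simpl in *.
  - now apply prv_ax_subst.
  - apply Hyp; now apply in_map.
  - apply Imp_I, IHprv.
  - eapply Imp_E; eauto.
  - apply And_I; auto.
  - eapply And_E1; eauto.
  - eapply And_E2; eauto.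
  - apply Or_I1; auto.
  - apply Or_I2; auto.
  - eapply Or_E; eauto.
  - apply Contradiction, IHprv.
  - apply AllNum_I. rewrite <- HN. apply (IHprv (up sg)).
  - rewrite instN_subst. apply AllNum_E, IHprv.
  - eapply ExNum_I. fold (up sg). rewrite <- instN_subst. apply IHprv.
  - eapply ExNum_E; [apply IHprv1|]. specialize (IHprv2 (up sg) rh).
    now rewrite HN, shiftN_subst in IHprv2.
  - apply AllSet_I. rewrite <- HS. apply (IHprv sg (upS rh)).
  - rewrite instS_subst. apply AllSet_E, IHprv.
  - eapply ExSet_I. fold (upS rh). rewrite <- instS_subst. apply IHprv.
  - eapply ExSet_E; [apply IHprv1|]. specialize (IHprv2 sg (upS rh)).
    now rewrite HS, shiftS_subst in IHprv2.
  - apply Eq_refl.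
  - rewrite instN_subst. eapply Eq_subst; [apply IHprv1|].
    rewrite <- instN_subst. apply IHprv2.
Qed.

Definition nbounds (G : list form) : nat := list_max (map nbound G).
Definition sbounds (G : list form) : nat := list_max (map sbound G).

Lemma nbounds_In G p : In p G -> nbound p <= nbounds G.
Proof.
  intros H. pose proof (proj1 (list_max_le (map nbound G) _) (le_n _)) as F.
  rewrite Forall_forall in F. now apply F, in_map.
Qed.

Lemma sbounds_In G p : In p G -> sbound p <= sbounds G.
Proof.
  intros H. pose proof (proj1 (list_max_le (map sbound G) _) (le_n _)) as F.
  rewrite Forall_forall in F. now apply F, in_map.
Qed.

(** The variable [nbounds G] is free in no formula of [G] and acts as the eigenvariable of
    [ExNum_E]: the renaming that sends it to index 0 and shifts all others turns the derivation into
    the premise of that rule. *)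
Lemma prv_fresh_ex G q :
  In (ExNum q) G -> prv T (instN (TVar (nbounds G)) q :: G) Bot -> prv T G Bot.
Proof.
  intros Hq H. set (x := nbounds G) in *.
  eapply ExNum_E; [now apply Hyp, Hq|].
  apply prv_subst with (sg := fun i => if i =? x then TVar 0 else TVar (S i))
    (rh := fun j => j) in H.
  eapply prv_weaken; [exact H|]. simpl.
  assert (Hx := nbounds_In _ _ Hq); simpl in Hx.
  assert (E : subst (fun i => if i =? x then TVar 0 else TVar (S i)) (fun j => j)
      (instN (TVar x) q) = q).
  { unfold instN. rewrite subst_comp. rewrite <- (subst_id q) at 2.
    apply subst_ext; trivial. intros [|i] Hi; simpl.
    - now rewrite Nat.eqb_refl.
    - destruct (Nat.eqb_spec i x); trivial; unfold x in *; lia. }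
  rewrite E. apply incl_cons; [now left|]. apply incl_tl.
  intros p Hp. apply in_map_iff in Hp as (p' & <- & Hp').
  replace (subst _ _ p') with (shiftN p'); [now apply in_map|].
  apply subst_ext; trivial. intros i Hi. apply nbounds_In in Hp'.
  destruct (Nat.eqb_spec i x); trivial; unfold x in *; lia.
Qed.

Lemma prv_fresh_exS G q :
  In (ExSet q) G -> prv T (instS (sbounds G) q :: G) Bot -> prv T G Bot.
Proof.
  intros Hq H. set (x := sbounds G) in *.
  eapply ExSet_E; [now apply Hyp, Hq|].
  apply prv_subst with (sg := TVar) (rh := fun i => if i =? x then 0 else S i) in H.
  eapply prv_weaken; [exact H|]. simpl.
  assert (Hx := sbounds_In _ _ Hq); simpl in Hx.
  assert (E : subst TVar (fun i => if i =? x then 0 else S i) (instS x q) = q).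
  { unfold instS. rewrite subst_comp. rewrite <- (subst_id q) at 2.
    apply subst_ext; trivial. intros [|i] Hi; simpl.
    - now rewrite Nat.eqb_refl.
    - destruct (Nat.eqb_spec i x); trivial; unfold x in *; lia. }
  rewrite E. apply incl_cons; [now left|]. apply incl_tl.
  intros p Hp. apply in_map_iff in Hp as (p' & <- & Hp').
  replace (subst _ _ p') with (shiftS p'); [now apply in_map|].
  apply subst_ext; trivial. intros i Hi. apply sbounds_In in Hp'.
  destruct (Nat.eqb_spec i x); trivial; unfold x in *; lia.
Qed.

End Calculus.

(** * Countability of formulas *)

Fixpoint tcode (t : term) : nat :=
  match t with
  | TVar i => to_nat (0, i)
  | TZero => to_nat (1, 0)
  | TOne => to_nat (2, 0)
  | TAdd s t => to_nat (3, to_nat (tcode s, tcode t))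
  | TMul s t => to_nat (4, to_nat (tcode s, tcode t))
  end.

Fixpoint fcode (p : form) : nat :=
  match p with
  | Eq s t => to_nat (0, to_nat (tcode s, tcode t))
  | Lt s t => to_nat (1, to_nat (tcode s, tcode t))
  | Mem t X => to_nat (2, to_nat (tcode t, X))
  | Bot => to_nat (3, 0)
  | Imp p q => to_nat (4, to_nat (fcode p, fcode q))
  | And p q => to_nat (5, to_nat (fcode p, fcode q))
  | Or p q => to_nat (6, to_nat (fcode p, fcode q))
  | AllNum p => to_nat (7, fcode p)
  | ExNum p => to_nat (8, fcode p)
  | AllSet p => to_nat (9, fcode p)
  | ExSet p => to_nat (10, fcode p)
  end.

Lemma to_nat_pair a b c d : to_nat (a, b) = to_nat (c, d) -> a = c /\ b = d.
Proof.
  intros H. apply (f_equal of_nat) in H. rewrite !cancel_of_to in H.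
  now injection H.
Qed.

Lemma tcode_inj t : forall t', tcode t = tcode t' -> t = t'.
Proof.
  induction t; destruct t'; cbn [tcode]; intros H; apply to_nat_pair in H as [H1 H2];
    try discriminate; try apply to_nat_pair in H2 as [H2 H3]; f_equal; auto.
Qed.

Lemma fcode_inj p : forall p', fcode p = fcode p' -> p = p'.
Proof.
  induction p; destruct p'; cbn [fcode]; intros H; apply to_nat_pair in H as [H1 H2];
    try discriminate; try apply to_nat_pair in H2 as [H2 H3]; f_equal;
    auto using tcode_inj.
Qed.

(** Inverts the injection [fcode] by choice; numbers that code nothing receive an arbitrary
    formula. *)
Definition enum_form (n : nat) : form := epsilon (inhabits Bot) (fun p => fcode p = n).

Lemma enum_form_code p : enum_form (fcode p) = p.
Proof.
  apply fcode_inj. unfold enum_form.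
  exact (epsilon_spec (inhabits Bot) (fun q => fcode q = fcode p) (ex_intro _ p eq_refl)).
Qed.

(** * Two-sorted models *)

Record model : Type := {
  dom : Type;
  sets : Type;
  mzero : dom;
  mone : dom;
  madd : dom -> dom -> dom;
  mmul : dom -> dom -> dom;
  mlt : dom -> dom -> Prop;
  mmem : dom -> sets -> Prop }.

Fixpoint eval (M : model) (rho : nat -> dom M) (t : term) : dom M :=
  match t with
  | TVar i => rho i
  | TZero => mzero M
  | TOne => mone M
  | TAdd s t => madd M (eval M rho s) (eval M rho t)
  | TMul s t => mmul M (eval M rho s) (eval M rho t)
  end.

(** Equality is read as identity of elements, so the term model below has to be a quotient. *)
Fixpoint sat (M : model) (rho : nat -> dom M) (sigma : nat -> sets M) (p : form) : Prop :=
  match p with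
  | Eq s t => eval M rho s = eval M rho t
  | Lt s t => mlt M (eval M rho s) (eval M rho t)
  | Mem t X => mmem M (eval M rho t) (sigma X)
  | Bot => False
  | Imp p q => sat M rho sigma p -> sat M rho sigma q
  | And p q => sat M rho sigma p /\ sat M rho sigma q
  | Or p q => sat M rho sigma p \/ sat M rho sigma q
  | AllNum p => forall x, sat M (scons x rho) sigma p
  | ExNum p => exists x, sat M (scons x rho) sigma p
  | AllSet p => forall X, sat M rho (scons X sigma) p
  | ExSet p => exists X, sat M rho (scons X sigma) p
  end.

Definition holds (M : model) (T : theory) : Prop :=
  forall p, T p -> forall rho sigma, sat M rho sigma p.

(** * The Henkin model of an unprovable formula *)

Section Henkin.
Variables (T : theory) (p0 : form).
Hypothesis p0_unprovable : ~ prv T [] p0.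

Definition consistent (G : list form) : Prop := ~ prv T G Bot.

Definition witness (p : form) (G : list form) : list form :=
  match p with
  | ExNum q => [instN (TVar (nbounds G)) q]
  | ExSet q => [instS (sbounds G) q]
  | _ => []
  end.

Fixpoint stage (n : nat) : list form :=
  match n with
  | 0 => [Not p0]
  | S n => let p := enum_form n in
      if excluded_middle_informative (consistent (p :: stage n))
      then witness p (p :: stage n) ++ p :: stage n else stage n
  end.

Lemma stage_consistent n : consistent (stage n).
Proof.
  induction n as [|n IH]; simpl.
  - intros Hen; now apply p0_unprovable, Contradiction.
  - destruct excluded_middle_informative as [Hen|Hen]; trivial.
    destruct (enum_form n) eqn:E; try exact Hen; simpl; intros Hen'.
    + apply Hen. eapply prv_fresh_ex; [now left|exact Hen'].
    + apply Hen. eapply prv_fresh_exS; [now left|exact Hen'].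
Qed.

Lemma stage_mono n m : n <= m -> incl (stage n) (stage m).
Proof.
  induction 1 as [|m _ IH]; [apply incl_refl|].
  eapply incl_tran; [exact IH|]. simpl.
  destruct excluded_middle_informative; [|apply incl_refl].
  now apply incl_appr, incl_tl.
Qed.

Definition henkin (p : form) : Prop := exists n, In p (stage n).

Lemma henkin_stage L : Forall henkin L -> exists n, incl L (stage n).
Proof.
  induction 1 as [|p L [n Hn] _ [m Hm]].
  - exists 0; intros x [].
  - exists (n + m). apply incl_cons.
    + eapply stage_mono, Hn; lia.
    + eapply incl_tran; [exact Hm|]. apply stage_mono; lia.
Qed.

(** The formula [p] is examined at stage [fcode p]: it is added there unless that stage refutes
    it. *)
Lemma henkin_dec p : henkin p \/ exists n, prv T (p :: stage n) Bot.
Proof.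
  destruct (classic (consistent (p :: stage (fcode p)))) as [C|C].
  - left. exists (S (fcode p)). simpl. rewrite enum_form_code.
    destruct excluded_middle_informative; [|tauto].
    apply in_or_app; right; now left.
  - right. exists (fcode p). now apply NNPP.
Qed.

(** If [p] were left out, some stage would refute it, and a later stage, which contains [L], would
    also prove it. *)
Lemma henkin_prv L p : Forall henkin L -> prv T L p -> henkin p.
Proof.
  intros HL Hp. destruct (henkin_dec p) as [|[n Hn]]; trivial. exfalso.
  destruct (henkin_stage L HL) as [m Hm].
  apply (stage_consistent (n + m)). eapply Imp_E.
  - apply Imp_I. eapply prv_weaken; [exact Hn|].
    apply incl_cons; [now left|]. apply incl_tl, stage_mono; lia.
  - eapply prv_weaken; [exact Hp|]. eapply incl_tran; [exact Hm|]. apply stage_mono; lia.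
Qed.

Lemma henkin_Bot : ~ henkin Bot.
Proof. intros [n Hn]. apply (stage_consistent n). now apply Hyp. Qed.

Lemma henkin_Imp p q : henkin (Imp p q) <-> (henkin p -> henkin q).
Proof.
  split.
  - intros H1 H2. apply (henkin_prv [Imp p q; p]); auto.
    eapply Imp_E; apply Hyp; simpl; auto.
  - intros Hpq. destruct (henkin_dec p) as [Hp|[n Hn]].
    + apply (henkin_prv [q]); auto. apply Imp_I, Hyp; simpl; auto.
    + apply (henkin_prv (stage n)).
      { apply Forall_forall; intros x Hx; now exists n. }
      apply Imp_I, Contradiction. eapply prv_weaken; [exact Hn|].
      now apply incl_tl, incl_refl.
Qed.

Lemma henkin_Not p : henkin (Not p) <-> ~ henkin p.
Proof. unfold Not; rewrite henkin_Imp. pose proof henkin_Bot. tauto. Qed.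

Lemma henkin_And p q : henkin (And p q) <-> henkin p /\ henkin q.
Proof.
  split.
  - intros A; split; apply (henkin_prv [And p q]); auto;
      [eapply And_E1 | eapply And_E2]; apply Hyp; now left.
  - intros [A B]. apply (henkin_prv [p; q]); auto. apply And_I; apply Hyp; simpl; auto.
Qed.

Lemma henkin_Or p q : henkin (Or p q) <-> henkin p \/ henkin q.
Proof.
  split.
  - intros A. apply NNPP; intros B. apply henkin_Bot.
    apply (henkin_prv [Or p q; Not p; Not q]).
    + repeat constructor; trivial; apply henkin_Not; tauto.
    + eapply Or_E; [now apply Hyp; left| |]; (eapply Imp_E;
        [|now apply Hyp; left]); apply Hyp; simpl; auto.
  - intros [A|A]; [apply (henkin_prv [p]) | apply (henkin_prv [q])]; auto;
      [apply Or_I1 | apply Or_I2]; apply Hyp; now left.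
Qed.

(** A formula may enter before its own turn. It is nevertheless consistent with every stage, so at
    turn [fcode p] its witness is added all the same. *)
Lemma stage_witness p : henkin p -> exists G, incl (witness p G) (stage (S (fcode p))).
Proof.
  intros [m Hm]. exists (p :: stage (fcode p)). simpl. rewrite enum_form_code.
  destruct excluded_middle_informative as [C|C].
  - now apply incl_appl, incl_refl.
  - exfalso. apply C. intros C'. apply (stage_consistent (m + fcode p)).
    eapply prv_weaken; [exact C'|]. apply incl_cons.
    + eapply stage_mono, Hm; lia.
    + apply stage_mono; lia.
Qed.

Lemma henkin_ExNum q : henkin (ExNum q) <-> exists t, henkin (instN t q).
Proof.
  split.
  - intros A. apply stage_witness in A as [G HG].
    eexists; eexists; apply HG; now left.
  - intros [t A]. apply (henkin_prv [instN t q]); auto.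
    eapply ExNum_I, Hyp; now left.
Qed.

Lemma henkin_ExSet q : henkin (ExSet q) <-> exists X, henkin (instS X q).
Proof.
  split.
  - intros A. apply stage_witness in A as [G HG].
    eexists; eexists; apply HG; now left.
  - intros [X A]. apply (henkin_prv [instS X q]); auto.
    eapply ExSet_I, Hyp; now left.
Qed.

Lemma henkin_AllNum q : henkin (AllNum q) <-> forall t, henkin (instN t q).
Proof.
  split.
  - intros A t. apply (henkin_prv [AllNum q]); auto. apply AllNum_E, Hyp; now left.
  - intros A. apply NNPP; intros B. apply henkin_Not in B.
    (* A universal formula left out yields a Henkin witness for the negated matrix, which
       contradicts the corresponding instance. *)
    assert (C : henkin (ExNum (Not q))).
    { apply (henkin_prv [Not (AllNum q)]); auto. apply Contradiction.
      eapply Imp_E; [apply Hyp; right; now left|].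
      apply AllNum_I, Contradiction. eapply Imp_E; [apply Hyp; right; now left|].
      apply ExNum_I with (t := TVar 0). apply Hyp; left.
      unfold instN; simpl. rewrite subst_comp. cbn.
      unfold Not; f_equal. rewrite <- (subst_id q) at 1. f_equal.
      extensionality i; now destruct i. }
    apply henkin_ExNum in C as [t C]. apply (henkin_Not (instN t q)) in C. now apply C.
Qed.

Lemma henkin_AllSet q : henkin (AllSet q) <-> forall X, henkin (instS X q).
Proof.
  split.
  - intros A t. apply (henkin_prv [AllSet q]); auto. apply AllSet_E, Hyp; now left.
  - intros A. apply NNPP; intros B. apply henkin_Not in B.
    assert (C : henkin (ExSet (Not q))).
    { apply (henkin_prv [Not (AllSet q)]); auto. apply Contradiction.
      eapply Imp_E; [apply Hyp; right; now left|].
      apply AllSet_I, Contradiction. eapply Imp_E; [apply Hyp; right; now left|].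
      apply ExSet_I with (X := 0). apply Hyp; left.
      unfold instS; simpl. rewrite subst_comp. cbn.
      unfold Not; f_equal. rewrite <- (subst_id q) at 1. f_equal.
      extensionality i; now destruct i. }
    apply henkin_ExSet in C as [t C]. apply (henkin_Not (instS t q)) in C. now apply C.
Qed.

Definition cls (t : term) : term -> Prop := fun s => henkin (Eq t s).

Lemma henkin_Eq_subst s t p : henkin (Eq s t) -> henkin (instN s p) -> henkin (instN t p).
Proof.
  intros A B. apply (henkin_prv [Eq s t; instN s p]); auto.
  eapply Eq_subst; apply Hyp; simpl; auto.
Qed.

Lemma instN_shift t u : tsubst (scons t TVar) (tshift u) = u.
Proof. unfold tshift; rewrite tsubst_comp; apply tsubst_id. Qed.

Lemma henkin_refl t : henkin (Eq t t).
Proof. apply (henkin_prv []); auto. apply Eq_refl. Qed.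

Lemma cls_eq s t : cls s = cls t <-> henkin (Eq s t).
Proof.
  split.
  - intros E. change (cls s t). rewrite E. apply henkin_refl.
  - intros A. extensionality u. apply propositional_extensionality.
    assert (H1 : forall s t, henkin (Eq s t) -> henkin (Eq s u) -> henkin (Eq t u)).
    { intros s' t' B C. generalize (henkin_Eq_subst s' t' (Eq (TVar 0) (tshift u)) B).
      unfold instN; simpl; rewrite !instN_shift; auto. }
    split; apply H1; trivial.
    generalize (henkin_Eq_subst s t (Eq (TVar 0) (tshift s)) A).
    unfold instN; simpl; rewrite !instN_shift. intros B; apply B, henkin_refl.
Qed.

(** The quotient of the terms by provable equality, with classes as predicates so that equal classes
    are identical. The operations of [hmodel] act on representatives chosen by [hrepr]. *)
Definition hdom : Type := {c : term -> Prop | exists t, c = cls t}.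
Definition hcls (t : term) : hdom := exist _ (cls t) (ex_intro _ t eq_refl).
Definition hrepr (d : hdom) : term := epsilon (inhabits TZero) (fun t => d = hcls t).

Lemma hcls_hrepr d : d = hcls (hrepr d).
Proof.
  unfold hrepr; apply epsilon_spec. destruct d as [c [t E]]; exists t.
  subst c. reflexivity.
Qed.

Lemma hcls_eq s t : hcls s = hcls t <-> henkin (Eq s t).
Proof.
  rewrite <- cls_eq. split; intros E.
  - now injection E.
  - unfold hcls. revert s E. intros s E.
    generalize (ex_intro (fun u => cls s = cls u) s eq_refl). rewrite E.
    intros e; f_equal; apply proof_irrelevance.
Qed.

Definition hmodel : model := {|
  dom := hdom;
  sets := nat;
  mzero := hcls TZero;
  mone := hcls TOne;
  madd := fun a b => hcls (TAdd (hrepr a) (hrepr b));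
  mmul := fun a b => hcls (TMul (hrepr a) (hrepr b));
  mlt := fun a b => henkin (Lt (hrepr a) (hrepr b));
  mmem := fun a X => henkin (Mem (hrepr a) X) |}.

Lemma henkin_hrepr t : henkin (Eq (hrepr (hcls t)) t).
Proof. apply hcls_eq. symmetry; apply hcls_hrepr. Qed.

(** The hypothesis says that [f] commutes with substitution: a shifted argument then survives the
    instantiation unchanged while the other one is replaced. *)
Lemma henkin_congr2 (f : term -> term -> form) s s' t t' :
  (forall sg u v, subst sg (fun j => j) (f u v) = f (tsubst sg u) (tsubst sg v)) ->
  henkin (Eq s s') -> henkin (Eq t t') -> henkin (f s t) -> henkin (f s' t').
Proof.
  intros Hf A B C.
  generalize (henkin_Eq_subst s s' (f (TVar 0) (tshift t)) A).
  unfold instN; rewrite !Hf; simpl; rewrite !instN_shift. intros D; apply D in C.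
  generalize (henkin_Eq_subst t t' (f (tshift s') (TVar 0)) B).
  unfold instN; rewrite !Hf; simpl; rewrite !instN_shift. intros E; now apply E in C.
Qed.

Lemma henkin_trans s t u : henkin (Eq s t) -> henkin (Eq t u) -> henkin (Eq s u).
Proof. rewrite <- !cls_eq; congruence. Qed.

Lemma henkin_congr_term (f : term -> term -> term) s s' t t' :
  (forall sg u v, tsubst sg (f u v) = f (tsubst sg u) (tsubst sg v)) ->
  henkin (Eq s s') -> henkin (Eq t t') -> henkin (Eq (f s t) (f s' t')).
Proof.
  intros Hf A B. apply henkin_trans with (f s' t).
  - generalize (henkin_Eq_subst s s' (Eq (f (tshift s) (tshift t)) (f (TVar 0) (tshift t))) A).
    unfold instN; simpl; rewrite !Hf; simpl; rewrite !instN_shift. intros D; apply D, henkin_refl.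
  - generalize (henkin_Eq_subst t t' (Eq (f (tshift s') (tshift t)) (f (tshift s') (TVar 0))) B).
    unfold instN; simpl; rewrite !Hf; simpl; rewrite !instN_shift. intros D; apply D, henkin_refl.
Qed.

Lemma heval rho sg t : (forall i, rho i = hcls (sg i)) ->
  eval hmodel rho t = hcls (tsubst sg t).
Proof.
  intros E. induction t; simpl; trivial.
  - rewrite IHt1, IHt2. apply hcls_eq, (henkin_congr_term TAdd); auto using henkin_hrepr.
  - rewrite IHt1, IHt2. apply hcls_eq, (henkin_congr_term TMul); auto using henkin_hrepr.
Qed.

Lemma henkin_sym s t : henkin (Eq s t) -> henkin (Eq t s).
Proof. rewrite <- !cls_eq; congruence. Qed.

(** The valuation is presented by terms [sg], so that a quantifier over elements becomes one over
    terms: every element is the class of its representative. *)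
Lemma truth p : forall rho sg sigma, (forall i, rho i = hcls (sg i)) ->
  sat hmodel rho sigma p <-> henkin (subst sg sigma p).
Proof.
  assert (Hup : forall rho sg t, (forall i, rho i = hcls (sg i)) ->
    forall i, @scons hdom (hcls t) rho i = hcls (scons t sg i)).
  { intros rho sg t E [|i]; simpl; auto. }
  induction p; intros rho sg sigma E; simpl.
  - rewrite !(heval rho sg) by trivial. apply hcls_eq.
  - rewrite !(heval rho sg) by trivial.
    split; apply (henkin_congr2 Lt); auto using henkin_hrepr, henkin_sym.
  - rewrite (heval rho sg) by trivial.
    split; apply (henkin_congr2 (fun t _ => Mem t (sigma X))) with (t := TZero) (t' := TZero);
      auto using henkin_hrepr, henkin_sym, henkin_refl.
  - split; [tauto | intros []%henkin_Bot].
  - rewrite henkin_Imp, (IHp1 rho sg), (IHp2 rho sg) by trivial. tauto.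
  - rewrite henkin_And, (IHp1 rho sg), (IHp2 rho sg) by trivial. tauto.
  - rewrite henkin_Or, (IHp1 rho sg), (IHp2 rho sg) by trivial. tauto.
  - rewrite henkin_AllNum. split; intros A.
    + intros t. change (subst (scons (TVar 0) (fun i => tshift (sg i))) sigma p)
        with (subst (up sg) sigma p). rewrite instN_up.
      apply (IHp _ _ _ (Hup _ _ t E)), A.
    + intros d. rewrite (hcls_hrepr d). apply (IHp _ _ _ (Hup _ _ (hrepr d) E)).
      rewrite <- instN_up. apply A.
  - rewrite henkin_ExNum. split.
    + intros [d A]. exists (hrepr d). rewrite (hcls_hrepr d) in A.
      apply (IHp _ _ _ (Hup _ _ (hrepr d) E)) in A. rewrite <- instN_up in A. exact A.
    + intros [t A]. exists (hcls t). apply (IHp _ _ _ (Hup _ _ t E)).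
      rewrite <- instN_up. exact A.
  - rewrite henkin_AllSet. split; intros A.
    + intros X. change (subst sg (scons 0 (fun j => S (sigma j))) p)
        with (subst sg (upS sigma) p). rewrite instS_up.
      apply (IHp _ _ _ E), A.
    + intros X. apply (IHp _ _ _ E). rewrite <- instS_up. apply A.
  - rewrite henkin_ExSet. split.
    + intros [X A]. exists X. apply (IHp _ _ _ E) in A. rewrite <- instS_up in A. exact A.
    + intros [X A]. exists X. apply (IHp _ _ _ E). rewrite <- instS_up. exact A.
Qed.

Lemma hmodel_holds : holds hmodel T.
Proof.
  intros p Hp rho sigma. apply (truth p rho (fun i => hrepr (rho i))).
  - intros i; apply hcls_hrepr.
  - apply (henkin_prv []); auto. now apply prv_ax_subst.
Qed.

Lemma hmodel_refutes : ~ sat hmodel (fun i => hcls (TVar i)) (fun j => j) p0.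
Proof.
  rewrite (truth p0 _ TVar) by trivial. rewrite subst_id.
  apply henkin_Not. exists 0; now left.
Qed.
End Henkin.

Theorem completeness T p :
  (forall M, holds M T -> forall rho sigma, sat M rho sigma p) -> prv T [] p.
Proof.
  intros A. apply NNPP; intros B.
  exact (hmodel_refutes T p B (A _ (hmodel_holds T p B) _ _)).
Qed.

Lemma equivalent_of_models T S S' :
  (forall M, holds M T -> (holds M S <-> holds M S')) ->
  provably_equivalent_over T S S'.
Proof.
  intros A.
  assert (B : forall U U', (forall M, holds M T -> holds M U -> holds M U') ->
    proves (extend T U) U').
  { intros U U' C p Hp. apply completeness. intros M HM. apply (C M); trivial.
    - intros q Hq. now apply HM; left.
    - intros q Hq. now apply HM; right. }
  split; apply B; intros M HM; now apply A.
Qed.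

(** * Satisfaction and substitution *)

Lemma eval_tsubst M rho sg t :
  eval M rho (tsubst sg t) = eval M (fun i => eval M rho (sg i)) t.
Proof. induction t; simpl; congruence. Qed.

Lemma sat_subst M p : forall rho sigma sg rh,
  sat M rho sigma (subst sg rh p)
  <-> sat M (fun i => eval M rho (sg i)) (fun j => sigma (rh j)) p.
Proof.
  assert (HN : forall rho x sg, (fun i => eval M (scons x rho) (up sg i))
     = scons x (fun i => eval M rho (sg i))).
  { intros; extensionality i; destruct i; simpl; trivial.
    unfold tshift; now rewrite eval_tsubst. }
  assert (HS : forall sigma (X : sets M) rh, (fun j => scons X sigma (upS rh j))
     = scons X (fun j => sigma (rh j))).
  { intros; extensionality j; now destruct j. }
  induction p; intros rho sigma sg rh; simpl; rewrite ?eval_tsubst;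
    rewrite ?IHp1, ?IHp2; try tauto.
  1,2: fold (up sg). 3,4: fold (upS rh).
  - split; intros A x; specialize (A x);
      [rewrite IHp, HN in A | rewrite IHp, HN]; exact A.
  - split; intros [x A]; exists x;
      [rewrite IHp, HN in A | rewrite IHp, HN]; exact A.
  - split; intros A x; specialize (A x);
      [rewrite IHp, HS in A | rewrite IHp, HS]; exact A.
  - split; intros [x A]; exists x;
      [rewrite IHp, HS in A | rewrite IHp, HS]; exact A.
Qed.

(** This substitution is the one produced by [plug] with two number arguments below [d] number and
    [e] set quantifiers; [rho] and [sigma] value the parameters of the schema instance. *)
Lemma sat_args M p rho sigma rho' sigma' t u d e :
  (forall i, rho' (i + d) = rho i) -> (forall j, sigma' (j + e) = sigma j) ->
  sat M rho' sigma' (subst (scons t (scons u (fun i => TVar (i + d)))) (fun j => j + e) p)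
  <-> sat M (scons (eval M rho' t) (scons (eval M rho' u) rho)) sigma p.
Proof.
  intros Hr Hs. rewrite sat_subst.
  replace (fun j => sigma' (j + e)) with sigma by now extensionality j.
  replace (fun i => _) with (scons (eval M rho' t) (scons (eval M rho' u) rho)); [tauto|].
  extensionality i; destruct i as [|[|i]]; simpl; trivial. symmetry; apply Hr.
Qed.

(** * Bounded formulas over a model *)

Section Definability.
Variable M : model.
Notation D := (dom M).
Notation env := (nat -> dom M).

(** Semantic counterparts of terms and bounded formulas, with elements and sets of the model as
    parameters. Definability is then shown by applying constructors to Rocq predicates, and
    [isD0_representable] leads back to formulas. *)
Inductive isTm : (env -> D) -> Prop :=
| isTm_var i : isTm (fun r => r i)
| isTm_const d : isTm (fun _ => d)
| isTm_add f g : isTm f -> isTm g -> isTm (fun r => madd M (f r) (g r))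
| isTm_mul f g : isTm f -> isTm g -> isTm (fun r => mmul M (f r) (g r)).

(** The second argument of the predicate is a set variable, needed for
    formulas about a real; in most uses it is dummy. *)
Inductive isD0 : (env -> sets M -> Prop) -> Prop :=
| isD0_eq f g : isTm f -> isTm g -> isD0 (fun r _ => f r = g r)
| isD0_lt f g : isTm f -> isTm g -> isD0 (fun r _ => mlt M (f r) (g r))
| isD0_mem f X : isTm f -> isD0 (fun r _ => mmem M (f r) X)
| isD0_memvar f : isTm f -> isD0 (fun r s => mmem M (f r) s)
| isD0_false : isD0 (fun _ _ => False)
| isD0_imp P Q : isD0 P -> isD0 Q -> isD0 (fun r s => P r s -> Q r s)
| isD0_and P Q : isD0 P -> isD0 Q -> isD0 (fun r s => P r s /\ Q r s)
| isD0_or P Q : isD0 P -> isD0 Q -> isD0 (fun r s => P r s \/ Q r s)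
| isD0_ball f P : isTm f -> isD0 (fun r s => P (fun i => r (S i)) s (r 0)) ->
    isD0 (fun r s => forall x, mlt M x (f r) -> P r s x)
| isD0_bex f P : isTm f -> isD0 (fun r s => P (fun i => r (S i)) s (r 0)) ->
    isD0 (fun r s => exists x, mlt M x (f r) /\ P r s x)
| isD0_ext P Q : (forall r s, P r s <-> Q r s) -> isD0 P -> isD0 Q.

Lemma isTm_subst f (F : nat -> env -> D) :
  (forall i, isTm (F i)) -> isTm f -> isTm (fun r => f (fun i => F i r)).
Proof. intros HF; induction 1; [apply HF|constructor..]; assumption. Qed.

Lemma isTm_shift f : isTm f -> isTm (fun r => f (fun i => r (S i))).
Proof. apply (isTm_subst f (fun i r => r (S i))). intros; constructor. Qed.

Lemma isTm_up (F : nat -> env -> D) : (forall i, isTm (F i)) ->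
  forall i, isTm (scons (fun r => r 0) (fun i r => F i (fun j => r (S j))) i).
Proof. intros HF [|i]; simpl; [constructor|]. now apply isTm_shift. Qed.

Lemma isD0_subst P : isD0 P -> forall F : nat -> env -> D,
  (forall i, isTm (F i)) -> isD0 (fun r s => P (fun i => F i r) s).
Proof.
  induction 1; intros F HF.
  - apply isD0_eq; now apply isTm_subst.
  - apply isD0_lt; now apply isTm_subst.
  - apply isD0_mem; now apply isTm_subst.
  - apply isD0_memvar; now apply isTm_subst.
  - apply isD0_false.
  - apply isD0_imp; auto.
  - apply isD0_and; auto.
  - apply isD0_or; auto.
  - apply (isD0_ball (fun r => f (fun i => F i r)) (fun r s => P (fun i => F i r) s));
      [now apply isTm_subst|]. exact (IHisD0 _ (isTm_up F HF)).
  - apply (isD0_bex (fun r => f (fun i => F i r)) (fun r s => P (fun i => F i r) s));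
      [now apply isTm_subst|]. exact (IHisD0 _ (isTm_up F HF)).
  - eapply isD0_ext; [|apply IHisD0, HF]. intros; apply H.
Qed.

Lemma scons_eval (f : env -> D) (F : nat -> env -> D) r :
  (fun i => scons f F i r) = scons (f r) (fun i => F i r).
Proof. extensionality i; now destruct i. Qed.

Lemma isD0_scons P f F : isD0 P -> isTm f -> (forall i, isTm (F i)) ->
  isD0 (fun r s => P (scons (f r) (fun i => F i r)) s).
Proof.
  intros HP Hf HF. assert (HF' : forall i, isTm (scons f F i)) by (intros [|i]; simpl; auto).
  apply (isD0_ext (fun r s => P (fun i => scons f F i r) s)).
  - intros; now rewrite scons_eval.
  - now apply isD0_subst.
Qed.

Lemma isD0_scons2 P f g F : isD0 P -> isTm f -> isTm g -> (forall i, isTm (F i)) ->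
  isD0 (fun r s => P (scons (f r) (scons (g r) (fun i => F i r))) s).
Proof.
  intros HP Hf Hg HF. assert (HF' : forall i, isTm (scons g F i)) by (intros [|i]; simpl; auto).
  apply (isD0_ext (fun r s => P (scons (f r) (fun i => scons g F i r)) s)).
  - intros; now rewrite scons_eval.
  - now apply isD0_scons.
Qed.

(** Variables below [N] are arguments, the others are parameters. *)
Definition envcat (N : nat) (r rho : env) : env :=
  fun i => if i <? N then r i else rho (i - N).

(** Set index 0 is the distinguished set variable, so the set parameters start at index 1. The
    threshold [N] is explicit because two formulas must share it before they can be combined. *)
Definition rep N rho sigma P phi : Prop :=
  Delta0 phi /\ forall r s, sat M (envcat N r rho) (scons s sigma) phi <-> P r s.

Definition trep N rho f t : Prop := forall r, eval M (envcat N r rho) t = f r.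

Lemma Delta0_subst p : Delta0 p -> forall sg rh, Delta0 (subst sg rh p).
Proof.
  assert (E : forall sg t, tsubst (up sg) (tshift t) = tshift (tsubst sg t)).
  { intros; unfold tshift; now rewrite !tsubst_comp. }
  induction 1; intros sg rh; try (simpl; constructor; auto; fail).
  - cbn. fold (up sg). rewrite E. constructor; auto.
  - cbn. fold (up sg). rewrite E. constructor; auto.
Qed.

Definition ren (N N' : nat) (f : nat -> nat) (i : nat) : term :=
  TVar (if i <? N then i else N' + f (i - N)).

(** Merges the parameters of two formulas: those of the first go to even positions, those of the
    second to odd ones, and [ren] and [renS] redirect the variables accordingly. *)
Definition mix {A} (f g : nat -> A) (i : nat) : A :=
  if Nat.even i then f (Nat.div2 i) else g (Nat.div2 i).

Lemma mix_even {A} (f g : nat -> A) i : mix f g (2 * i) = f i.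
Proof. unfold mix. now rewrite Nat.even_mul, Nat.div2_double. Qed.

Lemma mix_odd {A} (f g : nat -> A) i : mix f g (S (2 * i)) = g i.
Proof.
  unfold mix. now rewrite Nat.even_succ, Nat.odd_mul, Nat.div2_succ_double.
Qed.

Definition renS (g : nat -> nat) : nat -> nat := scons 0 (fun j => S (g j)).

Lemma trep_ren N rho f t N' rho' g : trep N rho f t -> N <= N' ->
  (forall i, rho' (g i) = rho i) -> trep N' rho' f (tsubst (ren N N' g) t).
Proof.
  intros Ht HN Hg r. rewrite eval_tsubst, <- Ht. f_equal.
  extensionality i. unfold ren, envcat; simpl.
  destruct (Nat.ltb_spec i N).
  - destruct (Nat.ltb_spec i N'); [auto|lia].
  - destruct (Nat.ltb_spec (N' + g (i - N)) N'); [lia|].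
    replace (N' + g (i - N) - N') with (g (i - N)) by lia. apply Hg.
Qed.

Lemma rep_ren N rho sigma P p N' rho' sigma' g h : rep N rho sigma P p -> N <= N' ->
  (forall i, rho' (g i) = rho i) -> (forall j, sigma' (h j) = sigma j) ->
  rep N' rho' sigma' P (subst (ren N N' g) (renS h) p).
Proof.
  intros [Hp HP] HN Hg Hh. split; [now apply Delta0_subst|].
  intros r s. rewrite sat_subst, <- HP.
  replace (fun j => scons s sigma' (renS h j)) with (scons s sigma).
  2: { extensionality j; destruct j; simpl; auto. }
  replace (fun i => eval M _ _) with (envcat N r rho); [tauto|].
  extensionality i. unfold ren, envcat; simpl.
  destruct (Nat.ltb_spec i N).
  - destruct (Nat.ltb_spec i N'); [auto|lia].
  - destruct (Nat.ltb_spec (N' + g (i - N)) N'); [lia|].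
    replace (N' + g (i - N) - N') with (g (i - N)) by lia. now rewrite Hg.
Qed.

Definition representable P := exists N rho sigma p, rep N rho sigma P p.
Definition trepresentable f := exists N rho t, trep N rho f t.

Lemma rep_raise P : representable P -> exists N rho sigma, forall N', N <= N' ->
  exists p, rep N' rho sigma P p.
Proof.
  intros (N & rho & sigma & p & Hp). exists N, rho, sigma. intros N' HN. eexists.
  apply (rep_ren _ _ _ _ _ N' rho sigma (fun i => i) (fun i => i) Hp HN); auto.
Qed.

Lemma trep_common f g : trepresentable f -> trepresentable g ->
  exists N rho, forall N', N <= N' -> exists t u, trep N' rho f t /\ trep N' rho g u.
Proof.
  intros (N1 & rho1 & t1 & H1) (N2 & rho2 & t2 & H2).
  exists (N1 + N2), (mix rho1 rho2). intros N' HN.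
  do 2 eexists; split.
  - apply (trep_ren _ _ _ _ N' _ (fun i => 2 * i) H1); [lia|]. intros; apply mix_even.
  - apply (trep_ren _ _ _ _ N' _ (fun i => S (2 * i)) H2); [lia|]. intros; apply mix_odd.
Qed.

Lemma trep_rep_common f P : trepresentable f -> representable P ->
  exists N rho sigma, forall N', N <= N' ->
  exists t p, trep N' rho f t /\ rep (S N') rho sigma P p.
Proof.
  intros (N1 & rho1 & t1 & H1) (N2 & rho2 & sigma & p & H2).
  exists (N1 + N2), (mix rho1 rho2), sigma. intros N' HN.
  do 2 eexists; split.
  - apply (trep_ren _ _ _ _ N' _ (fun i => 2 * i) H1); [lia|]. intros; apply mix_even.
  - apply (rep_ren _ _ _ _ _ (S N') _ sigma (fun i => S (2 * i)) (fun i => i) H2);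
    [lia| |auto]. intros; apply mix_odd.
Qed.

Lemma rep_common P Q : representable P -> representable Q ->
  exists N rho sigma, forall N', N <= N' ->
  exists p q, rep N' rho sigma P p /\ rep N' rho sigma Q q.
Proof.
  intros (N1 & rho1 & sigma1 & p1 & H1) (N2 & rho2 & sigma2 & p2 & H2).
  exists (N1 + N2), (mix rho1 rho2), (mix sigma1 sigma2). intros N' HN.
  do 2 eexists; split.
  - apply (rep_ren _ _ _ _ _ N' _ _ (fun i => 2 * i) (fun i => 2 * i) H1);
    [lia| |]; intros; apply mix_even.
  - apply (rep_ren _ _ _ _ _ N' _ _ (fun i => S (2 * i)) (fun i => S (2 * i)) H2);
    [lia| |]; intros; apply mix_odd.
Qed.

Lemma isTm_trepresentable f : isTm f -> trepresentable f.
Proof.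
  induction 1.
  - exists (S i), (fun _ => mzero M), (TVar i). intros r; unfold envcat; simpl.
    destruct (Nat.ltb_spec i (S i)); [auto|lia].
  - exists 0, (fun _ => d), (TVar 0). now intros r.
  - destruct (trep_common f g) as (N & rho & E); trivial.
    destruct (E N (le_n _)) as (t & u & Ht & Hu).
    exists N, rho, (TAdd t u). intros r; simpl; now rewrite Ht, Hu.
  - destruct (trep_common f g) as (N & rho & E); trivial.
    destruct (E N (le_n _)) as (t & u & Ht & Hu).
    exists N, rho, (TMul t u). intros r; simpl; now rewrite Ht, Hu.
Qed.

Lemma envcat_scons N x r rho : scons x (envcat N r rho) = envcat (S N) (scons x r) rho.
Proof.
  extensionality i. unfold envcat. now destruct i.
Qed.

Lemma eval_tshift rho x t : eval M (scons x rho) (tshift t) = eval M rho t.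
Proof. unfold tshift; now rewrite eval_tsubst. Qed.

(** The set [s0] fills the set valuation wherever no parameter is prescribed. *)
Lemma isD0_representable (s0 : sets M) P : isD0 P -> representable P.
Proof.
  induction 1.
  - destruct (trep_common f g) as (N & rho & E); auto using isTm_trepresentable.
    destruct (E N (le_n _)) as (t & u & Ht & Hu).
    exists N, rho, (fun _ => s0), (Eq t u). split; [constructor|].
    intros; simpl; now rewrite Ht, Hu.
  - destruct (trep_common f g) as (N & rho & E); auto using isTm_trepresentable.
    destruct (E N (le_n _)) as (t & u & Ht & Hu).
    exists N, rho, (fun _ => s0), (Lt t u). split; [constructor|].
    intros; simpl; now rewrite Ht, Hu.
  - destruct (isTm_trepresentable f H) as (N & rho & t & Ht).
    exists N, rho, (fun _ => X), (Mem t 1). split; [constructor|].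
    intros; simpl; now rewrite Ht.
  - destruct (isTm_trepresentable f H) as (N & rho & t & Ht).
    exists N, rho, (fun _ => s0), (Mem t 0). split; [constructor|].
    intros; simpl; now rewrite Ht.
  - exists 0, (fun _ => mzero M), (fun _ => s0), Bot. split; [constructor|]. simpl; tauto.
  - destruct (rep_common P Q) as (N & rho & sigma & E); trivial.
    destruct (E N (le_n _)) as (p & q & [Hp HP] & [Hq HQ]).
    exists N, rho, sigma, (Imp p q). split; [now constructor|].
    intros; simpl; now rewrite HP, HQ.
  - destruct (rep_common P Q) as (N & rho & sigma & E); trivial.
    destruct (E N (le_n _)) as (p & q & [Hp HP] & [Hq HQ]).
    exists N, rho, sigma, (And p q). split; [now constructor|].
    intros; simpl; now rewrite HP, HQ.
  - destruct (rep_common P Q) as (N & rho & sigma & E); trivial.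
    destruct (E N (le_n _)) as (p & q & [Hp HP] & [Hq HQ]).
    exists N, rho, sigma, (Or p q). split; [now constructor|].
    intros; simpl; now rewrite HP, HQ.
  - destruct (trep_rep_common f _ (isTm_trepresentable f H) IHisD0) as (N & rho & sigma & E).
    destruct (E N (le_n _)) as (t & p & Ht & [Hp HP]).
    exists N, rho, sigma, (AllNum (Imp (Lt (TVar 0) (tshift t)) p)).
    split; [now constructor|]. intros r s; simpl.
    split; intros A x; specialize (A x); rewrite eval_tshift, Ht, envcat_scons, HP in *; exact A.
  - destruct (trep_rep_common f _ (isTm_trepresentable f H) IHisD0) as (N & rho & sigma & E).
    destruct (E N (le_n _)) as (t & p & Ht & [Hp HP]).
    exists N, rho, sigma, (ExNum (And (Lt (TVar 0) (tshift t)) p)).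
    split; [now constructor|]. intros r s; simpl.
    split; intros [x A]; exists x; rewrite eval_tshift, Ht, envcat_scons, HP in *; exact A.
  - destruct IHisD0 as (N & rho & sigma & p & Hp & HP).
    exists N, rho, sigma, p. split; trivial. intros; now rewrite HP.
Qed.

Lemma isTm_eval (F : nat -> env -> D) t :
  (forall i, isTm (F i)) -> isTm (fun r => eval M (fun i => F i r) t).
Proof. intros HF; induction t; simpl; try constructor; auto. Qed.

(** In the set environment [tau], [None] is the distinguished set variable. *)
Lemma Delta0_isD0 p : Delta0 p ->
  forall (F : nat -> env -> D) (tau : nat -> option (sets M)), (forall i, isTm (F i)) ->
  isD0 (fun r s => sat M (fun i => F i r)
    (fun j => match tau j with Some X => X | None => s end) p).
Proof.
  assert (E : forall (F : nat -> env -> D) x r,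
    (fun i => scons (fun r => r 0) (fun i r => F i (fun j => r (S j))) i (scons x r))
    = scons x (fun i => F i r)).
  { intros; extensionality i; now destruct i. }
  induction 1; intros F tau HF; simpl.
  - apply isD0_eq; now apply isTm_eval.
  - apply isD0_lt; now apply isTm_eval.
  - destruct (tau X).
    + apply isD0_mem; now apply isTm_eval.
    + apply isD0_memvar; now apply isTm_eval.
  - apply isD0_false.
  - apply isD0_imp; auto.
  - apply isD0_and; auto.
  - apply isD0_or; auto.
  - eapply isD0_ext, (isD0_ball (fun r => eval M (fun i => F i r) t)
     (fun r s x => sat M (scons x (fun i => F i r))
       (fun j => match tau j with Some X => X | None => s end) p)).
    + intros r s; simpl. split; intros A x; specialize (A x); now rewrite eval_tshift in *.
    + now apply isTm_eval.
    + eapply isD0_ext; [|exact (IHDelta0 _ tau (isTm_up F HF))]. intros r s; simpl.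
      replace (fun i => _) with (scons (r 0) (fun i => F i (fun j => r (S j)))); [tauto|].
      extensionality i; now destruct i.
  - eapply isD0_ext, (isD0_bex (fun r => eval M (fun i => F i r) t)
     (fun r s x => sat M (scons x (fun i => F i r))
       (fun j => match tau j with Some X => X | None => s end) p)).
    + intros r s; simpl. split; intros [x A]; exists x; now rewrite eval_tshift in *.
    + now apply isTm_eval.
    + eapply isD0_ext; [|exact (IHDelta0 _ tau (isTm_up F HF))]. intros r s; simpl.
      replace (fun i => _) with (scons (r 0) (fun i => F i (fun j => r (S j)))); [tauto|].
      extensionality i; now destruct i.
Qed.

(** As in the schemas, [p] and [p'] take the free variable [n] first; [Q] and [Q']
    take the quantified variable [m] first. *)
Lemma isD0_matrices (s0 : sets M) (Q Q' : env -> Prop) :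
  isD0 (fun r _ => Q r) -> isD0 (fun r _ => Q' r) ->
  exists rho sigma p p', (Delta0 p /\ Delta0 p') /\ forall n m,
    (sat M (scons n (scons m rho)) sigma p <-> Q (scons m (scons n (fun _ => mzero M)))) /\
    (sat M (scons n (scons m rho)) sigma p' <-> Q' (scons m (scons n (fun _ => mzero M)))).
Proof.
  intros HQ HQ'.
  assert (H : forall P, isD0 (fun r _ => P r) ->
    isD0 (fun r _ => P (scons (r 1) (scons (r 0) (fun _ => mzero M))))).
  { intros P HP. apply (isD0_scons2 _ (fun r => r 1) (fun r => r 0) (fun _ _ => mzero M) HP);
      repeat constructor. }
  destruct (rep_common _ _ (isD0_representable s0 _ (H _ HQ))
    (isD0_representable s0 _ (H _ HQ'))) as (N & rho & sigma & E).
  destruct (E (N + 2) (Nat.le_add_r _ _)) as (p & p' & [Dp Ep] & [Dp' Ep']).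
  exists (fun i => envcat (N + 2) (fun _ => mzero M) rho (S (S i))), (scons s0 sigma), p, p'.
  split; [now split|]. intros n m.
  replace (scons n _) with (envcat (N + 2) (scons n (scons m (fun _ => mzero M))) rho).
  - split; [apply Ep | apply Ep'].
  - extensionality i. unfold envcat. destruct i as [|[|i]]; simpl;
      destruct (Nat.ltb_spec 0 (N + 2)), (Nat.ltb_spec 1 (N + 2)); trivial; lia.
Qed.

(** The representing formula has [N] arguments. Dependence on finitely many variables is what later
    allows an environment to be coded by a single number. *)
Lemma isD0_finite P : isD0 P -> exists N, forall r r' s,
  (forall i, i < N -> r i = r' i) -> P r s <-> P r' s.
Proof.
  intros HP. 
  destruct (classic (exists s : sets M, True)) as [[s0 _]|ns].
  2: { exists 0; intros r r' s; exfalso; apply ns; now exists s. }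
  destruct (isD0_representable s0 P HP) as (N & rho & sigma & p & _ & E).
  exists N. intros r r' s Hr. rewrite <- !E.
  replace (envcat N r rho) with (envcat N r' rho); [tauto|].
  extensionality i; unfold envcat. destruct (Nat.ltb_spec i N); trivial. now rewrite Hr.
Qed.

End Definability.

From HB Require Import structures.
From mathcomp Require Import ssreflect ssrfun ssrbool eqtype ssrnat choice order
  ssralg ssrnum fraction generic_quotient.
From mathcomp Require Import boolp.
From Stdlib Require Import Ring.
Import Order.TTheory GRing.Theory Num.Theory.

Set Implicit Arguments.
Unset Strict Implicit.
Unset Printing Implicit Defensive.

(** * The ordered field of a model of arithmetic *)

Notation "x +' y" := (madd _ x y) (at level 50, left associativity).
Notation "x *' y" := (mmul _ x y) (at level 40, left associativity).
Notation "x <' y" := (mlt _ x y) (at level 70, no associativity).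

Record pa_minus (M : model) : Prop := PaMinus {
  paddA : forall x y z : dom M, (x +' y) +' z = x +' (y +' z);
  paddC : forall x y : dom M, x +' y = y +' x;
  pmulA : forall x y z : dom M, (x *' y) *' z = x *' (y *' z);
  pmulC : forall x y : dom M, x *' y = y *' x;
  pmulDr : forall x y z : dom M, x *' (y +' z) = (x *' y) +' (x *' z);
  padd0 : forall x : dom M, x +' mzero M = x /\ x *' mzero M = mzero M;
  pmul1 : forall x : dom M, x *' mone M = x;
  plt_trans : forall x y z : dom M, x <' y /\ y <' z -> x <' z;
  pltxx : forall x : dom M, ~ x <' x;
  plt_total : forall x y : dom M, x <' y \/ x = y \/ y <' x;
  plt_add : forall x y z : dom M, x <' y -> x +' z <' y +' z;
  plt_mul : forall x y z : dom M, mzero M <' z /\ x <' y -> x *' z <' y *' z;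
  plt_sub : forall x y : dom M, x <' y -> exists z, x +' z = y;
  p01 : mzero M <' mone M /\
    forall x : dom M, mzero M <' x -> mone M <' x \/ mone M = x;
  pge0 : forall x : dom M, mzero M <' x \/ mzero M = x }.

Lemma holds_pa_minus M (s0 : sets M) : holds M RCA0 -> pa_minus M.
Proof.
move=> H.
have ax p : In p PA_minus -> sat M (fun=> mzero M) (fun=> s0) p.
  by move=> Hp; apply: H; constructor.
constructor.
- exact: (ax _ (or_introl erefl)).
- exact: (ax _ (or_intror (or_introl erefl))).
- exact: (ax _ (or_intror (or_intror (or_introl erefl)))).
- exact: (ax _ (or_intror (or_intror (or_intror (or_introl erefl))))).
- exact: (ax (nth 4 PA_minus Bot) ltac:(simpl; tauto)).
- exact: (ax (nth 5 PA_minus Bot) ltac:(simpl; tauto)).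
- exact: (ax (nth 6 PA_minus Bot) ltac:(simpl; tauto)).
- exact: (ax (nth 7 PA_minus Bot) ltac:(simpl; tauto)).
- exact: (ax (nth 8 PA_minus Bot) ltac:(simpl; tauto)).
- exact: (ax (nth 9 PA_minus Bot) ltac:(simpl; tauto)).
- exact: (ax (nth 10 PA_minus Bot) ltac:(simpl; tauto)).
- exact: (ax (nth 11 PA_minus Bot) ltac:(simpl; tauto)).
- exact: (ax (nth 12 PA_minus Bot) ltac:(simpl; tauto)).
- exact: (ax (nth 13 PA_minus Bot) ltac:(simpl; tauto)).
- exact: (ax (nth 14 PA_minus Bot) ltac:(simpl; tauto)).
Qed.

(** The ordered field of fractions of the ring of differences of a model of
    PA-. *)
Record pamodel := PaModel { pam :> model; pamP : pa_minus pam }.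

Section Integers.
Variable M : pamodel.
Notation D := (dom (pam M)).
Let H := pamP M.

Lemma dsemi : Ring_theory.semi_ring_theory (mzero M) (mone M) (@madd M) (@mmul M) (@Logic.eq D).
Proof.
constructor.
- by move=> x; rewrite (paddC H); case: (padd0 H x).
- exact: paddC H.
- by move=> x y z; rewrite (paddA H).
- by move=> x; rewrite (pmulC H) (pmul1 H).
- by move=> x; rewrite (pmulC H); case: (padd0 H x).
- exact: pmulC H.
- by move=> x y z; rewrite (pmulA H).
- by move=> x y z; rewrite ![_ *' z](pmulC H) (pmulDr H).
Qed.
Add Ring dring : dsemi.

Lemma dadd_cancel (x y z : D) : x +' z = y +' z -> x = y.
Proof.
move=> E; case: (plt_total H x y) => [L|[//|L]];
  by move/(plt_add H z): L; rewrite E => /(pltxx H).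
Qed.

Lemma dmul_eq0 (x y : D) : x *' y = mzero M -> x = mzero M \/ y = mzero M.
Proof.
case: (pge0 H x) => [x0|<-]; last by left.
case: (pge0 H y) => [y0|<-]; last by right.
move=> E; have := plt_mul H (conj y0 x0).
have -> : mzero M *' y = mzero M by ring.
by rewrite E => /(pltxx H).
Qed.

Definition zeqv (p q : D * D) : Prop := p.1 +' q.2 = q.1 +' p.2.

Lemma zeqv_trans p q r : zeqv p q -> zeqv q r -> zeqv p r.
Proof.
rewrite /zeqv => E1 E2; apply: (@dadd_cancel _ _ (q.2 +' q.1)).
transitivity ((p.1 +' q.2) +' (q.1 +' r.2)); first by ring.
by rewrite E1 E2; ring.
Qed.

(** Pairs up to equality of formal differences. A class is a predicate, so that equality of classes
    is Leibniz equality, as the algebraic structures require. *)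
Record zint := Zint { zset : D * D -> Prop; zsetP : exists p, zset = zeqv p }.
Definition zmk p := @Zint (zeqv p) (ex_intro _ p erefl).

Lemma zmk_eq p q : zmk p = zmk q <-> zeqv p q.
Proof.
split=> [[E]|E]; first by have : zeqv p q by rewrite E /zeqv; ring.
have {}E : zeqv p = zeqv q.
  apply: funext => r; apply: propext; split; last exact: zeqv_trans.
  by apply: zeqv_trans; rewrite /zeqv E.
rewrite /zmk; move: (ex_intro _ p _); rewrite E => e; congr Zint; exact: Prop_irrelevance.
Qed.

Lemma zmkP z : exists p, z = zmk p.
Proof.
case: z => S [p E]; exists p; subst S.
by [].
Qed.

Definition zpick z := sval (cid (zmkP z)).
Lemma zpickK z : z = zmk (zpick z).
Proof. exact: svalP (cid (zmkP z)). Qed.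

Definition zadd z w := zmk ((zpick z).1 +' (zpick w).1, (zpick z).2 +' (zpick w).2).
Definition zopp z := zmk ((zpick z).2, (zpick z).1).
Definition zmul z w :=
  zmk ((zpick z).1 *' (zpick w).1 +' (zpick z).2 *' (zpick w).2,
       (zpick z).1 *' (zpick w).2 +' (zpick z).2 *' (zpick w).1).

Lemma zpick_mk p : zeqv (zpick (zmk p)) p.
Proof. by apply/zmk_eq; rewrite -zpickK. Qed.

Lemma zaddE p q : zadd (zmk p) (zmk q) = zmk (p.1 +' q.1, p.2 +' q.2).
Proof.
apply/zmk_eq; rewrite /zeqv /=; move: (zpick_mk p) (zpick_mk q).
move: (zpick (zmk p)) (zpick (zmk q)) => p' q'; rewrite /zeqv => E1 E2.
transitivity ((p'.1 +' p.2) +' (q'.1 +' q.2)); first by ring.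
by rewrite E1 E2; ring.
Qed.

Lemma zoppE p : zopp (zmk p) = zmk (p.2, p.1).
Proof.
apply/zmk_eq; rewrite /zeqv /=; move: (zpick_mk p); rewrite /zeqv => E.
transitivity (p.1 +' (zpick (zmk p)).2); first by ring.
by rewrite -E; ring.
Qed.

Lemma zmulE p q : zmul (zmk p) (zmk q) =
  zmk (p.1 *' q.1 +' p.2 *' q.2, p.1 *' q.2 +' p.2 *' q.1).
Proof.
apply/zmk_eq; move: (zpick_mk p) (zpick_mk q).
move: (zpick (zmk p)) (zpick (zmk q)) => p' q' E1 E2.
apply: (@zeqv_trans _ (p'.1 *' q.1 +' p'.2 *' q.2, p'.1 *' q.2 +' p'.2 *' q.1)).
  rewrite /zeqv /= in E1 E2 *.
  transitivity (p'.1 *' (q'.1 +' q.2) +' p'.2 *' (q.1 +' q'.2)); first by ring.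
  by rewrite E2 -{2}E2; ring.
rewrite /zeqv /= in E1 E2 *.
transitivity (q.1 *' (p'.1 +' p.2) +' q.2 *' (p.1 +' p'.2)); first by ring.
by rewrite E1 -{2}E1; ring.
Qed.

HB.instance Definition _ := gen_eqMixin zint.
HB.instance Definition _ := gen_choiceMixin zint.

Definition zof (a : D) := zmk (a, mzero M).

Fact zaddA : associative zadd.
Proof.
move=> x y z; case: (zmkP x) (zmkP y) (zmkP z) => p -> [q ->] [r ->].
by rewrite !zaddE /=; congr (zmk (_, _)); ring.
Qed.
Fact zaddC : commutative zadd.
Proof.
move=> x y; case: (zmkP x) (zmkP y) => p -> [q ->].
by rewrite !zaddE /=; congr (zmk (_, _)); ring.
Qed.
Fact zadd0 : left_id (zof (mzero M)) zadd.
Proof.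
move=> x; case: (zmkP x) => [[a b] ->].
by rewrite !zaddE /=; congr (zmk (_, _)); ring.
Qed.
Fact zaddN : left_inverse (zof (mzero M)) zopp zadd.
Proof.
move=> x; case: (zmkP x) => p ->.
by rewrite zoppE zaddE; apply/zmk_eq; rewrite /zeqv /=; ring.
Qed.
HB.instance Definition _ := GRing.isZmodule.Build zint zaddA zaddC zadd0 zaddN.

Fact zmulA : associative zmul.
Proof.
move=> x y z; case: (zmkP x) (zmkP y) (zmkP z) => p -> [q ->] [r ->].
by rewrite !zmulE /=; congr (zmk (_, _)); ring.
Qed.
Fact zmulC : commutative zmul.
Proof.
move=> x y; case: (zmkP x) (zmkP y) => p -> [q ->].
by rewrite !zmulE /=; congr (zmk (_, _)); ring.
Qed.
Fact zmul1 : left_id (zof (mone M)) zmul.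
Proof.
move=> x; case: (zmkP x) => [[a b] ->].
by rewrite !zmulE /=; congr (zmk (_, _)); ring.
Qed.
Fact zmulDl : left_distributive zmul zadd.
Proof.
move=> x y z; case: (zmkP x) (zmkP y) (zmkP z) => p -> [q ->] [r ->].
by rewrite (zaddE p q) !zmulE zaddE /=; congr (zmk (_, _)); ring.
Qed.
Lemma zof_inj : injective zof.
Proof.
move=> a b /zmk_eq; rewrite /zeqv /= => /dadd_cancel; exact.
Qed.
Fact zone_neq0 : zof (mone M) != 0%R.
Proof.
apply/eqP => /zof_inj E; have [] := p01 H; rewrite E => /(pltxx H) [].
Qed.
HB.instance Definition _ :=
  GRing.Zmodule_isComNzRing.Build zint zmulA zmulC zmul1 zmulDl zone_neq0.

Lemma zofD a b : zof (a +' b) = (zof a + zof b)%R.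
Proof. by rewrite [RHS]zaddE; congr (zmk (_, _)) => /=; ring. Qed.
Lemma zofM a b : zof (a *' b) = (zof a * zof b)%R.
Proof. by rewrite [RHS]zmulE; congr (zmk (_, _)) => /=; ring. Qed.

(** The order of the model is total and a larger number can be reached by addition, so one of the
    two components can be subtracted from the other. Absence of zero divisors is thereby inherited
    from the model. *)
Lemma zsign (z : zint) : exists a : D, z = zof a \/ z = (- zof a)%R.
Proof.
have E (a b c : D) : a +' c = b -> zmk (a, b) = (- zof c)%R /\ zmk (b, a) = zof c.
  by move=> <-; split; [rewrite [RHS]zoppE|]; apply/zmk_eq; rewrite /zeqv /=; ring.
case: (zmkP z) => [[a b] ->]; case: (plt_total H a b) => [|[<-|]].
- by move/(plt_sub H) => [c /E [-> _]]; exists c; right.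
- by exists (mzero M); left; apply/zmk_eq; rewrite /zeqv /=; ring.
- by move/(plt_sub H) => [c /E [_ ->]]; exists c; left.
Qed.

Lemma zof_eq0 a : zof a = 0%R -> a = mzero M.
Proof. by move=> E; apply: zof_inj. Qed.

Fact zmul_eq0 (x y : zint) : (x * y = 0)%R -> (x == 0%R) || (y == 0%R).
Proof.
case: (zsign x) => a Ea; case: (zsign y) => b Eb E.
have {}E : (zof a * zof b = 0)%R.
  by case: Ea Eb E => -> [->|->]; rewrite ?mulrNN ?mulNr ?mulrN // => /eqP;
    rewrite oppr_eq0 => /eqP.
move: E; rewrite -zofM => /zof_eq0 /dmul_eq0 [] E; rewrite E in Ea Eb.
  by apply/orP; left; case: Ea => ->; rewrite ?oppr_eq0 eqxx.
by apply/orP; right; case: Eb => ->; rewrite ?oppr_eq0 eqxx.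
Qed.

(** Invertibility is decided classically and inverses are chosen: the field of fractions is formed
    over an integral domain, whose structure includes its units. *)
Definition zunit : {pred zint} := fun x => `[< exists y : zint, (y * x = 1)%R >].
Definition zinv (x : zint) : zint :=
  match pselect (exists y : zint, (y * x = 1)%R) with
  | left e => sval (cid e) | right _ => x end.
Fact zmulV : {in zunit, left_inverse 1%R zinv *%R}.
Proof.
move=> x /asboolP e; rewrite /zinv; case: pselect => // e'; exact: svalP (cid e').
Qed.
Fact zunitP (x y : zint) : (y * x = 1)%R -> zunit x.
Proof. by move=> e; apply/asboolP; exists y. Qed.
Fact zinv_out : {in [predC zunit], zinv =1 id}.
Proof. by move=> x /asboolP e; rewrite /zinv; case: pselect. Qed.
HB.instance Definition _ := GRing.ComNzRing_hasMulInverse.Build zint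
  zmulV zunitP zinv_out.
HB.instance Definition _ := GRing.ComUnitRing_isIntegral.Build zint zmul_eq0.

Definition qfrac : Type := {fraction zint}.
HB.instance Definition _ := GRing.Field.on qfrac.

Local Open Scope ring_scope.

Definition qof (a : D) : qfrac := FracField.tofrac (zof a).

Lemma qofD a b : qof (a +' b) = qof a + qof b.
Proof. by rewrite /qof zofD tofracD. Qed.
Lemma qofM a b : qof (a *' b) = qof a * qof b.
Proof. by rewrite /qof zofM tofracM. Qed.
Lemma qof0 : qof (mzero M) = 0. Proof. exact: tofrac0. Qed.
Lemma qof1 : qof (mone M) = 1. Proof. exact: tofrac1. Qed.
Lemma qof_inj : injective qof.
Proof. by move=> a b /eqP; rewrite tofrac_eq => /eqP /zof_inj. Qed.

Lemma qof_neq0 a : mzero M <' a -> qof a != 0.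
Proof. by move=> a0; apply/eqP; rewrite -qof0 => /qof_inj E; move: a0; rewrite E => /(pltxx H). Qed.

Lemma fracP (x : qfrac) : exists z w : zint, w != 0 /\
  x = FracField.tofrac z / FracField.tofrac w.
Proof.
suff [z [w [w0 E]]] : exists z w : zint, w != 0 /\
    FracField.mul x (FracField.tofrac w) = FracField.tofrac z.
  exists z, w; split=> //; rewrite -E; apply/eqP.
  by rewrite [FracField.mul _ _]/(x * _) mulfK // tofrac_eq0.
elim/quotW: x => r; exists (frac r).1, (frac r).2; split; first exact: denom_ratioP.
rewrite !piE; apply/eqmodP; rewrite /= equivfE.
by rewrite !numden_Ratio ?(oner_eq0, mulf_neq0, denom_ratioP) // !mulr1 mulrC.
Qed.

Definition qge0 (x : qfrac) : Prop :=
  exists a b, mzero M <' b /\ x = qof a / qof b.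

Lemma qge0P x : qge0 x \/ qge0 (- x).
Proof.
have [z [w [w0 ->]]] := fracP x.
have [a Ea] := zsign z; have [b Eb] := zsign w.
have b0 : mzero M <' b.
  case: (pge0 H b) => // E; move/eqP: w0; case.
  by case: Eb => ->; rewrite -E ?[zof _]/0 ?oppr0.
by case: Ea Eb => -> [] ->; [left | right | right | left]; exists a, b; split=> //;
  rewrite ?tofracN ?invrN ?mulrNN ?mulNr ?mulrN ?opprK.
Qed.

Lemma dmul_gt0 (a b : D) : mzero M <' a -> mzero M <' b -> mzero M <' a *' b.
Proof.
move=> a0 b0; case: (pge0 H (a *' b)) => // E; case: (dmul_eq0 (esym E)) => E';
  by [move: a0; rewrite E' => /(pltxx H) | move: b0; rewrite E' => /(pltxx H)].
Qed.

Lemma qge0_add x y : qge0 x -> qge0 y -> qge0 (x + y).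
Proof.
move=> [a [b [b0 ->]]] [c [d [d0 ->]]].
exists (a *' d +' c *' b), (b *' d); split; first exact: dmul_gt0.
by rewrite qofD !qofM addf_div // qof_neq0.
Qed.

Lemma qge0_mul x y : qge0 x -> qge0 y -> qge0 (x * y).
Proof.
move=> [a [b [b0 ->]]] [c [d [d0 ->]]].
exists (a *' c), (b *' d); split; first exact: dmul_gt0.
by rewrite !qofM mulf_div.
Qed.

(** If a/b = -(c/d), then a d + c b = 0 is a sum of two numbers of the model; hence a d = 0 and, as
    d is positive, a = 0. *)
Lemma qge0_anti x : qge0 x -> qge0 (- x) -> x = 0.
Proof.
move=> [a [b [b0 ->]]] [c [d [d0 E]]].
have E' : qof (a *' d +' c *' b) = 0.
  have b1 := qof_neq0 b0; have d1 := qof_neq0 d0.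
  have : (qof a / qof b + qof c / qof d) = 0 by rewrite -E subrr.
  rewrite qofD !qofM addf_div // => /eqP.
  by rewrite mulf_eq0 invr_eq0 (negPf (mulf_neq0 b1 d1)) orbF => /eqP.
move: E'; rewrite -qof0 => /qof_inj E'.
have E2 : a *' d = mzero M.
  case: (pge0 H (a *' d)) => // /(plt_add H (c *' b)); rewrite E' => L.
  have := pge0 H (c *' b) => -[L'|L'].
    case: (pltxx H (x := mzero M)); apply: (plt_trans H (conj L' _)).
    by move: L; have -> : mzero M +' c *' b = c *' b by ring.
  move: L; rewrite -L'; have -> : mzero M +' mzero M = mzero M by ring.
  by move/(pltxx H).
case: (dmul_eq0 E2) => E3; first by rewrite E3 qof0 mul0r.
by move: d0; rewrite E3 => /(pltxx H).
Qed.

Definition fle (x y : qfrac) : bool := `[< qge0 (y - x) >].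
Definition flt (x y : qfrac) : bool := (y != x) && fle x y.
Definition qnorm (x : qfrac) : qfrac := if fle 0 x then x else - x.

Fact fle_add x y : fle 0 x -> fle 0 y -> fle 0 (x + y).
Proof. by rewrite /fle !subr0 => /asboolP ? /asboolP ?; apply/asboolP/qge0_add. Qed.
Fact fle_mul x y : fle 0 x -> fle 0 y -> fle 0 (x * y).
Proof. by rewrite /fle !subr0 => /asboolP ? /asboolP ?; apply/asboolP/qge0_mul. Qed.
Fact fle_anti x : fle 0 x -> fle x 0 -> x = 0.
Proof. by rewrite /fle subr0 sub0r => /asboolP ? /asboolP ?; apply: qge0_anti. Qed.
Fact qsub_ge0 x y : fle 0 (y - x) = fle x y.
Proof. by rewrite /fle subr0. Qed.
Fact fle_total x : fle 0 x || fle x 0.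
Proof.
by rewrite /fle subr0 sub0r; case: (qge0P x) => E; apply/orP; [left|right]; apply/asboolP.
Qed.
Fact qnormN x : qnorm (- x) = qnorm x.
Proof.
rewrite /qnorm; have := fle_total x; rewrite {1 2}/fle subr0 sub0r.
case: ifPn => A; case: ifPn => B //; rewrite ?opprK //.
- move=> _; suff -> : x = 0 by rewrite oppr0.
  by apply: qge0_anti; [move: B|move: A]; rewrite /fle subr0 => /asboolP.
- by move: A B; rewrite /fle !subr0 => /negPf -> /negPf ->.
Qed.
Fact qge0_norm x : fle 0 x -> qnorm x = x.
Proof. by rewrite /qnorm => ->. Qed.
Fact flt_def x y : flt x y = (y != x) && fle x y. Proof. by []. Qed.

HB.instance Definition _ := Num.IntegralDomain_isLeReal.Build qfrac
  fle_add fle_mul fle_anti qsub_ge0 fle_total qnormN qge0_norm flt_def.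

Lemma qof_lt (a b : D) : (a <' b) <-> (qof a < qof b).
Proof.
have L (x y : D) : x <' y -> qof x < qof y.
  move=> xy; have [z Ez] := plt_sub H xy; rewrite lt_neqAle; apply/andP; split.
    by apply/eqP => /qof_inj E; move: xy; rewrite E => /(pltxx H).
  apply/asboolP; exists z, (mone M); split; first by case: (p01 H).
  by rewrite -Ez qofD qof1 divr1 addrC addKr.
split=> [/L //|ab]; case: (plt_total H a b) => // -[E|/L]; last by rewrite ltNge ltW.
by move: ab; rewrite E ltxx.
Qed.

Lemma qof_ge0 (a : D) : 0 <= qof a.
Proof.
by rewrite -qof0; case: (pge0 H a) => [/qof_lt/ltW //|->].
Qed.

(** The denominator is a successor, as in the codes of rationals. Thus every element of the field
    has a code in the model, and arbitrary field elements may serve as constants, bounds and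
    constant reals. *)
Lemma qfrac_rep (x : qfrac) : exists a b c : D, x = (qof a - qof b) / (qof c + 1).
Proof.
have S (d : D) : mzero M <' d -> exists c, qof d = qof c + 1.
  move=> d0; have [_ /(_ d d0) [|<-]] := p01 H; last by exists (mzero M); rewrite qof0 qof1 add0r.
  by move/(plt_sub H) => [c <-]; exists c; rewrite qofD qof1 addrC.
case: (qge0P x) => -[a [d [/S [c ->] E]]].
  by exists a, (mzero M), c; rewrite qof0 subr0.
by exists (mzero M), a, c; rewrite qof0 sub0r mulNr -E opprK.
Qed.
End Integers.

Lemma ordered_field (M : pamodel) : exists (K : realFieldType) (io : dom M -> K),
  [/\ (forall a b, io (a +' b) = io a + io b)%R,
      (forall a b, io (a *' b) = io a * io b)%R,
      io (mzero M) = 0%R /\ io (mone M) = 1%R,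
      (forall a b, a <' b <-> (io a < io b)%R) &
      [/\ injective io, forall a, (0 <= io a)%R &
      forall x, exists a b c, x = ((io a - io b) / (io c + 1))%R]].
Proof.
exists (qfrac M), (@qof M); split; [exact: qofD | exact: qofM | | exact: qof_lt |].
  by split; [exact: qof0 | exact: qof1].
by split; [exact: qof_inj | exact: qof_ge0 | exact: qfrac_rep].
Qed.

From mathcomp Require Import ring lra.
Local Open Scope ring_scope.

(** From here on the field is known only through these properties of [io]. The set [rset] ensures
    that valuations of set variables exist. *)
Record rca := Rca {
  rM : model;
  rset : sets rM;
  rP : holds rM RCA0;
  rK : realFieldType;
  io : dom rM -> rK;
  ioD : forall a b, io (a +' b) = io a + io b;
  ioM : forall a b, io (a *' b) = io a * io b;
  io0 : io (mzero rM) = 0;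
  io1 : io (mone rM) = 1;
  io_lt : forall a b, a <' b <-> io a < io b;
  io_inj : injective io;
  io_ge0 : forall a, 0 <= io a;
  io_rep : forall x, exists a b c, x = (io a - io b) / (io c + 1) }.
Arguments io {r}.

Section ModelOfRCA0.
Variable R : rca.
Notation M := (rM R).
Notation D := (dom M).
Notation K := (rK R).
Notation env := (nat -> D).
Notation set := (sets M).
Notation d0 := (mzero M).
Notation d1 := (mone M).
Notation "x \inn X" := (mmem M x X) (at level 70).

Definition ioE := (ioD, ioM, @io0 R, @io1 R).

(** The numbers are discrete although the field is not; this turns a strict hypothesis into the
    stronger form that linear arithmetic can use. *)
Lemma io_S (a b : D) : a <' b <-> io a + 1 <= io b.
Proof.
split=> [ab|ab]; last by apply/io_lt; lra.
have P := holds_pa_minus (rset R) (@rP R).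
have [c Ec] := plt_sub P ab; rewrite -Ec ioD lerD2l.
have [_ /(_ c) c1] := p01 P; case: (pge0 P c) => [/c1 [/io_lt|<-]|E].
- by rewrite io1; lra.
- by rewrite io1.
- by move: ab; rewrite -Ec => /io_lt; rewrite ioD -E io0; lra.
Qed.

Lemma io_ltn (a b : D) : ~ a <' b <-> io b <= io a.
Proof.
split; first by move=> A; rewrite leNgt; apply/negP => /io_lt.
by move=> A /io_lt; rewrite ltNge A.
Qed.

Lemma io_sub (a b : D) : io a <= io b -> exists c, io b = io a + io c.
Proof.
have P := holds_pa_minus (rset R) (@rP R).
rewrite le_eqVlt => /orP [/eqP/io_inj <-|/io_lt/(plt_sub P) [c <-]].
  by exists d0; rewrite io0 addr0.
by exists c; rewrite ioD.
Qed.

Lemma io_case (a b : D) : a <' b \/ a = b \/ b <' a.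
Proof. exact: plt_total (holds_pa_minus (rset R) (@rP R)) a b. Qed.

Lemma io_0or (a : D) : a = d0 \/ exists b, a = b +' d1.
Proof.
have [/io_lt L|[E|/io_S L]] := io_case a d0; last 2 first.
- by left.
- have [c Ec] := @io_sub d1 a ltac:(by rewrite io1; rewrite io0 in L; lra).
  by right; exists c; apply: io_inj; rewrite !ioE Ec io1; lra.
by exfalso; have := io_ge0 a; rewrite io0 in L; lra.
Qed.

(** With [io_norm] and [dlra], a statement about numbers is carried over to the field, supplied with
    discreteness and nonnegativity, and left to linear arithmetic. *)
Ltac io_pos := repeat match goal with x : dom _ |- _ =>
  lazymatch goal with _ : is_true (0 <= io x) |- _ => fail | _ => pose proof (io_ge0 x) end end.
Ltac io_norm := repeat match goal with
  | h : _ <' _ |- _ => apply io_S in h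
  | h : ~ _ <' _ |- _ => apply io_ltn in h
  | h : @Logic.eq (dom _) _ _ |- _ => apply (f_equal io) in h
  | |- _ <' _ => apply (proj2 (io_lt _ _))
  | |- ~ _ <' _ => apply (proj2 (io_ltn _ _))
  | |- @Logic.eq (dom _) _ _ => apply: io_inj end;
  repeat match goal with h : context [io _] |- _ => rewrite !ioE in h end;
  rewrite ?ioE.
Ltac dlra := io_norm; io_pos; lra.

(** * Definability and primitive recursion in a model of RCA0 *)

Definition isS1 (P : env -> Prop) : Prop :=
  exists Q : env -> Prop, isD0 M (fun r _ => Q r) /\
    forall r, P r <-> exists m, Q (scons m r).
Definition isD1 (P : env -> Prop) : Prop := isS1 P /\ isS1 (fun r => ~ P r).
(** A Sigma^0_1 graph suffices for recursiveness: as the function is total, f r differs from y iff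
    some z different from y is the value. *)
Definition isR (f : env -> D) : Prop := isS1 (fun r => f (fun i => r (S i)) = r 0%N).

Lemma S1_ext P Q : (forall r, P r <-> Q r) -> isS1 P -> isS1 Q.
Proof. by move=> E [F [HF EF]]; exists F; split=> // r; rewrite -E. Qed.

Lemma D1_ext P Q : (forall r, P r <-> Q r) -> isD1 P -> isD1 Q.
Proof. by move=> E [A B]; split; [move: A|move: B]; apply: S1_ext => r; rewrite E. Qed.

Lemma S1_D0 P : isD0 M (fun r _ => P r) -> isS1 P.
Proof.
move=> HP; exists (fun r => P (fun i => r (S i))); split.
  by apply: (isD0_subst M _ HP (fun i r => r (S i))) => i; constructor.
by move=> r; split=> [A|[m]//]; exists d0.
Qed.

Lemma S1_subst P (F : nat -> env -> D) : (forall i, isTm _ (F i)) ->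
  isS1 P -> isS1 (fun r => P (fun i => F i r)).
Proof.
move=> HF [Q [HQ E]].
exists (fun r => Q (scons (r 0%N) (fun i => F i (fun j => r (S j))))); split=> [|r]; last exact: E.
apply: (isD0_scons M (fun r _ => Q r) (fun r => r 0%N) (fun i r => F i (fun j => r (S j))) HQ).
  by constructor.
by move=> i; apply: isTm_shift.
Qed.

(** Two unbounded quantifiers are contracted into a common bound on both witnesses, which keeps the
    matrix bounded. *)
Lemma S1_ex P : isS1 (fun r => P (fun i => r (S i)) (r 0%N)) -> isS1 (fun r => exists x, P r x).
Proof.
move=> [Q [HQ E]].
exists (fun r => exists x, x <' r 0%N /\ exists m, m <' r 0%N /\ Q (scons m (scons x (fun i => r (S i))))).
split.
  apply: isD0_bex; first by constructor.
  apply: isD0_bex; first by constructor.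
  by apply: (isD0_scons2 M (fun r _ => Q r) _ _ (fun i r => r (S (S (S i)))) HQ); constructor.
move=> r; split=> [[x A]|[w [x [_ [m [_ A]]]]]].
  have [m B] := proj1 (E (scons x r)) A.
  exists (x +' m +' d1), x; split; first by rewrite /=; dlra.
  by exists m; split; first by rewrite /=; dlra.
by exists x; apply: (proj2 (E (scons x r))); exists m.
Qed.

Lemma S1_or P Q : isS1 P -> isS1 Q -> isS1 (fun r => P r \/ Q r).
Proof.
move=> [P' [HP EP]] [Q' [HQ EQ]]; exists (fun r => P' r \/ Q' r); split.
  exact: isD0_or.
move=> r; rewrite EP EQ; split=> [[[m A]|[m A]]|[m [A|A]]].
- by exists m; left.
- by exists m; right.
- by left; exists m.
- by right; exists m.
Qed.

Lemma D0_in1 P : isD0 M (fun r _ => P r) ->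
  isD0 M (fun r _ => P (scons (r 0%N) (fun i => r (S (S i))))).
Proof.
by move=> HP; apply: (isD0_scons M (fun r _ => P r) _ (fun i r => r (S (S i))) HP); constructor.
Qed.

Lemma S1_and P Q : isS1 P -> isS1 Q -> isS1 (fun r => P r /\ Q r).
Proof.
move=> [P' [HP EP]] [Q' [HQ EQ]].
exists (fun r => (exists m, m <' r 0%N /\ P' (scons m (fun i => r (S i)))) /\
                 (exists m, m <' r 0%N /\ Q' (scons m (fun i => r (S i))))); split.
  apply: isD0_and.
    by apply: isD0_bex; [constructor|exact: D0_in1].
  by apply: isD0_bex; [constructor|exact: D0_in1].
move=> r; rewrite EP EQ; split.
  move=> [[m A] [n B]]; exists (m +' n +' d1); split; [exists m|exists n]; split=> //=; dlra.
by move=> [w [[m [_ A]] [n [_ B]]]]; split; [exists m|exists n].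
Qed.

(** An instance of the induction schema for the representing formula; an axiom holds under all
    valuations, so elements and sets of the model are admissible as parameters. *)
Lemma S1_ind (P : D -> Prop) : isS1 (fun r => P (r 0%N)) -> P d0 ->
  (forall n, P n -> P (n +' d1)) -> forall n, P n.
Proof.
move=> [Q [HQ E]].
have [e [tau [p [p2 [[Dp _] Ep]]]]] := isD0_matrices _ (rset R) _ _ HQ HQ.
have EP n : P n <-> exists m, sat M (scons n (scons m e)) tau p.
  by rewrite (E (scons n (fun _ => d0))); split=> -[m A]; exists m; apply/(proj1 (Ep n m)).
have := @rP R _ (RCA0_induction p Dp) e tau; rewrite /Sigma1_induction /close /= => I P0 PS n.
have A r t d : (forall i, r (i + d)%coq_nat = e i) ->
    sat M r tau (subst (scons t (scons (TVar 0) (fun i => TVar (i + d)%coq_nat))) (fun j => (j + 0)%coq_nat) p)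
    <-> sat M (scons (eval M r t) (scons (r 0%N) e)) tau p.
  by move=> Hr; apply: sat_args => // j; rewrite Nat.add_0_r.
have A1 m i : scons m e (i + 1)%coq_nat = e i by rewrite Nat.add_comm.
have A2 m y i : scons m (scons y e) (i + 2)%coq_nat = e i by rewrite Nat.add_comm.
apply/EP; suff [m /(A _ _ _ (A2 _ _))] : exists m, sat M (scons m (scons n e)) tau (subst
    (scons (TVar 1) (scons (TVar 0) (fun i => TVar (i + 2)%coq_nat))) (fun j => (j + 0)%coq_nat) p).
  by exists m.
move: n; apply: I; split; first by have /EP [m B] := P0; exists m; apply/(A _ _ _ (A1 _)).
move=> n [m /(A _ _ _ (A2 _ _)) /= B].
have /EP [m' B'] : P (n +' d1) by apply: PS; apply/EP; exists m.
by exists m'; apply/(A _ _ _ (A2 _ _)).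
Qed.

Lemma D0_matrix (Q : env -> Prop) (r0 : env) : isD0 M (fun r _ => Q r) ->
  isD0 M (fun r _ => Q (scons (r 0%N) (scons (r 1%N) r0))).
Proof.
by move=> HQ; apply: (isD0_scons2 M (fun r _ => Q r) _ _ (fun i _ => r0 i) HQ); constructor.
Qed.

(** Bounded collection, by induction on y for the Sigma^0_1 claim that one w serves all x below y.
    The guard [x <' t] inside the claim lets the induction run over all y. *)
Lemma S1_collect (Q : env -> Prop) r (t : D) : isD0 M (fun r _ => Q r) ->
  (forall x, x <' t -> exists m, Q (scons m (scons x r))) ->
  exists w, forall x, x <' t -> exists m, m <' w /\ Q (scons m (scons x r)).
Proof.
move=> HQ A.
suff B : forall y, exists w, forall x, x <' y -> x <' t -> exists m, m <' w /\ Q (scons m (scons x r)).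
  by have [w Hw] := B t; exists w => x xt; apply: Hw.
apply: (@S1_ind (fun y => exists w, forall x, x <' y -> x <' t -> exists m, m <' w /\ Q (scons m (scons x r)))).
- apply: S1_ex; apply: S1_D0.
  apply: (isD0_ball M (fun r => r 1%N)
    (fun r' _ x => x <' t -> exists m, m <' r' 0%N /\ Q (scons m (scons x r)))).
    exact: isTm_var.
  apply: isD0_imp; first by apply: isD0_lt; constructor.
  apply: (isD0_bex M (fun r => r 1%N)); first exact: isTm_var.
  exact: D0_matrix.
- by exists d0 => x /io_lt; rewrite io0 => L; have := io_ge0 x; lra.
- move=> y [w Hw]; have [yt|yt] := pselect (y <' t).
    have [m Qm] := A _ yt; exists (w +' m +' d1) => x xy xt.
    have [xy'|[->|yx]] := io_case x y.
    + by have [m' [L Q']] := Hw _ xy' xt; exists m'; split=> //; dlra.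
    + by exists m; split=> //; dlra.
    + by exfalso; dlra.
  exists w => x xy xt; apply: Hw => //.
  by have [//|[E|L]] := io_case x y; [move: yt; rewrite -E | exfalso; dlra].
Qed.

(** By collection, the witnesses for all x below the bound have a common bound, so the unbounded
    quantifier moves to the front. The bound is a variable here; [S1_app] extends this to recursive
    bounds. *)
Lemma S1_ball_var P (k : nat) : isS1 (fun r => P (fun i => r (S i)) (r 0%N)) ->
  isS1 (fun r => forall x, x <' r k -> P r x).
Proof.
move=> [Q [HQ E]].
exists (fun r => forall x, x <' r (S k) -> exists m, m <' r 0%N /\ Q (scons m (scons x (fun i => r (S i))))).
split.
  apply: (isD0_ball M (fun r => r (S k))); first exact: isTm_var.
  apply: (isD0_bex M (fun r => r 1%N)); first exact: isTm_var.
  by apply: (isD0_scons2 M (fun r _ => Q r) _ _ (fun i r => r (S (S (S i)))) HQ); constructor.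
move=> r; split=> [A|[w A] x /A [m [_ B]]].
  by apply: S1_collect => // x /A B; apply: (proj1 (E (scons x r))).
by apply: (proj2 (E (scons x r))); exists m.
Qed.

Lemma S1_shift P : isS1 P -> isS1 (fun r => P (fun i => r (S i))).
Proof. by apply: S1_subst => i; constructor. Qed.

Lemma S1_app f P : isR f -> isS1 (fun r => P (fun i => r (S i)) (r 0%N)) ->
  isS1 (fun r => P r (f r)).
Proof.
move=> Hf HP; apply: (@S1_ext (fun r => exists y, f r = y /\ P r y)).
  by move=> r; split=> [[y [<-]]//|]; exists (f r).
by apply: S1_ex; apply: S1_and.
Qed.

Lemma S1_ball f P : isR f -> isS1 (fun r => P (fun i => r (S i)) (r 0%N)) ->
  isS1 (fun r => forall x, x <' f r -> P r x).
Proof.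
move=> Hf HP; apply: (@S1_app f (fun r b => forall x, x <' b -> P r x)) => //.
apply: (@S1_ball_var (fun r x => P (fun i => r (S i)) x) 0).
refine (S1_subst (F := (scons (fun r => r 0%N) (fun i r => r (S (S i))))) _ HP); move=> [|i]; constructor.
Qed.

Lemma S1_bex f P : isR f -> isS1 (fun r => P (fun i => r (S i)) (r 0%N)) ->
  isS1 (fun r => exists x, x <' f r /\ P r x).
Proof.
move=> Hf HP; apply: (@S1_app f (fun r b => exists x, x <' b /\ P r x)) => //.
apply: S1_ex; apply: S1_and; first by apply: S1_D0; apply: isD0_lt; constructor.
refine (S1_subst (F := (scons (fun r => r 0%N) (fun i r => r (S (S i))))) _ HP); move=> [|i]; constructor.
Qed.

Lemma D1_not P : isD1 P -> isD1 (fun r => ~ P r).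
Proof.
by move=> [A B]; split=> //; apply: S1_ext A => r; split=> [p np|/contrapT]; first exact: np.
Qed.
Lemma D1_and P Q : isD1 P -> isD1 Q -> isD1 (fun r => P r /\ Q r).
Proof.
move=> [A B] [A' B']; split; first exact: S1_and.
apply: (@S1_ext (fun r => ~ P r \/ ~ Q r)); last exact: S1_or.
move=> r; split=> [[A2|A2] [p q]|C]; [exact: A2|exact: A2|].
by case: (pselect (P r)) => p; [right=> q; apply: C|left].
Qed.
Lemma D1_or P Q : isD1 P -> isD1 Q -> isD1 (fun r => P r \/ Q r).
Proof.
move=> A B; apply: (@D1_ext (fun r => ~ (~ P r /\ ~ Q r))).
  by move=> r; tauto.
by apply: D1_not; apply: D1_and; apply: D1_not.
Qed.
Lemma D1_imp P Q : isD1 P -> isD1 Q -> isD1 (fun r => P r -> Q r).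
Proof.
move=> A B; apply: (@D1_ext (fun r => ~ P r \/ Q r)).
  by move=> r; split=> [[|]//|C]; case: (pselect (P r)) => [/C|]; [right|left].
by apply: D1_or => //; apply: D1_not.
Qed.
Lemma D1_iff P Q : isD1 P -> isD1 Q -> isD1 (fun r => P r <-> Q r).
Proof. by move=> A B; apply: D1_and; apply: D1_imp. Qed.
Lemma D1_ball f P : isR f -> isD1 (fun r => P (fun i => r (S i)) (r 0%N)) ->
  isD1 (fun r => forall x, x <' f r -> P r x).
Proof.
move=> Hf [A B]; split; first exact: S1_ball.
apply: (@S1_ext (fun r => exists x, x <' f r /\ ~ P r x)); last exact: (@S1_bex f (fun r x => ~ P r x)).
move=> r; split=> [[x [xf nP]] C|C]; first by apply: nP; apply: C.
apply: contrapT => C'; apply: C => x xf; apply: contrapT => nP; apply: C'; by exists x.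
Qed.
Lemma D1_bex f P : isR f -> isD1 (fun r => P (fun i => r (S i)) (r 0%N)) ->
  isD1 (fun r => exists x, x <' f r /\ P r x).
Proof.
move=> Hf A; apply: (@D1_ext (fun r => ~ (forall x, x <' f r -> ~ P r x))).
  move=> r; split=> [C|[x [xf Px]] C]; last exact: C Px.
  by apply: contrapT => C'; apply: C => x xf Px; apply: C'; exists x.
apply: D1_not; apply: (@D1_ball f (fun r x => ~ P r x)) => //; exact: D1_not.
Qed.
Lemma D1_D0 P : isD0 M (fun r _ => P r) -> isD1 P.
Proof.
by move=> A; split; apply: S1_D0 => //; apply: isD0_imp => //; exact: isD0_false.
Qed.
Lemma D1_app f P : isR f -> isD1 (fun r => P (fun i => r (S i)) (r 0%N)) ->
  isD1 (fun r => P r (f r)).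
Proof. by move=> Hf [A B]; split; [apply: S1_app | apply: (@S1_app f (fun r x => ~ P r x))]. Qed.
Lemma D1_subst P (F : nat -> env -> D) : (forall i, isTm M (F i)) ->
  isD1 P -> isD1 (fun r => P (fun i => F i r)).
Proof. by move=> HF [A B]; split; [apply: (S1_subst HF A) | apply: (S1_subst HF B)]. Qed.

Lemma R_T f : isTm M f -> isR f.
Proof.
by move=> Hf; apply: S1_D0; apply: isD0_eq; [exact: isTm_shift | constructor].
Qed.
Lemma R_var k : isR (fun r => r k). Proof. by apply: R_T; constructor. Qed.
Lemma R_const d : isR (fun r => d). Proof. by apply: R_T; constructor. Qed.
Lemma R_shift f : isR f -> isR (fun r => f (fun i => r (S i))).
Proof.
move=> Hf; refine (S1_subst (F := (scons (fun r => r 0%N) (fun i r => r (S (S i))))) _ Hf); move=> [|i]; constructor.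
Qed.
Definition isR1 (u : D -> D) := isR (fun r => u (r 0%N)).
Definition isR2 (u : D -> D -> D) := isR (fun r => u (r 0%N) (r 1%N)).
Definition isR3 (u : D -> D -> D -> D) := isR (fun r => u (r 0%N) (r 1%N) (r 2%N)).
Definition isP1 (P : D -> Prop) := isD1 (fun r => P (r 0%N)).
Definition isP2 (P : D -> D -> Prop) := isD1 (fun r => P (r 0%N) (r 1%N)).
Definition isP3 (P : D -> D -> D -> Prop) := isD1 (fun r => P (r 0%N) (r 1%N) (r 2%N)).

Definition pick3 (a b c : nat) (i : nat) : nat := match i with 0 => a | 1 => b | _ => c end.

Lemma S1_pick P (a b c : nat) : isS1 P -> isS1 (fun r => P (fun i => r (pick3 a b c i))).
Proof. by apply: (@S1_subst _ (fun i r => r (pick3 a b c i))) => i; constructor. Qed.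
Lemma D1_pick P (a b c : nat) : isD1 P -> isD1 (fun r => P (fun i => r (pick3 a b c i))).
Proof. by move=> [A B]; split; [exact: (S1_pick a b c A) | exact: (S1_pick a b c B)]. Qed.

Lemma D1_app1 P f : isP1 P -> isR f -> isD1 (fun r => P (f r)).
Proof.
by move=> HP Hf; apply: (@D1_app f (fun _ y => P y)) => //; exact: (D1_pick 0 0 0 HP).
Qed.
Lemma D1_app2 P f g : isP2 P -> isR f -> isR g -> isD1 (fun r => P (f r) (g r)).
Proof.
move=> HP Hf Hg; apply: (@D1_app f (fun r y => P y (g r))) => //.
apply: (@D1_app _ (fun r y => P (r 0%N) y)); first exact: R_shift.
exact: (D1_pick 1 0 0 HP).
Qed.
Lemma D1_app3 P f g h : isP3 P -> isR f -> isR g -> isR h ->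
  isD1 (fun r => P (f r) (g r) (h r)).
Proof.
move=> HP Hf Hg Hh; apply: (@D1_app f (fun r y => P y (g r) (h r))) => //.
apply: (@D1_app _ (fun r y => P (r 0%N) y (h (fun i => r (S i))))); first exact: R_shift.
apply: (@D1_app _ (fun r y => P (r 1%N) (r 0%N) y)); first exact: (R_shift (R_shift Hh)).
exact: (D1_pick 2 1 0 HP).
Qed.
Lemma R_app1 u f : isR1 u -> isR f -> isR (fun r => u (f r)).
Proof.
move=> Hu Hf; apply: (@S1_app _ (fun r y => u y = r 0%N)); first exact: R_shift.
exact: (S1_pick 1 0 0 Hu).
Qed.
Lemma R_app2 u f g : isR2 u -> isR f -> isR g -> isR (fun r => u (f r) (g r)).
Proof.
move=> Hu Hf Hg; apply: (@S1_app _ (fun r y => u y (g (fun i => r (S i))) = r 0%N)); first exact: R_shift.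
apply: (@S1_app _ (fun r y => u (r 0%N) y = r 1%N)); first exact: (R_shift (R_shift Hg)).
exact: (S1_pick 2 1 0 Hu).
Qed.
Lemma S1_pick4 P : isS1 P -> isS1
  (fun r => P (fun i => r (match i with 0 => 3 | 1 => 2 | 2 => 1 | _ => 0 end)%N)).
Proof.
by apply: (@S1_subst _ (fun i r => r (match i with 0 => 3 | 1 => 2 | 2 => 1 | _ => 0 end)%N)) => i; constructor.
Qed.
Lemma R_app3 u f g h : isR3 u -> isR f -> isR g -> isR h -> isR (fun r => u (f r) (g r) (h r)).
Proof.
move=> Hu Hf Hg Hh.
apply: (@S1_app _ (fun r y => u y (g (fun i => r (S i))) (h (fun i => r (S i))) = r 0%N)); first exact: R_shift.
apply: (@S1_app _ (fun r y => u (r 0%N) y (h (fun i => r (S (S i)))) = r 1%N)); first exact: (R_shift (R_shift Hg)).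
apply: (@S1_app _ (fun r y => u (r 1%N) (r 0%N) y = r 2%N)); first exact: (R_shift (R_shift (R_shift Hh))).
exact: (S1_pick4 Hu).
Qed.
Lemma R_add f g : isR f -> isR g -> isR (fun r => f r +' g r).
Proof. by apply: (@R_app2 (fun x y => x +' y)); apply: R_T; do !constructor. Qed.
Lemma R_mul f g : isR f -> isR g -> isR (fun r => f r *' g r).
Proof. by apply: (@R_app2 (fun x y => x *' y)); apply: R_T; do !constructor. Qed.

Lemma D1_eq f g : isR f -> isR g -> isD1 (fun r => f r = g r).
Proof. by apply: (@D1_app2 (fun x y => x = y)); apply: D1_D0; apply: isD0_eq; constructor. Qed.
Lemma D1_lt f g : isR f -> isR g -> isD1 (fun r => f r <' g r).
Proof. by apply: (@D1_app2 (fun x y => x <' y)); apply: D1_D0; apply: isD0_lt; constructor. Qed.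
Lemma D1_mem f X : isR f -> isD1 (fun r => f r \inn X).
Proof. by apply: (@D1_app1 (fun x => x \inn X)); apply: D1_D0; apply: isD0_mem; constructor. Qed.
Lemma D1_io_lt f g : isR f -> isR g -> isD1 (fun r => io (f r) < io (g r)).
Proof. by move=> A B; apply: D1_ext (D1_lt A B) => r; exact: io_lt. Qed.
(** Classically a fixed proposition is either true or false, so a trivial formula represents it even
    when its content is not arithmetical. *)
Lemma D1_const (P : Prop) : isD1 (fun r => P).
Proof.
have [p|np] := pselect P.
  apply: (@D1_ext (fun r => d0 = d0)) => //.
  by apply: D1_eq; exact: R_const.
apply: (@D1_ext (fun r => ~ (d0 = d0))); first by move=> r; split.
by apply: D1_not; apply: D1_eq; exact: R_const.
Qed.

Lemma R_if P f g : isD1 P -> isR f -> isR g ->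
  isR (fun r => if `[< P r >] then f r else g r).
Proof.
move=> [A B] Hf Hg.
apply: (@S1_ext (fun r => (P (fun i => r (S i)) /\ f (fun i => r (S i)) = r 0%N) \/
                            (~ P (fun i => r (S i)) /\ g (fun i => r (S i)) = r 0%N))).
  by move=> r; case: asboolP => HP; tauto.
by apply: S1_or; apply: S1_and => //; [exact: (S1_shift A) | exact: (S1_shift B)].
Qed.

Lemma exists_iff T (A B : T -> Prop) : (forall x, A x <-> B x) -> (exists x, A x) <-> (exists x, B x).
Proof. by move=> H; split=> -[x H']; exists x; apply/H. Qed.

Lemma sat_plug2 p n m (r : env) tau (Xs : list set) :
  sat M (scons m (scons n r)) (fold_right scons tau Xs) (subst (scons (TVar 1) (scons (TVar 0)
    (fun i => TVar (i + 2)%coq_nat))) (fun j => (j + length Xs)%coq_nat) p)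
  <-> sat M (scons n (scons m r)) tau p.
Proof.
apply: sat_args => [i|j]; first by rewrite Nat.add_comm.
by elim: Xs => [|X Xs IH] /=; rewrite ?Nat.add_0_r // Nat.add_succ_r.
Qed.

(** The comprehension schema asks for a Pi^0_1 form of P; it is obtained by negating the matrix of
    the complement. Both matrices are represented over the same parameters, as one instance has only
    one valuation. *)
Lemma D1_set (P : D -> Prop) : isP1 P -> exists X, forall n, n \inn X <-> P n.
Proof.
move=> [[Q [HQ EQ]] [Q' [HQ' EQ']]].
have HN := isD0_imp _ _ _ HQ' (isD0_false _).
have [e [tau [p [q [[Dp Dq] E]]]]] := isD0_matrices _ (rset R) _ _ HQ HN.
have EP n : P n <-> exists m, sat M (scons n (scons m e)) tau p.
  by rewrite (EQ (scons n (fun _ => d0))); split=> -[m A]; exists m; apply/(proj1 (E n m)).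
have EP' n : P n <-> forall m, sat M (scons n (scons m e)) tau q.
  have Z := EQ' (scons n (fun _ => d0)); split=> [Pn m|A].
    by apply/(proj2 (E n m)) => F; have /Z : exists m, Q' (scons m (scons n (fun=> d0))) by exists m.
  by apply: contrapT => /Z [m F]; have /(proj2 (E n m)) := A m.
have := @rP R _ (RCA0_comprehension p q Dp Dq) e tau.
rewrite /Delta1_comprehension /close /= => C; case: C => [n|X HX].
  rewrite -(iff_trans (EP n) (@exists_iff _ _ _ (fun m => iff_sym (sat_plug2 p n m e tau [])))).
  by rewrite EP'; split=> A k; have := A k; rewrite (sat_plug2 q n k e tau []).
exists X => n; apply: (iff_trans (HX n)); rewrite EP'.
by split=> A k; have := A k; rewrite (sat_plug2 q n k e tau [X]).
Qed.

(** Otherwise the absence of P below y propagates by induction on y; that claim is Sigma^0_1 because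
    the complement of P is. *)
Lemma D1_least (P : D -> Prop) n : isP1 P -> P n -> exists m, P m /\ forall k, k <' m -> ~ P k.
Proof.
move=> HP Pn; apply: contrapT => C.
have : forall y k, k <' y -> ~ P k.
  apply: S1_ind.
  - apply: (@S1_ball (fun r => r 0%N) (fun _ k => ~ P k)); first exact: R_var.
    exact: (S1_pick 0 0 0 (proj2 HP)).
  - by move=> k L; exfalso; dlra.
  - move=> y IH k ky Pk; apply: C; exists k; split=> // j jk; apply: IH.
    by dlra.
by move/(_ (n +' d1) n); apply=> //; dlra.
Qed.

(** By minimization of the value. *)
Lemma R_choice (P : env -> D -> Prop) : isD1 (fun r => P (fun i => r (S i)) (r 0%N)) ->
  (forall r, exists y, P r y) -> exists f, isR f /\ forall r, P r (f r).
Proof.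
move=> HP H.
have H' r : exists m, P r m /\ forall k, k <' m -> ~ P r k.
  have [y Py] := H r; apply: D1_least Py.
  refine (D1_subst (F := scons (fun r => r 0%N) (fun i _ => r i)) _ HP); move=> [|i]; [exact: isTm_var|exact: isTm_const].
pose f r := sval (cid (H' r)); have Hf r : P r (f r) /\ forall k, k <' f r -> ~ P r k := svalP (cid (H' r)).
exists f; split=> [|r]; last by case: (Hf r).
apply: (@S1_ext (fun r => P (fun i => r (S i)) (r 0%N) /\ forall k, k <' r 0%N -> ~ P (fun i => r (S i)) k)).
  move=> r; split=> [[A B]|<-]; last exact: Hf.
  have [C E] := Hf (fun i => r (S i)); have [/E//|[//|/B//]] := io_case (r 0%N) (f (fun i => r (S i))).
apply: S1_and; first by case: HP.
apply: (@S1_ball _ (fun r k => ~ P (fun i => r (S i)) k)); first exact: R_var.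
refine (S1_subst (F := (scons (fun r => r 0%N) (fun i r => r (S (S i))))) _ (proj2 HP)); move=> [|i]; constructor.
Qed.

(** Syntax-directed search for definability proofs; [rec_extra] is redefined whenever new functions
    become available. *)
Ltac rec1 := match goal with
  | |- isR (fun r => r _) => apply: R_var
  | |- isR (fun _ => ?d) => apply: R_const
  | |- isR (fun r => @?f r +' @?g r) => apply: R_add
  | |- isR (fun r => @?f r *' @?g r) => apply: R_mul
  | h : isR1 ?u |- isR (fun r => ?u (@?f r)) => apply: (R_app1 h)
  | h : isR2 ?u |- isR (fun r => ?u (@?f r) (@?g r)) => apply: (R_app2 h)
  | h : isR3 ?u |- isR (fun r => ?u (@?f r) (@?g r) (@?k r)) => apply: (R_app3 h)
  | |- isR (fun r => if `[< _ >] then _ else _) => apply: R_if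
  | h : isP1 ?u |- isD1 (fun r => ?u (@?f r)) => apply: (D1_app1 h)
  | h : isP2 ?u |- isD1 (fun r => ?u (@?f r) (@?g r)) => apply: (D1_app2 h)
  | h : isP3 ?u |- isD1 (fun r => ?u (@?f r) (@?g r) (@?k r)) => apply: (D1_app3 h)
  | |- isD1 (fun _ => ?P) => apply: D1_const
  | |- isD1 (fun r => forall x, x <' @?f r -> _) => refine (D1_ball (f := f) _ _)
  | |- isD1 (fun r => exists x, x <' @?f r /\ _) => refine (D1_bex (f := f) _ _)
  | |- isD1 (fun r => @?f r = @?g r) => apply: D1_eq
  | |- isD1 (fun r => @?f r <' @?g r) => apply: D1_lt
  | |- isD1 (fun r => mmem _ (@?f r) _) => apply: D1_mem
  | |- isD1 (fun r => _ /\ _) => apply: D1_and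
  | |- isD1 (fun r => _ \/ _) => apply: D1_or
  | |- isD1 (fun r => ~ _) => apply: D1_not
  | |- isD1 (fun r => _ <-> _) => apply: D1_iff
  | |- isD1 (fun r => _ -> _) => apply: D1_imp
  end.
Ltac rec_extra := fail.
Ltac rec := repeat (cbn beta; first [assumption | rec1 | rec_extra]).

Lemma S1_of_D1 P : isD1 P -> isS1 P. Proof. by case. Qed.

(** * Pairs and codes of finite sets *)

Definition pair (x y : D) : D := (x +' y) *' (x +' y) +' x.

(** The code lies between (x + y)^2 and (x + y + 1)^2, the latter excluded, so it determines x + y
    and then x. *)
Lemma pair_inj x y x' y' : pair x y = pair x' y' -> x = x' /\ y = y'.
Proof.
rewrite /pair => E.
have L (u v u' v' : D) : io (u +' v) + 1 <= io (u' +' v') ->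
    (u +' v) *' (u +' v) +' u = (u' +' v') *' (u' +' v') +' u' -> False.
  move=> A /(f_equal io); rewrite !ioE in A * => B; io_pos.
  have : (io u + io v + 1) * (io u + io v + 1) <= (io u' + io v') * (io u' + io v').
    by apply: ler_pM => //; lra.
  by move=> C; dlra.
have S : x +' y = x' +' y'.
  by have [/io_S /L /(_ E)|[//|/io_S /L /(_ (esym E))]] := io_case (x +' y) (x' +' y').
by rewrite S in E; split; dlra.
Qed.

Lemma le_pair1 x y : io x <= io (pair x y).
Proof. by rewrite /pair !ioE; io_pos; rewrite lerDr mulr_ge0 // addr_ge0. Qed.

Lemma le_pair2 x y : io y <= io (pair x y).
Proof.
have [->|[z E]] := io_0or y; first by rewrite io0 io_ge0.
rewrite /pair !ioE; apply: (@le_trans _ _ ((io x + io y) * (io x + io y))); last by io_pos; lra.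
have y1 : 1 <= io y by rewrite E !ioE; io_pos; lra.
have := @ler_pM K 1 (io x + io y) (io y) (io x + io y) ler01 (io_ge0 y).
by rewrite mul1r; apply; io_pos; lra.
Qed.

Lemma R_pair f g : isR f -> isR g -> isR (fun r => pair (f r) (g r)).
Proof. by move=> Hf Hg; rewrite /pair; rec. Qed.

(** Divisibility in the ring of differences, where the usual manipulations with subtraction are
    possible; [zdvdP] returns to a quotient among the numbers. *)
Definition zdvd (x y : K) : Prop := exists a b : D, y = x * (io a - io b).

Lemma zdvdP (a b : D) : 0 < io a -> zdvd (io a) (io b) -> exists q, q <' b +' d1 /\ q *' a = b.
Proof.
move=> a0 [c [d E]].
have L : io d <= io c by rewrite -subr_ge0 -(pmulr_rge0 _ a0) -E io_ge0.
have [q Eq] := io_sub L.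
have Eb : q *' a = b.
  by apply: io_inj; rewrite ioM E Eq; ring.
exists q; split=> //.
have a1 : 1 <= io a by have /io_S := proj2 (io_lt d0 a) ltac:(by rewrite io0); rewrite io0 add0r.
have a2 : 0 <= io a - 1 by rewrite subr_ge0.
by have := mulr_ge0 (io_ge0 q) a2; move: Eb => /(f_equal io); rewrite ioM => Eb ?; dlra.
Qed.

Definition bit (b x : D) : D := d1 +' (x +' d1) *' b.

Lemma bit_gt0 b x : 0 < io (bit b x).
Proof. by rewrite /bit !ioE; io_pos; have := mulr_ge0 (io_ge0 x) (io_ge0 b); lra. Qed.

(** The number b is invertible modulo 1 + (x + 1) b, because 1 is the modulus minus (x + 1) b. *)
Lemma zdvd_bit b x (s : K) : (exists u v : D, s = io u - io v) ->
  zdvd (io (bit b x)) (s * io b) -> zdvd (io (bit b x)) s.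
Proof.
move=> [u [v Es]] [c [d E]].
exists (u +' (x +' d1) *' d), (v +' (x +' d1) *' c).
have -> : s = s * io (bit b x) - (io x + 1) * (s * io b) by rewrite /bit !ioE; ring.
by rewrite E Es !ioE; ring.
Qed.

(** Goedel's moduli [bit b x] and [bit b n] are coprime, stated as Euclid's lemma. *)
Lemma bit_coprime b x n m : (exists c d : D, io b = (io n - io x) * (io c - io d)) ->
  zdvd (io (bit b x)) (io m * io (bit b n)) -> zdvd (io (bit b x)) (io m).
Proof.
move=> [c [d Eb]] [u [v E]].
have H1 : zdvd (io (bit b x)) (io m * (io n - io x)).
  apply: zdvd_bit; first by exists (m *' n), (m *' x); rewrite !ioE; ring.
  exists u, (v +' m).
  have -> : io m * (io n - io x) * io b = io m * io (bit b n) - io m * io (bit b x).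
    by rewrite /bit !ioE; ring.
  by rewrite E !ioE; ring.
apply: zdvd_bit; first by exists m, d0; rewrite io0; ring.
case: H1 => u' [v' E']; exists (u' *' c +' v' *' d), (u' *' d +' v' *' c).
by rewrite Eb mulrA E' !ioE; ring.
Qed.

(** The triple [m], [b], [N] codes the finite set of the [x < N] such that
    [1 + (x + 1) b] divides [m]. *)
Definition cdvd (m b x : D) : Prop := exists q, q <' m +' d1 /\ q *' bit b x = m.
Definition cmem (m b N x : D) : Prop := x <' N /\ cdvd m b x.

Lemma D1_cdvd f g h : isR f -> isR g -> isR h -> isD1 (fun r => cdvd (f r) (g r) (h r)).
Proof. by apply: (@D1_app3 cdvd); rewrite /isP3 /cdvd /bit; rec. Qed.

Lemma D1_cmem f g h k : isR f -> isR g -> isR h -> isR k ->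
  isD1 (fun r => cmem (f r) (g r) (h r) (k r)).
Proof. by move=> *; apply: D1_and; [exact: D1_lt|exact: D1_cdvd]. Qed.

(** Replaces the factorial of N. If such a b is used in the moduli, it is divisible by the
    difference of any two distinct numbers below N, which makes the moduli coprime. *)
Lemma common_multiple N : exists b : D, d0 <' b /\ forall k, k <' N -> exists c, c <' b +' d1 /\ b = (k +' d1) *' c.
Proof.
move: N; apply: S1_ind.
- by apply: S1_ex; apply: S1_of_D1; rec.
- by exists d1; split; [dlra | move=> k ?; exfalso; dlra].
- move=> N [b [b0 H]]; exists (b *' (N +' d1)); split.
    have : 0 < io b * (io N + 1).
      by rewrite mulr_gt0 //; [move: b0 => /io_lt; rewrite io0 | have := io_ge0 N; lra].
    by move=> ?; dlra.
  move=> k kN; have [kN'|[->|L]] := io_case k N; last by exfalso; dlra.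
    have [c [cb Ec]] := H _ kN'; exists (c *' (N +' d1)); split.
      have : io c * (io N + 1) <= io b * (io N + 1).
        by apply: ler_wpM2r; [have := io_ge0 N; lra | move: cb => /io_S; rewrite !ioE; lra].
      by move=> ?; dlra.
    by rewrite {1}Ec; apply: io_inj; rewrite !ioE; ring.
  exists b; split; last by apply: io_inj; rewrite !ioE; ring.
  by have := mulr_ge0 (io_ge0 b) (io_ge0 N) => ?; dlra.
Qed.

(** The code is the product of the moduli of the elements, built up by induction on n: a factor
    [bit b n] is added when n is in the set, and by coprimality it creates no other element. *)
Lemma bounded_comprehension (P : D -> Prop) N : isP1 P ->
  exists m b, forall x, cmem m b N x <-> x <' N /\ P x.
Proof.
move=> HP; have [b [b0 Hb]] := common_multiple N.
suff /(_ N) [m [_ H]] : forall n, exists m, d0 <' m /\ forall x, x <' N -> (cdvd m b x <-> x <' n /\ P x).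
  exists m, b => x; split=> [[xN /(H _ xN) [_ Px]]//|[xN Px]]; split=> //; exact/H.
apply: S1_ind.
- apply: S1_ex; apply: S1_of_D1; apply: D1_and; first by rec.
  apply: (@D1_ball (fun _ => N)); first by rec.
  by apply: D1_iff; [apply: D1_cdvd; rec | rec].
- exists d1; split=> [|x xN]; first by dlra.
  split=> [[q [qL E]]|[L _]]; last by exfalso; dlra.
  exfalso; have [q0|[q' Eq]] := io_0or q.
    by move: E; rewrite q0 /bit => /(f_equal io); rewrite !ioE mul0r; lra.
  move: E => /(f_equal io); rewrite Eq /bit !ioE; io_pos.
  have := mulr_ge0 (io_ge0 x) (io_ge0 b); have := mulr_ge0 (io_ge0 q') (ltW (bit_gt0 b x)).
  by rewrite /bit !ioE => A B C; dlra.
- move=> n [m [m0 H]]; have [[nN Pn]|nP] := pselect (n <' N /\ P n); last first.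
    exists m; split=> // x xN; rewrite H //; split=> [[xn Px]|[xn Px]]; split=> //; first by dlra.
    have [//|[E|]] := io_case x n; last by move=> ?; exfalso; dlra.
    by case: nP; rewrite -E.
  exists (m *' bit b n); split.
    by apply/io_lt; rewrite io0 ioM mulr_gt0 ?bit_gt0 //; move: m0 => /io_lt; rewrite io0.
  move=> x xN; split.
    move=> [q [_ E]]; have [xn|xn] := pselect (x = n); first by rewrite xn; split=> //; dlra.
    suff /(H _ xN) [xn' Px] : cdvd m b x by split=> //; dlra.
    apply: zdvdP; first exact: bit_gt0.
    apply: (@bit_coprime b x n m); last first.
      by exists q, d0; rewrite -ioM -E ioM io0; ring.
    have [L|[//|L]] := io_case x n.
      have [k Ek] := @io_sub (x +' d1) n ltac:(by dlra).
      have [c [_ Ec]] := Hb k ltac:(by dlra).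
      by exists c, d0; rewrite {1}Ec Ek !ioE; ring.
    have [k Ek] := @io_sub (n +' d1) x ltac:(by dlra).
    have [c [_ Ec]] := Hb k ltac:(by dlra).
    by exists d0, c; rewrite {1}Ec Ek !ioE; ring.
  move=> [xn Px]; have [L|[->|L]] := io_case x n; last by exfalso; dlra.
    have /(H _ xN) [q [qm E]] : x <' n /\ P x by [].
    apply: zdvdP; first exact: bit_gt0.
    by exists (q *' bit b n), d0; rewrite -E !ioM io0; ring.
  apply: zdvdP; first exact: bit_gt0.
  by exists m, d0; rewrite !ioM io0; ring.
Qed.

(** * Primitive recursion *)

Section PrimRec.
Variables (a : D -> D) (g : D -> D -> D -> D).
Hypotheses (Ha : isR1 a) (Hg : isR3 g).

(** A finite piece of the graph in which every pair is justified by the recursion equations. Since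
    [N] bounds the codes of its pairs, it bounds all quantifiers, and a certificate can be checked
    in a Delta^0_1 way. *)
Definition pr_closed p m b N : Prop := forall i, i <' N -> forall z, z <' N ->
  cmem m b N (pair i z) -> (i = d0 /\ z = a p) \/
  exists i', i' <' N /\ exists z', z' <' N /\
    [/\ i = i' +' d1, z = g p i' z' & cmem m b N (pair i' z')].

Lemma pr_unique p m b N m' b' N' : pr_closed p m b N -> pr_closed p m' b' N' ->
  forall n z z', cmem m b N (pair n z) -> cmem m' b' N' (pair n z') -> z = z'.
Proof.
move=> C C'.
have below m1 b1 N1 i z : cmem m1 b1 N1 (pair i z) -> i <' N1 /\ z <' N1.
  by move=> [/io_lt L _]; split; apply/io_lt; apply: le_lt_trans L; [exact: le_pair1|exact: le_pair2].
(* The bounds on z and z' keep the claim Delta^0_1, so that induction applies. *)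
have : forall n, forall z, z <' N -> forall z', z' <' N' ->
    cmem m b N (pair n z) -> cmem m' b' N' (pair n z') -> z = z'.
  apply: S1_ind.
  - apply: S1_of_D1; apply: (@D1_ball (fun _ => N)); first by rec.
    apply: (@D1_ball (fun _ => N')); first by rec.
    by apply: D1_imp; [|apply: D1_imp; last by rec]; apply: D1_cmem; rec; apply: R_pair; rec.
  - move=> z zN z' zN' E E'; have [iN _] := below _ _ _ _ _ E; have [iN' _] := below _ _ _ _ _ E'.
    have [[_ ->]|[i [_ [? [_ [F _ _]]]]]] := C _ iN _ zN E; last by exfalso; dlra.
    by have [[_ ->]|[i [_ [? [_ [F _ _]]]]]] := C' _ iN' _ zN' E'; last by exfalso; dlra.
  - move=> n IH z zN z' zN' E E'; have [iN _] := below _ _ _ _ _ E; have [iN' _] := below _ _ _ _ _ E'.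
    have [[F _]|[i [_ [y [yN [F -> H]]]]]] := C _ iN _ zN E; first by exfalso; dlra.
    have [[F' _]|[i' [_ [y' [yN' [F' -> H']]]]]] := C' _ iN' _ zN' E'; first by exfalso; dlra.
    have Ei : i = n by dlra. have Ei' : i' = n by dlra.
    by subst i i'; congr (g p n _); apply: IH.
by move=> H n z z' E E'; apply: (H n) => //; [have [] := below _ _ _ _ _ E|have [] := below _ _ _ _ _ E'].
Qed.

Definition pr_cert p n y m b N := pr_closed p m b N /\ cmem m b N (pair n y).

Lemma S1_cert : isS1 (fun r => exists m b N, pr_cert (r 0%N) (r 1%N) (r 2%N) m b N).
Proof.
apply: S1_ex; apply: S1_ex; apply: S1_ex; apply: S1_of_D1; rewrite /pr_cert /pr_closed.
apply: D1_and; last by apply: D1_cmem; rec; apply: R_pair; rec.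
apply: (@D1_ball (fun r => r 0%N)); first by rec.
apply: (@D1_ball (fun r => r 1%N)); first by rec.
apply: D1_imp; first by apply: D1_cmem; rec; apply: R_pair; rec.
apply: D1_or; first by rec.
apply: (@D1_bex (fun r => r 2%N)); first by rec.
apply: (@D1_bex (fun r => r 3%N)); first by rec.
apply: (@D1_ext (fun r => r 3%N = r 1%N +' d1 /\ r 2%N = g (r 7%N) (r 1%N) (r 0%N) /\
  cmem (r 6%N) (r 5%N) (r 4%N) (pair (r 1%N) (r 0%N)))).
  by move=> r; split=> [[? []]//|[]].
by apply: D1_and; [rec | apply: D1_and; [rec | apply: D1_cmem; rec; apply: R_pair; rec]].
Qed.

Lemma pr_zero p : exists m b N, pr_cert p d0 (a p) m b N.
Proof.
have [m [b H]] := @bounded_comprehension (fun x => x = pair d0 (a p)) (pair d0 (a p) +' d1) ltac:(by rewrite /isP1; rec).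
exists m, b, (pair d0 (a p) +' d1); split=> [i _ z _ /H [_ /pair_inj]|]; first by left.
by apply/H; split=> //; dlra.
Qed.

Lemma pr_succ p n y : (exists m b N, pr_cert p n y m b N) ->
  exists m b N, pr_cert p (n +' d1) (g p n y) m b N.
Proof.
(* The new pair is hidden behind w, so that linear arithmetic treats its nonlinear code as an
   atom. *)
move=> [m [b [N [C E]]]]; have [w Ew] : exists w, w = pair (n +' d1) (g p n y) by eexists.
have [m' [b' H]] := @bounded_comprehension (fun x => cmem m b N x \/ x = w) (N +' w +' d1)
  ltac:(by apply: D1_or; [apply: D1_cmem; rec | rec]).
have up x : cmem m b N x -> cmem m' b' (N +' w +' d1) x.
  by move=> A; apply/H; split; [case: A => A _; clear Ew; dlra | left].
have wid x : x <' N -> x <' N +' w +' d1 by clear Ew; move=> ?; dlra.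
exists m', b', (N +' w +' d1); split; last by rewrite -Ew; apply/H; split; [clear Ew; dlra|right].
move=> i _ z _ /H [_ [A|]]; last rewrite [X in _ = X]Ew => /pair_inj [-> ->].
  have [iN zN] : i <' N /\ z <' N.
    by case: A => /io_lt L _; split; apply/io_lt; apply: le_lt_trans L; [exact: le_pair1|exact: le_pair2].
  have [|[i' [iN' [z' [zN' [F G B]]]]]] := C _ iN _ zN A; first by left.
  by right; exists i'; split; [exact: wid|]; exists z'; split; [exact: wid|]; split=> //; exact: up.
have [nN yN] : n <' N /\ y <' N.
  by case: E => /io_lt L _; split; apply/io_lt; apply: le_lt_trans L; [exact: le_pair1|exact: le_pair2].
by rewrite -?Ew; right; exists n; split; [exact: wid|]; exists y; split; [exact: wid|]; split=> //; exact: up.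
Qed.

Lemma primrec : exists h : D -> D -> D,
  [/\ isR2 h, forall p, h p d0 = a p & forall p n, h p (n +' d1) = g p n (h p n)].
Proof.
have T p : forall n, exists y m b N, pr_cert p n y m b N.
  apply: S1_ind.
  - apply: S1_ex.
    have := S1_cert => /(S1_subst (F := fun i r => match i with 0 => p | 1 => r 1 | _ => r 0 end%N)).
    by apply=> -[|[|i]]; constructor.
  - by exists (a p); exact: pr_zero.
  - by move=> n [y /pr_succ H]; exists (g p n y).
have U p n y y' : (exists m b N, pr_cert p n y m b N) -> (exists m b N, pr_cert p n y' m b N) -> y = y'.
  by move=> [m [b [N [C E]]]] [m' [b' [N' [C' E']]]]; apply: (pr_unique C C' E E').
pose h p n := sval (cid (T p n)).
have Hh p n : exists m b N, pr_cert p n (h p n) m b N := svalP (cid (T p n)).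
exists h; split.
- apply: (@S1_ext (fun r => exists m b N, pr_cert (r 1%N) (r 2%N) (r 0%N) m b N)).
    by move=> r; split=> [E|<-//]; exact: U (Hh _ _) E.
  have := S1_cert => /(S1_subst (F := fun i r => match i with 0 => r 1 | 1 => r 2 | _ => r 0 end%N)).
  by apply=> -[|[|i]]; constructor.
- by move=> p; apply: U (Hh _ _) (pr_zero p).
- by move=> p n; apply: U (Hh _ _) _; apply: pr_succ.
Qed.
End PrimRec.

(** * Semantics of the statements *)

(** Each notion below is the value in [M] of the formula of the same name, and is
    convertible to its satisfaction. *)
Record qt := Qt { qp : D; qn : D; qd : D }.
Definition qN t := Qt t d0 d1.
Definition qInv t := Qt d1 d0 t.
Definition qadd r s := Qt (qp r *' qd s +' qp s *' qd r)
  (qn r *' qd s +' qn s *' qd r) (qd r *' qd s).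
Definition qsub r s := qadd r (Qt (qn s) (qp s) (qd s)).
Definition qlt r s := qp r *' qd s +' qn s *' qd r <' qp s *' qd r +' qn r *' qd s.
Definition dle (x y : D) := x <' y \/ x = y.
Definition qle r s := dle (qp r *' qd s +' qn s *' qd r) (qp s *' qd r +' qn r *' qd s).

Definition Mis_exp2 E :=
  (forall p, (pair d0 p \inn E -> p = d1) /\ (p = d1 -> pair d0 p \inn E)) /\
  (forall k p, (pair (k +' d1) p \inn E -> exists r, pair k r \inn E /\ p = (d1 +' d1) *' r) /\
     ((exists r, pair k r \inn E /\ p = (d1 +' d1) *' r) -> pair (k +' d1) p \inn E)).
Definition Mwith_exp2 k (p : D -> Prop) :=
  exists E, Mis_exp2 E /\ exists t, pair k t \inn E /\ p t.

Definition msq := D -> (qt -> Prop) -> Prop.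
Definition Mconst r : msq := fun _ p => p r.
Definition Mset X : msq := fun k p =>
  exists a b c, pair k (pair (pair a b) c) \inn X /\ p (Qt a b (c +' d1)).
Definition Mrow X n : msq := fun k p =>
  exists a b c, pair (pair n k) (pair (pair a b) c) \inn X /\ p (Qt a b (c +' d1)).
Definition Madd (u v : msq) : msq :=
  fun k p => u (k +' d1) (fun r => v (k +' d1) (fun s => p (qadd r s))).
Definition Msub (u v : msq) : msq :=
  fun k p => u (k +' d1) (fun r => v (k +' d1) (fun s => p (qsub r s))).
Definition Mmodulus (u : msq) : Prop := forall k i, Mwith_exp2 k (fun t =>
  u k (fun r => u (k +' i) (fun s => qle r (qadd s (qInv t)) /\ qle s (qadd r (qInv t))))).
Definition Mis_ratseq X :=
  (forall z, z \inn X -> exists k a b c, z = pair k (pair (pair a b) c)) /\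
  (forall k, exists a b c, pair k (pair (pair a b) c) \inn X) /\
  (forall k q q', pair k q \inn X /\ pair k q' \inn X -> q = q').
Definition Mis_real X := Mis_ratseq X /\ Mmodulus (Mset X).
Definition Mis_realseq X :=
  (forall z, z \inn X -> exists n k a b c, z = pair (pair n k) (pair (pair a b) c)) /\
  (forall n k, exists a b c, pair (pair n k) (pair (pair a b) c) \inn X) /\
  (forall n k q q', pair (pair n k) q \inn X /\ pair (pair n k) q' \inn X -> q = q') /\
  (forall n, Mmodulus (Mrow X n)).
Definition Mle (u v : msq) := forall k, Mwith_exp2 k (fun t => u k (fun r => v k (fun s =>
  qle r (qadd s (Qt (d1 +' d1) d0 t))))).
Definition Mlt (u v : msq) := exists k, Mwith_exp2 k (fun t => u k (fun r => v k (fun s =>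
  qlt (qadd r (Qt (d1 +' d1) d0 t)) s))).
Definition M0 := Mconst (qN d0).
Definition M1 := Mconst (qN d1).
Definition Min01 u := Mle M0 u /\ Mle u M1.
Definition Meq u v := Mle u v /\ Mle v u.
Definition Mnear u v eps := Mlt (Msub v eps) u /\ Mlt u (Madd v eps).
Definition Mbounded X := exists a, Mis_real a /\ exists b, Mis_real b /\
  forall n, Mle (Mset a) (Mrow X n) /\ Mle (Mrow X n) (Mset b).
Definition Mmonotone X := (forall m n, m <' n -> Mle (Mrow X m) (Mrow X n)) \/
  (forall m n, m <' n -> Mle (Mrow X n) (Mrow X m)).
Definition Mcauchy X := forall eps, Mis_real eps -> Mlt M0 (Mset eps) ->
  exists k, forall m n, dle k m -> dle k n -> Mnear (Mrow X m) (Mrow X n) (Mset eps).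
Definition Mlimit X x := forall eps, Mis_real eps -> Mlt M0 (Mset eps) ->
  exists k, forall n, dle k n -> Mnear (Mrow X n) (Mset x) (Mset eps).
Definition Mis_sup (P : set -> Prop) s :=
  (forall x, Mis_real x -> P x -> Mle (Mset x) (Mset s)) /\
  (forall y, Mis_real y -> (forall x, Mis_real x -> P x -> Mle (Mset x) (Mset y)) -> Mle (Mset s) (Mset y)).
Definition Mis_inf (P : set -> Prop) s :=
  (forall x, Mis_real x -> P x -> Mle (Mset s) (Mset x)) /\
  (forall y, Mis_real y -> (forall x, Mis_real x -> P x -> Mle (Mset y) (Mset x)) -> Mle (Mset y) (Mset s)).
Definition Mis_row X n x := Mis_real x /\ forall k q,
  (pair k q \inn x -> pair (pair n k) q \inn X) /\ (pair (pair n k) q \inn X -> pair k q \inn x).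
Definition Min_open Q Q' u := exists n, Mset Q n (fun r => Mset Q' n (fun r' =>
  Mlt (Mconst r) u /\ Mlt u (Mconst r'))).
Definition Min_open01 Q Q' u := Min01 u /\ Min_open Q Q' u.
Definition Min_closed01 Q Q' u := Min01 u /\ (Min_open Q Q' u -> False).

Definition Mmonotone_convergence := forall X, Mis_realseq X -> Mbounded X -> Mmonotone X ->
  (forall n, Min01 (Mrow X n)) -> exists x, Mis_real x /\ Mlimit X x.
Definition Mcauchy_convergence := forall X, Mis_realseq X -> Mcauchy X ->
  exists x, Mis_real x /\ Mlimit X x.
Definition Msequence_sup := forall X, Mis_realseq X -> Mbounded X ->
  exists s, Mis_real s /\ Mis_sup (fun x => exists n, Meq (Mset x) (Mrow X n)) s.
Definition Mclosed_inf := forall Q Q', Mis_ratseq Q -> Mis_ratseq Q' ->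
  (exists x, Mis_real x /\ Min_closed01 Q Q' (Mset x)) ->
  exists s, Mis_real s /\ Mis_inf (fun x => Min_closed01 Q Q' (Mset x)) s.
Definition Mopen_sup := forall Q Q', Mis_ratseq Q -> Mis_ratseq Q' ->
  (exists x, Mis_real x /\ Min_open01 Q Q' (Mset x)) ->
  exists s, Mis_real s /\ Mis_sup (fun x => Min_open01 Q Q' (Mset x)) s.
Definition MOI4 := forall Q Q', Mis_ratseq Q -> Mis_ratseq Q' ->
  (forall y, Mis_real y -> Min01 (Mset y) ->
     (forall z, Mis_real z -> Min01 (Mset z) -> Mlt (Mset z) (Mset y) -> Min_open01 Q Q' (Mset z)) ->
     Min_open01 Q Q' (Mset y)) ->
  forall x, Mis_real x -> Min01 (Mset x) -> Min_open01 Q Q' (Mset x).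

Section Psi.
Variable P : set -> Prop.
Definition MOpen := forall x, Mis_real x -> P x ->
  exists eps, Mis_real eps /\ (Mlt M0 (Mset eps) /\
    forall y, Mis_real y -> Mlt (Msub (Mset x) (Mset eps)) (Mset y) /\
      Mlt (Mset y) (Madd (Mset x) (Mset eps)) -> P y).
Definition MProg := forall x, Mis_real x -> Min01 (Mset x) ->
  (forall y, Mis_real y -> Min01 (Mset y) -> Mlt (Mset y) (Mset x) -> P y) -> P x.
Definition MLCC := forall x, Mis_real x -> Min01 (Mset x) -> forall X, Mis_realseq X ->
  (forall n, Mle M0 (Mrow X n) /\ Mle (Mrow X n) (Mset x)) -> Mlimit X x ->
  (forall n, exists y, Mis_row X n y /\ P y) -> P x.
Definition Mat_zero := exists z, Mis_real z /\
  ((forall k, pair k (pair (pair d0 d0) d0) \inn z) /\ P z).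
Definition MOI1 := MOpen /\ MProg -> forall x, Mis_real x -> Min01 (Mset x) -> P x.
Definition MOI3 := MOpen /\ Mat_zero /\ MLCC -> forall x, Mis_real x -> Min01 (Mset x) -> P x.
End Psi.

Lemma holds_sentence p (P : Prop) : (forall rho sigma, sat M rho sigma p <-> P) ->
  holds M (sentence p) <-> P.
Proof.
move=> E; split=> [H|H q -> rho sigma]; last exact/E.
exact: (proj1 (E (fun _ => d0) (fun _ => rset R)) (H _ erefl _ _)).
Qed.

Lemma sem_monotone_convergence : holds M (sentence monotone_convergence) <-> Mmonotone_convergence.
Proof. by apply: holds_sentence => rho sigma; exact: iff_refl. Qed.
Lemma sem_cauchy_convergence : holds M (sentence cauchy_convergence) <-> Mcauchy_convergence.
Proof. by apply: holds_sentence => rho sigma; exact: iff_refl. Qed.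
Lemma sem_sequence_sup : holds M (sentence sequence_sup) <-> Msequence_sup.
Proof. by apply: holds_sentence => rho sigma; exact: iff_refl. Qed.
Lemma sem_closed_inf : holds M (sentence closed_inf) <-> Mclosed_inf.
Proof. by apply: holds_sentence => rho sigma; exact: iff_refl. Qed.
Lemma sem_open_sup : holds M (sentence open_sup) <-> Mopen_sup.
Proof. by apply: holds_sentence => rho sigma; exact: iff_refl. Qed.
Lemma sem_OI4 : holds M (sentence OI4) <-> MOI4.
Proof. by apply: holds_sentence => rho sigma; exact: iff_refl. Qed.

Section Schemas.

Lemma forall_iff T (A B : T -> Prop) : (forall x, A x <-> B x) -> (forall x, A x) <-> (forall x, B x).
Proof. by move=> H; split=> H' x; apply/H. Qed.
Lemma imp_iff (A B C D : Prop) : (A <-> B) -> (C <-> D) -> (A -> C) <-> (B -> D).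
Proof. tauto. Qed.
Lemma and_iff (A B C D : Prop) : (A <-> B) -> (C <-> D) -> (A /\ C) <-> (B /\ D).
Proof. tauto. Qed.

Variables (Psi : form) (rho : nat -> D) (sigma : nat -> set).
Definition msat (x : set) : Prop := sat M rho (scons x sigma) Psi.

(** The environments at an occurrence of [Psi] extend [rho] and [sigma] by the values of the
    quantifiers around it; the shift by [d] and [e] in [plug] skips these. *)
Lemma plug_msat rho' sigma' (X : hset) d e :
  (forall i, rho' (i + d)%coq_nat = rho i) -> (forall j, sigma' (j + e)%coq_nat = sigma j) ->
  sat M rho' sigma' (plug Psi [] [X] d e) <-> msat (sigma' (X e)).
Proof.
move=> Hr Hs; rewrite /plug sat_subst /msat /=.
rewrite (_ : (fun i => rho' _) = rho); last exact: funext.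
rewrite (_ : (fun j => sigma' _) = scons (sigma' (X e)) sigma) //.
by apply: funext => -[|j] /=.
Qed.

Ltac shifts := let i := fresh "i" in intro i; rewrite ?Nat.add_0_r;
  repeat (rewrite Nat.add_succ_r /=); rewrite ?Nat.add_0_r; reflexivity.
Ltac at_psi := refine (plug_msat _ _ _); shifts.

Lemma sem_Open : sat M rho sigma (Open Psi 0 0) <-> MOpen msat.
Proof.
apply: forall_iff => x; apply: imp_iff; first exact: iff_refl.
apply: imp_iff; first by at_psi.
apply: exists_iff => eps; apply: and_iff; first exact: iff_refl.
apply: and_iff; first exact: iff_refl.
apply: forall_iff => y; apply: imp_iff; first exact: iff_refl.
by apply: imp_iff; [exact: iff_refl|at_psi].
Qed.

Lemma sem_Prog : sat M rho sigma (Prog Psi 0 0) <-> MProg msat.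
Proof.
apply: forall_iff => x; apply: imp_iff; first exact: iff_refl.
apply: imp_iff; first exact: iff_refl.
apply: imp_iff; last by at_psi.
apply: forall_iff => y; apply: imp_iff; first exact: iff_refl.
by do 2!(apply: imp_iff; first exact: iff_refl); at_psi.
Qed.

Lemma sem_LCC : sat M rho sigma (LCC_seq Psi 0 0) <-> MLCC msat.
Proof.
apply: forall_iff => x; do 2!(apply: imp_iff; first exact: iff_refl).
apply: forall_iff => X; do 3!(apply: imp_iff; first exact: iff_refl).
apply: imp_iff; last by at_psi.
apply: forall_iff => n; apply: exists_iff => y.
by apply: and_iff; [exact: iff_refl|at_psi].
Qed.

Lemma sem_at_zero : sat M rho sigma (holds_at_zero Psi 0 0) <-> Mat_zero msat.
Proof.
apply: exists_iff => x; apply: and_iff; first exact: iff_refl.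
by apply: and_iff; [exact: iff_refl|at_psi].
Qed.

Lemma sem_conclusion :
  sat M rho sigma (hallS (fun x => himp (is_real x) (himp (in01 x) (plug Psi [] [x]))) 0 0)
  <-> forall x, Mis_real x -> Min01 (Mset x) -> msat x.
Proof.
apply: forall_iff => x; do 2!(apply: imp_iff; first exact: iff_refl); at_psi.
Qed.

Lemma sem_OI1 : sat M rho sigma (OI1 Psi) <-> MOI1 msat.
Proof.
apply: imp_iff; last exact: sem_conclusion.
by apply: and_iff; [exact: sem_Open|exact: sem_Prog].
Qed.

Lemma sem_OI3 : sat M rho sigma (OI3 Psi) <-> MOI3 msat.
Proof.
apply: imp_iff; last exact: sem_conclusion.
apply: and_iff; first exact: sem_Open.
by apply: and_iff; [exact: sem_at_zero|exact: sem_LCC].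
Qed.
End Schemas.

Lemma exp2_exists : exists h : D -> D,
  [/\ isR1 h, h d0 = d1 & forall n, h (n +' d1) = (d1 +' d1) *' h n].
Proof.
have [h [Hh h0 hS]] := @primrec (fun _ => d1) (fun _ _ y => (d1 +' d1) *' y)
   ltac:(by rewrite /isR1; rec) ltac:(by rewrite /isR3; rec).
by exists (h d0); split=> //; rewrite /isR1; rec.
Qed.
Definition exp2 : D -> D := sval (cid exp2_exists).
Lemma R1_exp2 : isR1 exp2. Proof. by rewrite /exp2; case: cid => h []. Qed.
Lemma exp2_0 : exp2 d0 = d1. Proof. by rewrite /exp2; case: cid => h []. Qed.
Lemma exp2_S n : exp2 (n +' d1) = (d1 +' d1) *' exp2 n.
Proof. by rewrite /exp2; case: cid => h []. Qed.

Lemma R_exp2 f : isR f -> isR (fun r => exp2 (f r)).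
Proof. exact: (R_app1 R1_exp2). Qed.

Ltac rec_extra ::= match goal with
  | |- isR (fun r => pair (@?f r) (@?g r)) => apply: R_pair
  | |- isR (fun r => exp2 (@?f r)) => apply: R_exp2
  end.

Lemma with_exp2P k (p : D -> Prop) : Mwith_exp2 k p <-> p (exp2 k).
Proof.
have U E : Mis_exp2 E -> forall n q, pair n q \inn E <-> q = exp2 n.
  move=> [E0 ES].
  have A : forall n, pair n (exp2 n) \inn E.
    apply: S1_ind.
    - by apply: S1_of_D1; rec.
    - by apply/E0; rewrite exp2_0.
    - by move=> n IH; apply/ES; exists (exp2 n); split=> //; rewrite exp2_S.
  (* Without the bound b on q the induction formula would be Pi^0_1. *)
  have B b : forall n q, q <' b -> pair n q \inn E -> q = exp2 n.
    apply: S1_ind.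
    - apply: S1_of_D1; apply: (@D1_ball (fun _ => b)); first by rec.
      by rec.
    - by move=> q _ /E0 ->; rewrite exp2_0.
    - move=> n IH q qb /ES [r [rE Eq]]; rewrite Eq exp2_S; congr (_ *' _); apply: IH => //.
      by dlra.
  by move=> n q; split=> [|->//]; apply: (B (q +' d1)); dlra.
split=> [[E [/U HE [t [/HE -> //]]]]|pk].
have [E HE] := @D1_set (fun z => exists k, k <' z +' d1 /\ z = pair k (exp2 k))
  ltac:(by apply: (@D1_bex (fun r => r 0%N +' d1)); rec).
have {}HE n q : pair n q \inn E <-> q = exp2 n.
  split=> [/HE [m [_ /pair_inj [-> ->]]]//|->]; apply/HE; exists n; split=> //.
  by have := le_pair1 n (exp2 n) => ?; apply/io_lt; rewrite ioD io1; lra.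
exists E; split; last by exists (exp2 k); split=> //; exact/HE.
split=> [q|n q]; first by rewrite HE exp2_0.
split=> [/HE ->|[r [/HE -> ->]]]; last by apply/HE; rewrite exp2_S.
by exists (exp2 n); split; [exact/HE | exact: exp2_S].
Qed.

(** * Negative powers of two and field-valued functions *)

Definition e2 (k : D) : K := (io (exp2 k))^-1.

Lemma exp2_gt n : io n < io (exp2 n).
Proof.
apply/io_lt; move: n; apply: S1_ind.
- by apply: S1_of_D1; rec.
- by rewrite exp2_0; dlra.
- by move=> n IH; rewrite exp2_S; dlra.
Qed.

Lemma exp2_gt0 n : 0 < io (exp2 n).
Proof. by apply: le_lt_trans (exp2_gt n); exact: io_ge0. Qed.

Lemma e2_gt0 k : 0 < e2 k. Proof. by rewrite invr_gt0 exp2_gt0. Qed.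
Lemma e2_0 : e2 d0 = 1. Proof. by rewrite /e2 exp2_0 io1 invr1. Qed.
Lemma e2_S k : e2 (k +' d1) = e2 k / 2.
Proof.
by rewrite /e2 exp2_S !ioE invfM mulrC.
Qed.

Lemma e2_le k j : io k <= io j -> e2 j <= e2 k.
Proof.
move=> /io_sub [i]; rewrite -ioD => /io_inj ->; clear j.
suff : forall i, ~ (io (exp2 (k +' i)) < io (exp2 k)).
  by move=> /(_ i) /negP; rewrite -leNgt => H; rewrite /e2 lef_pV2 ?posrE ?exp2_gt0.
apply: S1_ind.
- apply: S1_of_D1; apply: D1_not; apply: D1_io_lt; last by rec.
  by apply: R_exp2; rec.
- rewrite (_ : k +' d0 = k) ?ltxx //; dlra.
- move=> m /negP; rewrite -leNgt => IH; apply/negP; rewrite -leNgt.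
  rewrite (_ : k +' (m +' d1) = (k +' m) +' d1); last by dlra.
  by rewrite exp2_S; have := exp2_gt0 (k +' m) => ?; dlra.
Qed.

(** The field is archimedean relative to the numbers of the model: a positive element with
    denominator c + 1 is at least 1/(c + 1), and 2^(c + 1) exceeds c + 1. *)
Lemma e2_arch (x : K) : 0 < x -> exists k, e2 k < x.
Proof.
have [a [b [c ->]]] := io_rep x => x0; exists (c +' d1).
have c0 : 0 < io c + 1 by have := io_ge0 c; lra.
have ab : 1 <= io a - io b.
  have : 0 < io a - io b by move: x0; rewrite pmulr_lgt0 // invr_gt0.
  by rewrite subr_gt0 => /io_lt /io_S; lra.
apply: (@lt_le_trans _ _ (io c + 1)^-1).
  by rewrite /e2 ltf_pV2 ?posrE ?exp2_gt0 //; have := exp2_gt (c +' d1); rewrite ioD io1.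
by rewrite ler_pdivlMr // mulVf // gt_eqF.
Qed.

Lemma io_arch (x : K) : exists n, x < io n.
Proof.
have [a [b [c ->]]] := io_rep x; exists (a +' d1).
have c0 : 0 < io c + 1 by have := io_ge0 c; lra.
rewrite ltr_pdivrMr // ioD io1.
by have := mulr_ge0 (io_ge0 a) (io_ge0 c); io_pos; lra.
Qed.

(** Recursive numerators over a positive recursive denominator; cross multiplication then makes
    comparisons Delta^0_1. *)
Definition isK (f : env -> K) : Prop := exists a b d : env -> D,
  [/\ isR a, isR b, isR d & forall r, 0 < io (d r) /\ f r = (io (a r) - io (b r)) / io (d r)].

Lemma K_io f : isR f -> isK (fun r => io (f r)).
Proof.
move=> Hf; exists f, (fun _ => d0), (fun _ => d1); split; rec.
by move=> r; rewrite io0 io1 subr0 divr1 ltr01.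
Qed.

Lemma K_const x : isK (fun _ => x).
Proof.
have [a [b [c ->]]] := io_rep x; exists (fun _ => a), (fun _ => b), (fun _ => c +' d1); split; rec.
by move=> r; rewrite !ioE; split=> //; have := io_ge0 c; lra.
Qed.

Lemma K_add f g : isK f -> isK g -> isK (fun r => f r + g r).
Proof.
move=> [a [b [c [Ha Hb Hc E]]]] [a' [b' [c' [Ha' Hb' Hc' E']]]].
exists (fun r => a r *' c' r +' a' r *' c r), (fun r => b r *' c' r +' b' r *' c r), (fun r => c r *' c' r).
split; rec; move=> r; have [c0 ->] := E r; have [c0' ->] := E' r.
rewrite !ioE mulr_gt0 //; split=> //; rewrite addf_div ?gt_eqF //; congr (_ / _); ring.
Qed.

Lemma K_mul f g : isK f -> isK g -> isK (fun r => f r * g r).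
Proof.
move=> [a [b [c [Ha Hb Hc E]]]] [a' [b' [c' [Ha' Hb' Hc' E']]]].
exists (fun r => a r *' a' r +' b r *' b' r), (fun r => a r *' b' r +' b r *' a' r), (fun r => c r *' c' r).
split; rec; move=> r; have [c0 ->] := E r; have [c0' ->] := E' r.
rewrite !ioE mulr_gt0 //; split=> //; rewrite mulf_div; congr (_ / _); ring.
Qed.

Lemma K_opp f : isK f -> isK (fun r => - f r).
Proof.
move=> [a [b [c [Ha Hb Hc E]]]]; exists b, a, c; split=> // r; have [c0 ->] := E r.
by split=> //; rewrite -mulNr opprB.
Qed.

Lemma K_e2 f : isR f -> isK (fun r => e2 (f r)).
Proof.
move=> Hf; exists (fun _ => d1), (fun _ => d0), (fun r => exp2 (f r)); split; rec.
by move=> r; rewrite exp2_gt0 io0 io1 subr0 div1r.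
Qed.

Lemma K_if P f g : isD1 P -> isK f -> isK g -> isK (fun r => if `[< P r >] then f r else g r).
Proof.
move=> HP [a [b [c [Ha Hb Hc E]]]] [a' [b' [c' [Ha' Hb' Hc' E']]]].
exists (fun r => if `[< P r >] then a r else a' r), (fun r => if `[< P r >] then b r else b' r),
  (fun r => if `[< P r >] then c r else c' r); split; rec.
by move=> r; case: ifP.
Qed.

Lemma D1_ltK f g : isK f -> isK g -> isD1 (fun r => f r < g r).
Proof.
move=> [a [b [c [Ha Hb Hc E]]]] [a' [b' [c' [Ha' Hb' Hc' E']]]].
apply: (@D1_ext (fun r => a r *' c' r +' b' r *' c r <' a' r *' c r +' b r *' c' r)); last by rec.
move=> r; have [c0 ->] := E r; have [c0' ->] := E' r.
rewrite ltr_pdivrMr // mulrAC ltr_pdivlMr //.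
by split=> [/io_lt|H]; rewrite ?ioE; [|apply/io_lt]; rewrite ?ioE; lra.
Qed.

Lemma D1_leK f g : isK f -> isK g -> isD1 (fun r => f r <= g r).
Proof.
move=> A B; apply: (@D1_ext (fun r => ~ (g r < f r))); last by apply: D1_not; exact: D1_ltK.
by move=> r; rewrite leNgt; split=> [/negP|/negP].
Qed.

Definition isK1 (u : D -> K) := isK (fun r => u (r 0%N)).
Definition isK2 (u : D -> D -> K) := isK (fun r => u (r 0%N) (r 1%N)).

Lemma R_subst f (F : nat -> env -> D) : (forall i, isTm M (F i)) ->
  isR f -> isR (fun r => f (fun i => F i r)).
Proof.
move=> HF Hf.
refine (@S1_subst _ (scons (fun r => r 0%N) (fun i r => F i (fun i => r (S i)))) _ Hf).
by move=> [|i]; [constructor | exact: isTm_shift].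
Qed.

Lemma K_app1 u f : isK1 u -> isR f -> isK (fun r => u (f r)).
Proof.
move=> [a [b [c [Ha Hb Hc E]]]] Hf.
have T g : isR g -> isR (fun r => g (fun _ => f r)).
  move=> Hg; apply: (@R_app1 (fun x => g (fun _ => x))) => //.
  by apply: (@R_subst g (fun _ r => r 0%N)) => // i; constructor.
exists (fun r => a (fun _ => f r)), (fun r => b (fun _ => f r)), (fun r => c (fun _ => f r)).
by split; try exact: T; move=> r; exact: E.
Qed.

Lemma K_app2 u f g : isK2 u -> isR f -> isR g -> isK (fun r => u (f r) (g r)).
Proof.
move=> [a [b [c [Ha Hb Hc E]]]] Hf Hg.
have T h : isR h -> isR (fun r => h (scons (f r) (fun _ => g r))).
  move=> Hh; apply: (@R_app2 (fun x y => h (scons x (fun _ => y)))) => //.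
  have := @R_subst h (fun i r => match i with 0 => r 0 | _ => r 1 end%N) _ Hh.
  rewrite /isR2; have -> : (fun r => h (scons (r 0%N) (fun _ => r 1%N))) =
    (fun r : env => h (fun i => match i with 0 => r 0 | _ => r 1 end%N)).
    by apply: funext => r; congr h; apply: funext => -[].
  by apply=> -[|i]; constructor.
exists (fun r => a (scons (f r) (fun _ => g r))), (fun r => b (scons (f r) (fun _ => g r))),
  (fun r => c (scons (f r) (fun _ => g r))).
by split; try exact: T; move=> r; exact: E.
Qed.

Ltac rec_extra ::= match goal with
  | |- isR (fun r => pair (@?f r) (@?g r)) => apply: R_pair
  | |- isR (fun r => exp2 (@?f r)) => apply: R_exp2
  | |- isK (fun r => io (@?f r)) => apply: K_io
  | |- isK (fun r => ?c) => apply: K_const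
  | |- isK (fun r => e2 (@?f r)) => apply: K_e2
  | |- isK (fun r => @?f r + @?g r) => apply: K_add
  | |- isK (fun r => @?f r * @?g r) => apply: K_mul
  | |- isK (fun r => - @?f r) => apply: K_opp
  | |- isK (fun r => if `[< _ >] then _ else _) => apply: K_if
  | h : isK1 ?u |- isK (fun r => ?u (@?f r)) => apply: (K_app1 h)
  | h : isK2 ?u |- isK (fun r => ?u (@?f r) (@?g r)) => apply: (K_app2 h)
  | |- isD1 (fun r => is_true (@?f r < @?g r)) => apply: D1_ltK
  | |- isD1 (fun r => is_true (@?f r <= @?g r)) => apply: D1_leK
  end.

Lemma le_ltS (x y : D) : io x <= io y -> x <' y +' d1.
Proof. by move=> ?; dlra. Qed.

(** * Coded reals *)

Definition okq (r : qt) : Prop := 0 < io (qd r).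
Definition val (r : qt) : K := (io (qp r) - io (qn r)) / io (qd r).

Lemma dleP (x y : D) : dle x y <-> io x <= io y.
Proof.
split=> [[/io_lt /ltW //|->//]|]; rewrite le_eqVlt => /orP [/eqP /io_inj ->|/io_lt]; by [right|left].
Qed.

Lemma qltP r s : okq r -> okq s -> qlt r s <-> val r < val s.
Proof.
rewrite /okq /qlt /val => r0 s0; rewrite io_lt !ioE ltr_pdivrMr // mulrAC ltr_pdivlMr //.
by split=> ?; lra.
Qed.

Lemma qleP r s : okq r -> okq s -> qle r s <-> val r <= val s.
Proof.
rewrite /okq /qle /val => r0 s0; rewrite dleP !ioE ler_pdivrMr // mulrAC ler_pdivlMr //.
by split=> ?; lra.
Qed.

Lemma qadd_ok r s : okq r -> okq s -> okq (qadd r s) /\ val (qadd r s) = val r + val s.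
Proof.
rewrite /okq /val /= => r0 s0; rewrite !ioE mulr_gt0 //; split=> //.
by rewrite addf_div ?gt_eqF //; congr (_ / _); ring.
Qed.

Lemma qsub_ok r s : okq r -> okq s -> okq (qsub r s) /\ val (qsub r s) = val r - val s.
Proof.
move=> r0 s0; have [] := @qadd_ok r (Qt (qn s) (qp s) (qd s)) r0 s0; rewrite -/(qsub r s) => ? ->.
by split=> //; congr (_ + _); rewrite /val /= -mulNr opprB.
Qed.

Lemma qInv_ok k : okq (Qt d1 d0 (exp2 k)) /\ val (Qt d1 d0 (exp2 k)) = e2 k.
Proof. by rewrite /okq /val /= exp2_gt0 io0 io1 subr0 div1r. Qed.

Lemma q2Inv_ok k : okq (Qt (d1 +' d1) d0 (exp2 k)) /\ val (Qt (d1 +' d1) d0 (exp2 k)) = 2 * e2 k.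
Proof. by rewrite /okq /val /= exp2_gt0 !ioE subr0. Qed.

(** A sequence in the statements hands its k-th term to a continuation. Here that term is named, so
    that nested continuations collapse to an inequality between values. *)
Definition den (u : msq) (v : D -> K) : Prop := exists f : D -> qt,
  (forall k p, u k p <-> p (f k)) /\ forall k, okq (f k) /\ val (f k) = v k.

Lemma den_add u v f g : den u f -> den v g -> den (Madd u v) (fun k => f (k +' d1) + g (k +' d1)).
Proof.
move=> [a [Ea Ha]] [b [Eb Hb]]; exists (fun k => qadd (a (k +' d1)) (b (k +' d1))); split=> k.
  by move=> p; rewrite /Madd Ea Eb.
have [a0 <-] := Ha (k +' d1); have [b0 <-] := Hb (k +' d1); exact: qadd_ok.
Qed.

Lemma den_sub u v f g : den u f -> den v g -> den (Msub u v) (fun k => f (k +' d1) - g (k +' d1)).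
Proof.
move=> [a [Ea Ha]] [b [Eb Hb]]; exists (fun k => qsub (a (k +' d1)) (b (k +' d1))); split=> k.
  by move=> p; rewrite /Msub Ea Eb.
have [a0 <-] := Ha (k +' d1); have [b0 <-] := Hb (k +' d1); exact: qsub_ok.
Qed.

Lemma den_const r : okq r -> den (Mconst r) (fun _ => val r).
Proof. by move=> r0; exists (fun _ => r). Qed.

Lemma den_0 : den M0 (fun _ => 0).
Proof.
have -> : (fun _ : D => 0 : K) = (fun _ => val (qN d0)) by rewrite /val /= io0 subr0 mul0r.
by apply: den_const; rewrite /okq /= io1.
Qed.
Lemma den_1 : den M1 (fun _ => 1).
Proof.
have -> : (fun _ : D => 1 : K) = (fun _ => val (qN d1)) by rewrite /val /= io0 io1 subr0 divr1.
by apply: den_const; rewrite /okq /= io1.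
Qed.

Definition leR (f g : D -> K) : Prop := forall k, f k <= g k + 2 * e2 k.
Definition ltR (f g : D -> K) : Prop := exists k, f k + 2 * e2 k < g k.
Definition reg (f : D -> K) : Prop := forall k j, io k <= io j ->
  f k <= f j + e2 k /\ f j <= f k + e2 k.

Lemma Mle_E u v f g : den u f -> den v g -> Mle u v <-> leR f g.
Proof.
move=> [a [Ea Ha]] [b [Eb Hb]].
have E k : Mwith_exp2 k (fun t => u k (fun r => v k (fun s => qle r (qadd s (Qt (d1 +' d1) d0 t)))))
   <-> f k <= g k + 2 * e2 k.
  have [a0 <-] := Ha k; have [b0 <-] := Hb k.
  rewrite with_exp2P Ea Eb.
  by have [c0 <-] := q2Inv_ok k; have [d0 <-] := qadd_ok b0 c0; rewrite qleP.
by split=> H k; apply/E.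
Qed.

Lemma Mlt_E u v f g : den u f -> den v g -> Mlt u v <-> ltR f g.
Proof.
move=> [a [Ea Ha]] [b [Eb Hb]].
have E k : Mwith_exp2 k (fun t => u k (fun r => v k (fun s => qlt (qadd r (Qt (d1 +' d1) d0 t)) s)))
   <-> f k + 2 * e2 k < g k.
  have [a0 <-] := Ha k; have [b0 <-] := Hb k.
  rewrite with_exp2P Ea Eb.
  by have [c0 <-] := q2Inv_ok k; have [d0 <-] := qadd_ok a0 c0; rewrite qltP.
by split=> -[k H]; exists k; apply/E.
Qed.

Lemma Mmodulus_E u f : den u f -> Mmodulus u <-> reg f.
Proof.
move=> [a [Ea Ha]].
have E k i : Mwith_exp2 k (fun t => u k (fun r => u (k +' i) (fun s =>
     qle r (qadd s (qInv t)) /\ qle s (qadd r (qInv t)))))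
   <-> f k <= f (k +' i) + e2 k /\ f (k +' i) <= f k + e2 k.
  have [a0 <-] := Ha k; have [b0 <-] := Ha (k +' i).
  rewrite with_exp2P Ea Ea; have [c0 <-] := qInv_ok k.
  by have [? <-] := qadd_ok b0 c0; have [? <-] := qadd_ok a0 c0; rewrite !qleP.
split=> H k i; last by apply/E; apply: H; rewrite ioD; have := io_ge0 i; lra.
by move=> /io_sub [j]; rewrite -ioD => /io_inj ->; apply/E.
Qed.

(** The index z is k for a real and [pair n k] for a sequence of reals, so that both kinds of codes
    are handled together. *)
Definition entry (X : set) (z : D) : Prop := exists t : D * D * D,
  pair z (pair (pair t.1.1 t.1.2) t.2) \inn X.
Definition rt (X : set) (z : D) : qt :=
  match pselect (entry X z) with
  | left e => let t := sval (cid e) in Qt t.1.1 t.1.2 (t.2 +' d1)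
  | right _ => Qt d0 d0 d1 end.
Definition vg (X : set) (z : D) : K := val (rt X z).

Lemma rt_ok X z : okq (rt X z).
Proof.
rewrite /okq /rt; case: pselect => e /=; rewrite ?ioE; last by [].
by have := io_ge0 (sval (cid e)).2; lra.
Qed.

Definition entry1 X z := (exists a b c, pair z (pair (pair a b) c) \inn X) /\
  (forall q q', pair z q \inn X /\ pair z q' \inn X -> q = q').

Lemma rtP X z a b c : entry1 X z -> pair z (pair (pair a b) c) \inn X <-> rt X z = Qt a b (c +' d1).
Proof.
move=> [[a' [b' [c' Hc']]] U]; rewrite /rt; case: pselect => e; last by case: e; exists (a', b', c').
have H := svalP (cid e); move: (sval (cid e)) H => [[a1 b1] c1] /= H; split=> [H'|[<- <- E]].
  by have /pair_inj [/pair_inj [-> ->] ->] := U _ _ (conj H H').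
by suff <- : c1 = c by []; dlra.
Qed.

Lemma den_entry X (T : D -> D) : (forall k, entry1 X (T k)) ->
  den (fun k p => exists a b c, pair (T k) (pair (pair a b) c) \inn X /\ p (Qt a b (c +' d1)))
      (fun k => vg X (T k)).
Proof.
move=> H; exists (fun k => rt X (T k)); split=> [k p|k]; last by split=> //; exact: rt_ok.
split=> [[a [b [c [/rtP - /(_ (H k)) ->]]]]//|].
have [[a [b [c Hc]]] _] := H k => pr; exists a, b, c; split=> //.
by move: Hc pr => /rtP - /(_ (H k)) ->.
Qed.

Lemma ratseq_entry X : Mis_ratseq X -> forall k, entry1 X k.
Proof. by move=> [_ [A B]] k; exact: (conj (A k) (B k)). Qed.
Lemma realseq_entry X : Mis_realseq X -> forall n k, entry1 X (pair n k).
Proof. by move=> [_ [A [B _]]] n k; exact: (conj (A n k) (B n k)). Qed.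

Lemma den_set X : Mis_ratseq X -> den (Mset X) (vg X).
Proof. by move=> /ratseq_entry H; exact: (den_entry (T := fun k => k)). Qed.
Lemma den_row X n : Mis_realseq X -> den (Mrow X n) (fun k => vg X (pair n k)).
Proof. by move=> /realseq_entry H; exact: (den_entry (T := fun k => pair n k)). Qed.

Lemma Mle_set X Y : Mis_real X -> Mis_real Y -> Mle (Mset X) (Mset Y) <-> leR (vg X) (vg Y).
Proof. by move=> [HX _] [HY _]; exact: Mle_E (den_set HX) (den_set HY). Qed.
Lemma Mlt_set X Y : Mis_real X -> Mis_real Y -> Mlt (Mset X) (Mset Y) <-> ltR (vg X) (vg Y).
Proof. by move=> [HX _] [HY _]; exact: Mlt_E (den_set HX) (den_set HY). Qed.
Lemma Mle_set_row n X Y : Mis_real Y -> Mis_realseq X ->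
  Mle (Mset Y) (Mrow X n) <-> leR (vg Y) (fun k => vg X (pair n k)).
Proof. by move=> [HY _] HX; exact: Mle_E (den_set HY) (den_row n HX). Qed.
Lemma Mle_row_set n X Y : Mis_realseq X -> Mis_real Y ->
  Mle (Mrow X n) (Mset Y) <-> leR (fun k => vg X (pair n k)) (vg Y).
Proof. by move=> HX [HY _]; exact: Mle_E (den_row n HX) (den_set HY). Qed.

(** The graph of each component of an entry is Sigma^0_1: the remaining components are quantified,
    and uniqueness of the entry identifies the value. *)
Lemma K_vg X (T : env -> D) : isR T -> (forall r, entry1 X (T r)) -> isK (fun r => vg X (T r)).
Proof.
move=> HT H; exists (fun r => qp (rt X (T r))), (fun r => qn (rt X (T r))), (fun r => qd (rt X (T r))).
split; last by move=> r; split=> //; exact: rt_ok.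
- apply: (@S1_ext (fun r => exists b c, pair (T (fun i => r (S i))) (pair (pair (r 0%N) b) c) \inn X)).
    move=> r; split=> [[b [c /rtP - /(_ (H _)) -> //]]|].
    have [[a [b [c Hc]]] _] := H (fun i => r (S i)).
    by have := Hc => /rtP - /(_ (H _)) -> /= <-; exists b, c.
  apply: S1_ex; apply: S1_ex; apply: S1_of_D1; apply: D1_mem.
  by apply: R_pair; [exact: (R_shift (R_shift (R_shift HT)))|rec].
- apply: (@S1_ext (fun r => exists b c, pair (T (fun i => r (S i))) (pair (pair b (r 0%N)) c) \inn X)).
    move=> r; split=> [[b [c /rtP - /(_ (H _)) -> //]]|].
    have [[a [b [c Hc]]] _] := H (fun i => r (S i)).
    by have := Hc => /rtP - /(_ (H _)) -> /= <-; exists a, c.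
  apply: S1_ex; apply: S1_ex; apply: S1_of_D1; apply: D1_mem.
  by apply: R_pair; [exact: (R_shift (R_shift (R_shift HT)))|rec].
- apply: (@S1_ext (fun r => exists a b c, pair (T (fun i => r (S i))) (pair (pair a b) c) \inn X
     /\ c +' d1 = r 0%N)).
    move=> r; split=> [[a [b [c [/rtP - /(_ (H _)) -> //]]]]|].
    have [[a [b [c Hc]]] _] := H (fun i => r (S i)).
    by have := Hc => /rtP - /(_ (H _)) -> /= <-; exists a, b, c.
  apply: S1_ex; apply: S1_ex; apply: S1_ex; apply: S1_of_D1; apply: D1_and; last by rec.
  apply: D1_mem.
  by apply: R_pair; [exact: (R_shift (R_shift (R_shift (R_shift HT))))|rec].
Qed.

Lemma K1_vg X : Mis_ratseq X -> isK1 (vg X).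
Proof. by move=> /ratseq_entry H; apply: K_vg => //; rec. Qed.
Lemma K2_vg X : Mis_realseq X -> isK2 (fun n k => vg X (pair n k)).
Proof. by move=> /realseq_entry H; apply: K_vg => //; rec. Qed.

Lemma real_reg X : Mis_real X -> reg (vg X).
Proof. by move=> [H1 H2]; apply/(Mmodulus_E (den_set H1)). Qed.
Lemma realseq_reg X : Mis_realseq X -> forall n, reg (fun k => vg X (pair n k)).
Proof. by move=> H n; apply/(Mmodulus_E (den_row n H)); case: H => _ [_ [_]]. Qed.

Lemma R1_diag g : isR g -> isR1 (fun x => g (fun _ => x)).
Proof.
by move=> Hg; apply: (@R_subst g (fun _ r => r 0%N)) => // i; exact: (isTm_var M 0).
Qed.

(** The index class [I] is there because a code may contain nothing but well-formed entries: for a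
    real every number is an index, for a sequence of reals only the pairs are. All quantifiers in
    the definition of X are bounded, since a pair dominates its components. *)
Lemma coded (I : D -> Prop) (u : D -> K) : isP1 I -> isK1 u -> exists X,
  (forall w, w \inn X -> exists z a b c, I z /\ w = pair z (pair (pair a b) c)) /\
  (forall z, I z -> entry1 X z /\ vg X z = u z).
Proof.
move=> HI [a [b [d [Ha Hb Hd E]]]].
have [X HX] := @D1_set (fun w => exists z, z <' w +' d1 /\ exists x, x <' w +' d1 /\
   exists y, y <' w +' d1 /\ exists c, c <' w +' d1 /\ (I z /\ (w = pair z (pair (pair x y) c) /\
   (x = a (fun _ => z) /\ (y = b (fun _ => z) /\ c +' d1 = d (fun _ => z))))))
  ltac:(have := R1_diag Ha; have := R1_diag Hb; have := R1_diag Hd; move=> ? ? ?; rewrite /isP1;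
    apply: (D1_bex (f := fun r => r 0%N +' d1)); first (by rec);
    apply: (D1_bex (f := fun r => r 1%N +' d1)); first (by rec);
    apply: (D1_bex (f := fun r => r 2%N +' d1)); first (by rec);
    apply: (D1_bex (f := fun r => r 3%N +' d1)); first (by rec);
    apply: D1_and; [by rec|]; apply: D1_and; [by rec|];
    apply: D1_and; [apply: D1_eq; [by rec|apply: (@R_app1 (fun z => a (fun _ => z))); [by []|by rec]]|];
    apply: D1_and; [apply: D1_eq; [by rec|apply: (@R_app1 (fun z => b (fun _ => z))); [by []|by rec]]|];
    apply: D1_eq; [by rec|apply: (@R_app1 (fun z => d (fun _ => z))); [by []|by rec]]).
have S1 z : exists c, c +' d1 = d (fun _ => z).
  have [d0' _] := E (fun _ => z); have [E'|[c ->]] := io_0or (d (fun _ => z)); last by exists c.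
  by move: d0'; rewrite E' io0 ltxx.
have HX' z x y c : I z -> pair z (pair (pair x y) c) \inn X <->
    [/\ x = a (fun _ => z), y = b (fun _ => z) & c +' d1 = d (fun _ => z)].
  move=> Iz; rewrite HX; split.
    by move=> [z' [_ [x' [_ [y' [_ [c' [_ [_ [/pair_inj [-> /pair_inj [/pair_inj [-> ->] ->]]]]]]]]]]]] [-> [-> ->]].
  have L1 := le_pair1 z (pair (pair x y) c); have L2 := le_pair2 z (pair (pair x y) c).
  have L3 := le_pair1 (pair x y) c; have L4 := le_pair2 (pair x y) c.
  have L5 := le_pair1 x y; have L6 := le_pair2 x y.
  move=> [Ex Ey Ec]; exists z; split; first by apply: le_ltS; clear Ex Ey Ec; lra.
  exists x; split; first by apply: le_ltS; clear Ex Ey Ec; lra.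
  exists y; split; first by apply: le_ltS; clear Ex Ey Ec; lra.
  by exists c; split; first by apply: le_ltS; clear Ex Ey Ec; lra.
exists X; split.
  move=> w /HX [z [_ [x [_ [y [_ [c [_ [Iz [Ew _]]]]]]]]]].
  by exists z, x, y, c.
move=> z Iz; have [c Ec] := S1 z.
have F : pair z (pair (pair (a (fun _ => z)) (b (fun _ => z))) c) \inn X by apply/HX'.
have F' : entry1 X z.
  split; first by exists (a (fun _ => z)), (b (fun _ => z)), c.
  suff U q : pair z q \inn X -> q = pair (pair (a (fun _ => z)) (b (fun _ => z))) c.
    by move=> q q' [/U -> /U ->].
  move=> /HX [z' [_ [x' [_ [y' [_ [c' [_ [_ [/pair_inj [<- ->] [-> [-> Ec']]]]]]]]]]]].
  by congr pair; dlra.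
split=> //; have := F => /rtP - /(_ F'); rewrite /vg => ->.
by rewrite /val /= Ec; have [_ ->] := E (fun _ => z).
Qed.

Lemma mk_ratseq u : isK1 u -> exists X, Mis_ratseq X /\ vg X = u.
Proof.
move=> Hu; have [X [H1 H2]] := @coded (fun _ => True) u ltac:(by rewrite /isP1; rec) Hu.
exists X; split; last by apply: funext => z; have [] := H2 z Logic.I.
split; first by move=> w /H1 [z [a [b [c [_ ->]]]]]; exists z, a, b, c.
by split=> k; have [[A B] _] := H2 k Logic.I.
Qed.

Lemma mk_real u : isK1 u -> reg u -> exists X, Mis_real X /\ vg X = u.
Proof.
move=> Hu Ru; have [X [HX E]] := mk_ratseq Hu; exists X; split=> //; split=> //.
by apply/(Mmodulus_E (den_set HX)); rewrite E.
Qed.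

(** Found by bounded search. Pairing is injective but not onto; on other numbers the condition is
    vacuous, which makes the search total. *)
Lemma unpair : exists p q : D -> D, [/\ isR1 p, isR1 q & forall x y, p (pair x y) = x /\ q (pair x y) = y].
Proof.
have [p [Hp Ep]] := @R_choice (fun r x => forall y, y <' r 0%N +' d1 -> forall z, z <' r 0%N +' d1 ->
    r 0%N = pair y z -> x = y)
  ltac:(apply: (D1_ball (f := fun r => r 1%N +' d1)); first (by rec);
    apply: (D1_ball (f := fun r => r 2%N +' d1)); rec)
  ltac:(move=> r; have [[y [z E]]|N] := pselect (exists y z, r 0%N = pair y z);
     [by exists y => y' _ z' _; rewrite E => /pair_inj [] | by exists d0 => y _ z _ E; case: N; exists y, z]).
have [q [Hq Eq]] := @R_choice (fun r x => forall y, y <' r 0%N +' d1 -> forall z, z <' r 0%N +' d1 ->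
    r 0%N = pair y z -> x = z)
  ltac:(apply: (D1_ball (f := fun r => r 1%N +' d1)); first (by rec);
    apply: (D1_ball (f := fun r => r 2%N +' d1)); rec)
  ltac:(move=> r; have [[y [z E]]|N] := pselect (exists y z, r 0%N = pair y z);
     [by exists z => y' _ z' _; rewrite E => /pair_inj [] | by exists d0 => y _ z _ E; case: N; exists y, z]).
exists (fun x => p (fun _ => x)), (fun x => q (fun _ => x)); split.
- exact: R1_diag.
- exact: R1_diag.
- move=> x y.
  have L1 : x <' pair x y +' d1 by apply: le_ltS; exact: le_pair1.
  have L2 : y <' pair x y +' d1 by apply: le_ltS; exact: le_pair2.
  by split; [apply: (Ep (fun _ => pair x y)) L1 _ L2 _ | apply: (Eq (fun _ => pair x y)) L1 _ L2 _].
Qed.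

Lemma mk_realseq (u : D -> D -> K) : isK2 u -> (forall n, reg (u n)) ->
  exists X, Mis_realseq X /\ forall n k, vg X (pair n k) = u n k.
Proof.
move=> Hu Ru; have [p [q [Hp Hq E]]] := unpair.
have [X [H1 H2]] := @coded (fun z => exists n, n <' z +' d1 /\ exists k, k <' z +' d1 /\ z = pair n k)
   (fun z => u (p z) (q z))
   ltac:(by rewrite /isP1; apply: (D1_bex (f := fun r => r 0%N +' d1)); first (by rec);
    apply: (D1_bex (f := fun r => r 1%N +' d1)); rec) ltac:(by rewrite /isK1; rec).
have I n k : exists n', n' <' pair n k +' d1 /\ exists k', k' <' pair n k +' d1 /\ pair n k = pair n' k'.
  exists n; split; first by apply: le_ltS; exact: le_pair1.
  by exists k; split=> //; apply: le_ltS; exact: le_pair2.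
have V n k : vg X (pair n k) = u n k by have [_ ->] := H2 _ (I n k); have [-> ->] := E n k.
have En n k : entry1 X (pair n k) by have [] := H2 _ (I n k).
exists X; split=> //; split; first by move=> w /H1 [z [a [b [c [[n [_ [k [_ ->]]]] ->]]]]]; exists n, k, a, b, c.
split; first by move=> n k; case: (En n k).
split; first by move=> n k; case: (En n k).
move=> n; apply/(Mmodulus_E (den_entry (T := fun k => pair n k) (En n))).
by rewrite (_ : (fun k => _) = u n); last exact: funext.
Qed.

(** * Rational cuts of regular sequences *)

Section Order.
Implicit Types (f g h : D -> K) (q : K).

(** The Sigma^0_1 forms of q < f and f < q for the real given by f. Facts about the order of reals
    are reduced to these two cuts. *)
Definition lo f q : Prop := exists k, q + e2 k < f k.
Definition hi f q : Prop := exists k, f k + e2 k < q.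

(** The factor 8 leaves room for the several errors [e2 j] that accumulate in later estimates. *)
Lemma e2_small (x : K) : 0 < x -> exists k, forall j, io k <= io j -> 8 * e2 j < x.
Proof.
move=> x0; have [k Hk] := @e2_arch (x / 8) ltac:(by lra).
by exists k => j /e2_le; lra.
Qed.

Lemma io_max (a b : D) : exists c, io a <= io c /\ io b <= io c.
Proof. by exists (a +' b); rewrite ioD; io_pos; lra. Qed.

Lemma reg2 f : reg f -> forall j k, f j <= f k + e2 j + e2 k.
Proof.
move=> H j k; have A := e2_gt0 j; have B := e2_gt0 k.
by have [L|/ltW L] := lerP (io j) (io k); have [] := H _ _ L; lra.
Qed.

Lemma reg_cst q : reg (fun _ : D => q).
Proof. by move=> k j _; have := e2_gt0 k; lra. Qed.

Lemma lo_lt f q : reg f -> lo f q -> forall k, q < f k + e2 k.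
Proof. by move=> Rf [j Hj] k; have := reg2 Rf j k; lra. Qed.
Lemma hi_lt f q : reg f -> hi f q -> forall k, f k - e2 k < q.
Proof. by move=> Rf [j Hj] k; have := reg2 Rf k j; lra. Qed.
Lemma nlo f q : ~ lo f q -> forall k, f k <= q + e2 k.
Proof. by move=> H k; rewrite leNgt; apply/negP => L; apply: H; exists k. Qed.
Lemma lo_hi f q q' : reg f -> lo f q -> hi f q' -> q < q'.
Proof. by move=> Rf [j A] [k B]; have := reg2 Rf j k; lra. Qed.
Lemma lo_or_hi f q q' : q < q' -> lo f q \/ hi f q'.
Proof.
move=> L; have [k /(_ k (lexx _)) Hk] := @e2_small (q' - q) ltac:(by rewrite subr_gt0).
by have := e2_gt0 k; have [A|A] := ltrP (q + e2 k) (f k); [left|right]; exists k; lra.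
Qed.
Lemma lo_open f q : lo f q -> exists q', q < q' /\ lo f q'.
Proof. by move=> [k L]; exists ((q + (f k - e2 k)) / 2); split; [lra | exists k; lra]. Qed.
Lemma hi_open f q : hi f q -> exists q', q' < q /\ hi f q'.
Proof. by move=> [k L]; exists ((q + (f k + e2 k)) / 2); split; [lra | exists k; lra]. Qed.
Lemma lo_le f q q' : q' <= q -> lo f q -> lo f q'.
Proof. by move=> L [k H]; exists k; lra. Qed.
Lemma hi_le f q q' : q <= q' -> hi f q -> hi f q'.
Proof. by move=> L [k H]; exists k; lra. Qed.

Lemma lo_cst q q' : lo (fun _ => q) q' <-> q' < q.
Proof.
split=> [[k H]|L]; first by have := e2_gt0 k; lra.
by have [k Hk] := @e2_arch (q - q') ltac:(by lra); exists k; lra.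
Qed.
Lemma hi_cst q q' : hi (fun _ => q) q' <-> q < q'.
Proof.
split=> [[k H]|L]; first by have := e2_gt0 k; lra.
by have [k Hk] := @e2_arch (q' - q) ltac:(by lra); exists k; lra.
Qed.

(** The order of reals demands a gap of 2 * 2^-k at index k itself. A separating rational leaves a
    fixed gap, which dominates this tolerance at a late enough index. *)
Lemma ltRP f g : reg f -> reg g -> ltR f g <-> exists q, hi f q /\ lo g q.
Proof.
move=> Rf Rg; split=> [[k H]|[q [[j A] [k B]]]].
  by exists ((f k + g k) / 2); split; exists k; lra.
have [n Hn] := @e2_small (q - (f j + e2 j)) ltac:(by lra).
exists (j +' k +' n); have [_ A'] := Rf j (j +' k +' n) ltac:(by rewrite !ioD; io_pos; lra).
have [B' _] := Rg k (j +' k +' n) ltac:(by rewrite !ioD; io_pos; lra).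
by have := Hn (j +' k +' n) ltac:(by rewrite !ioD; io_pos; lra); have := e2_gt0 (j +' k +' n); lra.
Qed.

Lemma nltR f g : ~ ltR g f <-> leR f g.
Proof.
split=> [H k|H [k]]; last by have := H k; lra.
by rewrite leNgt; apply/negP => L; apply: H; exists k.
Qed.

Lemma leR_lo f g q : reg f -> reg g -> leR f g -> lo f q -> lo g q.
Proof.
move=> Rf Rg /nltR L /lo_open [q' [Lq H]]; have [//|H'] := lo_or_hi g Lq.
by case: L; apply/ltRP => //; exists q'.
Qed.
Lemma leR_of_lo f g : reg f -> reg g -> (forall q, lo f q -> lo g q) -> leR f g.
Proof.
move=> Rf Rg H; apply/nltR => /ltRP [//|//|q [A /H B]].
by have := lo_hi Rg B A; lra.
Qed.
Lemma ltR_le f g : reg f -> reg g -> ltR f g -> leR f g.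
Proof.
move=> Rf Rg /ltRP -[//|//|q [A B]]; apply/nltR => /ltRP -[//|//|q' [A' B']].
by have := lo_hi Rf B' A; have := lo_hi Rg B A'; lra.
Qed.
Lemma leR_trans f g h : reg f -> reg g -> reg h -> leR f g -> leR g h -> leR f h.
Proof.
by move=> Rf Rg Rh L L'; apply: leR_of_lo => // q H; apply: (leR_lo Rg Rh L'); exact: (leR_lo Rf Rg L).
Qed.
Lemma leR_refl f : leR f f.
Proof. by move=> k; have := e2_gt0 k; lra. Qed.
Lemma leR_cstl f q : reg f -> leR (fun _ => q) f <-> forall q', q' < q -> lo f q'.
Proof.
move=> Rf; split=> [L q' L'|H]; first by apply: (leR_lo (reg_cst q) Rf L); apply/lo_cst.
by apply: leR_of_lo => //; [exact: reg_cst|move=> q' /lo_cst /H].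
Qed.
Lemma leR_cstr f q : reg f -> leR f (fun _ => q) <-> forall q', lo f q' -> q' < q.
Proof.
move=> Rf; split=> [L q' L'|H]; first by apply/lo_cst; apply: (leR_lo Rf (reg_cst q) L).
by apply: leR_of_lo => //; [exact: reg_cst|move=> q' /H /lo_cst].
Qed.

Lemma reg_shift_add f g : reg f -> reg g -> reg (fun k => f (k +' d1) + g (k +' d1)).
Proof.
move=> Rf Rg k j L; have L' : io (k +' d1) <= io (j +' d1) by rewrite !ioD; lra.
by have := Rf _ _ L'; have := Rg _ _ L'; rewrite e2_S; lra.
Qed.
Lemma reg_shift_sub f g : reg f -> reg g -> reg (fun k => f (k +' d1) - g (k +' d1)).
Proof.
move=> Rf Rg k j L; have L' : io (k +' d1) <= io (j +' d1) by rewrite !ioD; lra.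
by have := Rf _ _ L'; have := Rg _ _ L'; rewrite e2_S; lra.
Qed.

(** The distance is at most q. Comparison costs 2 * e2 j and undoing the index shift in sums and
    differences costs e2 j; the tolerance 4 * e2 j covers both. *)
Definition clo f g q : Prop := forall j,
  f j <= g j + q + 4 * e2 j /\ g j <= f j + q + 4 * e2 j.
Definition nearR f g h : Prop :=
  ltR (fun k => g (k +' d1) - h (k +' d1)) f /\ ltR f (fun k => g (k +' d1) + h (k +' d1)).

Lemma near_clo f g q : reg f -> reg g -> nearR f g (fun _ => q) -> clo f g q.
Proof.
move=> Rf Rg [A B] j.
have := ltR_le (reg_shift_sub Rg (reg_cst q)) Rf A j; have := ltR_le Rf (reg_shift_add Rg (reg_cst q)) B j.
by have := Rg j (j +' d1) ltac:(by rewrite ioD io1; lra); have := e2_gt0 j; lra.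
Qed.

Lemma clo_near f g h q q' : reg f -> reg g -> reg h -> clo f g q -> q < q' -> lo h q' -> nearR f g h.
Proof.
move=> Rf Rg Rh C L H; have [n Hn] := @e2_small ((q' - q) / 8) ltac:(by lra).
have {}Hn := Hn n (lexx _); have E := e2_gt0 n.
have := lo_lt Rh H (n +' d1); rewrite e2_S.
have := Rg n (n +' d1) ltac:(by rewrite ioD io1; lra); have := C n.
by split; exists n; lra.
Qed.

Definition limR (x : D -> D -> K) f : Prop :=
  forall n, exists k, forall m, io k <= io m -> clo (x m) f (e2 n).
Definition cauchyR (x : D -> D -> K) : Prop :=
  forall n, exists k, forall m m', io k <= io m -> io k <= io m' -> clo (x m) (x m') (e2 n).

Lemma Mnear_E u v w f g h : den u f -> den v g -> den w h -> Mnear u v w <-> nearR f g h.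
Proof.
move=> Hu Hv Hw; rewrite /Mnear (Mlt_E (den_sub Hv Hw) Hu) (Mlt_E Hu (den_add Hv Hw)); exact: iff_refl.
Qed.

Lemma pos_lo f : reg f -> ltR (fun _ => 0) f -> exists n, lo f (e2 n).
Proof.
move=> Rf /ltRP -[//|//|q [/hi_cst q0 B]]; first exact: reg_cst.
by have [n Hn] := e2_arch q0; exists n; apply: lo_le B; exact: ltW.
Qed.

Lemma mk_const q : exists X : set, Mis_real X /\ vg X = fun _ => q.
Proof. by apply: mk_real; [exact: K_const | exact: reg_cst]. Qed.

Lemma Mpos_E (X : set) : Mis_real X -> Mlt M0 (Mset X) <-> ltR (fun _ => 0) (vg X).
Proof. by move=> [H _]; exact: (Mlt_E (den_0) (den_set H)). Qed.

Lemma e2_pos n : ltR (fun _ : D => 0) (fun _ => e2 n).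
Proof.
apply/ltRP; [exact: reg_cst|exact: reg_cst|]; exists (e2 n / 2); have := e2_gt0 n => ?.
by split; [apply/hi_cst|apply/lo_cst]; lra.
Qed.

(** Real tolerances may be replaced by powers of 1/2, since every positive real exceeds one of
    them. *)
Lemma Mlimit_E (X x : set) : Mis_realseq X -> Mis_real x ->
  Mlimit X x <-> limR (fun n k => vg X (pair n k)) (vg x).
Proof.
move=> HX Hx; have Rx := real_reg Hx; have RX := realseq_reg HX; split=> H.
  move=> n; have [E [HE Ev]] := mk_const (e2 n).
  have [k Hk] := H E HE ltac:(by apply/Mpos_E => //; rewrite Ev; exact: e2_pos).
  exists k => m km; apply: near_clo => //; rewrite -Ev.
  by apply/(Mnear_E (den_row m HX) (den_set (proj1 Hx)) (den_set (proj1 HE))); apply: Hk; apply/dleP.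
move=> E HE /(Mpos_E HE) /(pos_lo (real_reg HE)) [n Hn].
(* Halving the tolerance creates the strict gap that [clo_near] asks for. *)
have [k Hk] := H (n +' d1); exists k => m /dleP km.
apply/(Mnear_E (den_row m HX) (den_set (proj1 Hx)) (den_set (proj1 HE))).
apply: (clo_near _ _ _ (Hk m km) _ Hn) => //; first exact: real_reg.
by rewrite e2_S; have := e2_gt0 n; lra.
Qed.

Lemma Mcauchy_E (X : set) : Mis_realseq X ->
  Mcauchy X <-> cauchyR (fun n k => vg X (pair n k)).
Proof.
move=> HX; have RX := realseq_reg HX; split=> H.
  move=> n; have [E [HE Ev]] := mk_const (e2 n).
  have [k Hk] := H E HE ltac:(by apply/Mpos_E => //; rewrite Ev; exact: e2_pos).
  exists k => m m' km km'; apply: near_clo => //; rewrite -Ev.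
  by apply/(Mnear_E (den_row m HX) (den_row m' HX) (den_set (proj1 HE))); apply: Hk; apply/dleP.
move=> E HE /(Mpos_E HE) /(pos_lo (real_reg HE)) [n Hn].
have [k Hk] := H (n +' d1); exists k => m m' /dleP km /dleP km'.
apply/(Mnear_E (den_row m HX) (den_row m' HX) (den_set (proj1 HE))).
apply: (clo_near _ _ _ (Hk m m' km km') _ Hn) => //; first exact: real_reg.
by rewrite e2_S; have := e2_gt0 n; lra.
Qed.
End Order.
Arguments leR_cstl {f} q.
Arguments leR_cstr {f} q.

(** * Comprehension from suprema *)

Definition Sigma1_CA : Prop := forall P : D -> Prop, isS1 (fun r => P (r 0%N)) ->
  exists X, forall n, n \inn X <-> P n.

Definition is_lub (x f : D -> K) : Prop := [/\ isK1 f, reg f,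
  forall s, ~ hi f (x s) & forall q, lo f q -> exists s, q < x s].

(** The bounds place 0 strictly below and 1 strictly above all terms, so that the part of [0,1]
    below some term is neither empty nor everything. They are met by Specker's sequence with a
    leading digit 1. *)
Definition increasing (x : D -> K) : Prop := [/\ isK1 x,
  forall s t, io s <= io t -> x s <= x t & forall s, 1 / 2 <= x s /\ x s < 1].

Definition increasing_lub : Prop := forall x, increasing x -> exists f, is_lub x f.

Lemma increasing_lub_CA : increasing_lub -> Sigma1_CA.
Proof.
move=> LUB P [Q [HQ EQ]].
pose th n m := Q (scons m (scons n (fun _ => d0))).
have Hth : isP2 th.
  by apply: D1_D0; apply: (isD0_scons2 M (fun r _ => Q r) _ _ (fun _ _ => d0) HQ); constructor.
have EP n : P n <-> exists m, th n m by exact: (EQ (scons n (fun _ => d0))).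
pose seen s n := exists m, m <' s /\ th n m.
have Hseen : isP2 seen by rewrite /isP2 /seen; apply: (D1_bex (f := fun r => r 0%N)); rec.
have seen_mono s t n : io s <= io t -> seen s n -> seen t n.
  by move=> L [m [ms H]]; exists m; split=> //; dlra.
pose c s n : D := if `[< seen s n >] then d1 else d0.
have Hc : isR2 c by rewrite /isR2 /c; rec.
(* [G s j] has the binary digits 1, c s 0, .., c s (j - 1). After scaling, [w s j] is 1/2 plus the
   sum of c s i * 2^-(i + 2) over i < j. *)
have [G [HG G0 GS]] := @primrec (fun _ => d1) (fun s j y => (d1 +' d1) *' y +' c s j)
  ltac:(by rewrite /isR1; rec) ltac:(by rewrite /isR3; rec).
pose w s j := io (G s j) * e2 (j +' d1).
have Hw : isK2 w by rewrite /isK2 /w; rec.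
have w0 s : w s d0 = 1 / 2 by rewrite /w G0 e2_S e2_0 io1 mul1r.
have wS s j : w s (j +' d1) = w s j + io (c s j) * e2 (j +' d1 +' d1).
  by rewrite /w GS !ioE !e2_S; lra.
have c01 s j : 0 <= io (c s j) /\ io (c s j) <= 1.
  by rewrite /c; case: asboolP; rewrite ?io0 ?io1; lra.
have c_mono s t j : io s <= io t -> io (c s j) <= io (c t j).
  rewrite /c => L; case: asboolP => A; case: asboolP => B; rewrite ?io0 ?io1 //.
  by case: B; exact: seen_mono A.
have wstep s j : w s j <= w s (j +' d1).
  by rewrite wS lerDl mulr_ge0 //; [case: (c01 s j) | exact/ltW/e2_gt0].
have wlow s i j : w s i <= w s (i +' j).
  move: j; apply: S1_ind; first by apply: S1_of_D1; rec.
    by rewrite (_ : i +' d0 = i) //; dlra.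
  move=> j IH; rewrite (_ : i +' (j +' d1) = i +' j +' d1); last by dlra.
  exact: le_trans IH _.
have whigh s j : w s j <= 1 - e2 (j +' d1).
  move: j; apply: S1_ind; first by apply: S1_of_D1; rec.
    by rewrite w0 e2_S e2_0; lra.
  move=> j IH; rewrite wS; have [_ c1] := c01 s j; have E := e2_gt0 (j +' d1 +' d1).
  have := ler_wpM2r (ltW E) c1; rewrite mul1r.
  by move: E IH; rewrite (e2_S (j +' d1)); lra.
have wmono s t j : io s <= io t -> w s j <= w t j.
  move=> L; move: j; apply: S1_ind; first by apply: S1_of_D1; rec.
    by rewrite !w0.
  move=> j IH; rewrite !wS; apply: lerD => //; apply: ler_wpM2r; [exact/ltW/e2_gt0 | exact: c_mono].
(* When n is enumerated between stages s and t, its digit contributes 2^-(n + 2), and no other digit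
   decreases. *)
have jump s t n : io s <= io t -> ~ seen s n -> seen t n ->
    forall i, w s (n +' d1 +' i) + e2 (n +' d1 +' d1) <= w t (n +' d1 +' i).
  move=> L A B; apply: S1_ind; first by apply: S1_of_D1; rec.
    rewrite (_ : n +' d1 +' d0 = n +' d1); last by dlra.
    rewrite !wS /c; case: asboolP => // _; case: asboolP => // _; rewrite io0 io1.
    by have := wmono s t n L; lra.
  move=> i IH; rewrite (_ : n +' d1 +' (i +' d1) = n +' d1 +' i +' d1); last by dlra.
  rewrite !wS; have := ler_wpM2r (ltW (e2_gt0 (n +' d1 +' i +' d1 +' d1))) (c_mono s t (n +' d1 +' i) L).
  by lra.
pose x s := w s s.
have xmono s t : io s <= io t -> x s <= x t.
  move=> L; apply: (le_trans (wmono s t s L)); have [i Ei] := io_sub L.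
  by have -> : t = s +' i; [dlra | exact: wlow].
have Ix : increasing x.
  split; [by rewrite /isK1 /x; rec | exact: xmono | move=> s].
  rewrite -(w0 s); split; first by have := wlow s d0 s; rewrite (_ : d0 +' s = s) //; dlra.
  by have := whigh s s; have := e2_gt0 (s +' d1); rewrite /x; lra.
have [f [Hf Rf H1 H2]] := LUB x Ix.
(* The tolerance is the weight of digit n; the condition n < s ensures that [x s] includes this
   digit. *)
have near_lub n : exists s, n <' s /\ exists k, f k + e2 k < x s + e2 (n +' d1 +' d1).
  have [k Hk] := @e2_small _ (e2_gt0 (n +' d1 +' d1)); have {}Hk := Hk k (lexx _).
  have E := e2_gt0 k; have [s Hs] := H2 (f k - 2 * e2 k) ltac:(by exists k; lra).
  exists (s +' (n +' d1)); split; first by dlra.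
  by exists k; have := xmono s (s +' (n +' d1)) ltac:(by rewrite !ioE; io_pos; lra); lra.
(* If n appeared only after such a stage s, the jump would lift a later term above f. *)
have decide n s : n <' s -> (exists k, f k + e2 k < x s + e2 (n +' d1 +' d1)) -> P n <-> seen s n.
  move=> ns [k Hk]; split=> [/EP [m Hm]|[m [_ Hm]]]; last by apply/EP; exists m.
  apply: contrapT => A.
  pose t := s +' (m +' d1); have L : io s <= io t by rewrite /t !ioE; io_pos; lra.
  have B : seen t n by exists m; split=> //; rewrite /t; dlra.
  have [i Ei] := @io_sub (n +' d1) s ltac:(by move: ns => /io_S; rewrite ioD io1).
  have Es : s = n +' d1 +' i by dlra.
  have := jump s t n L A B i; rewrite -Es => J; apply: (H1 t); exists k.
  have [j Ej] := io_sub L; have := wlow t s j; rewrite (_ : s +' j = t); last by dlra.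
  by rewrite -/(x s) -/(x t) in J *; lra.
apply: D1_set; split.
  apply: (@S1_ext (fun r => exists m, th (r 0%N) m)); first by move=> r; rewrite EP.
  by apply: S1_ex; apply: S1_of_D1; rec.
(* Being outside P is witnessed by a stage close to the supremum at which n has not been seen; this
   is the Sigma^0_1 form of the complement. *)
apply: (@S1_ext (fun r => exists s k, r 0%N <' s /\ (f k + e2 k < x s + e2 (r 0%N +' d1 +' d1) /\ ~ seen s (r 0%N)))).
  move=> r; split=> [[s [k [A [B C]]]]|A].
    by rewrite (decide _ s) //; exists k.
  have [s [ns Hk]] := near_lub (r 0%N); case: (Hk) => k Hk'; exists s, k; split=> //; split=> //.
  by move=> B; apply: A; apply/(decide _ s).
apply: S1_ex; apply: S1_ex; apply: S1_of_D1.
have Hx : isK1 x by rewrite /isK1 /x; rec.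
by rec.
Qed.

(** The schema has a universal quantifier in front, so it is applied to the negated matrix and
    yields the complement. *)
Lemma ACA_Sigma1_CA : holds M (schema Arithmetical arithmetical_comprehension) -> Sigma1_CA.
Proof.
move=> H P [Q [HQ EQ]].
have [e [tau [p [p2 [[Dp _] E]]]]] := isD0_matrices _ (rset R) _ _ HQ HQ.
have Ap : Arithmetical p by elim: Dp.
have := H _ (ex_intro _ (Not p) (conj (conj Ap Logic.I) erefl)) e tau.
rewrite /arithmetical_comprehension /close /= => -[X HX].
have [Z HZ] := @D1_set (fun n => ~ n \inn X) ltac:(by rewrite /isP1; rec).
have EP n : P n <-> exists m, Q (scons m (scons n (fun _ => d0))) by exact: (EQ (scons n (fun _ => d0))).
have E' n k := iff_trans (sat_plug2 p n k e tau [X]) (proj1 (E n k)).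
exists Z => n; rewrite HZ EP; split=> [A|[m A] /(proj1 (HX n)) B]; last exact: (B m (proj2 (E' n m) A)).
apply: contrapT => B; apply: A; apply: (proj2 (HX n)) => k /(proj1 (E' n k)) A.
by apply: B; exists k.
Qed.

Lemma limR_lub x f : increasing x -> isK1 f -> reg f ->
  limR (fun n _ => x n) f -> is_lub x f.
Proof.
move=> [Hx mx bx] Hf Rf L; split=> //.
  move=> s [j Hj]; have [i Hi] := @e2_small (x s - (f j + e2 j)) ltac:(by lra).
  have {}Hi := Hi i (lexx _); have [k Hk] := L i; have [m [km sm]] := io_max k s.
  by have := Hk m km i; have := mx _ _ sm; have := reg2 Rf i j; have := e2_gt0 i; lra.
move=> q [j Hj]; have [i Hi] := @e2_small (f j - (q + e2 j)) ltac:(by lra).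
have {}Hi := Hi i (lexx _); have [k Hk] := L i; exists k.
by have := Hk k (lexx _) i; have := reg2 Rf j i; have := e2_gt0 i; lra.
Qed.

(** If the sequence kept increasing by more than 2^-n, then by Sigma^0_1 induction on j some term
    would reach j * 2^-n; for j = 2^n this contradicts the bound 1. *)
Lemma increasing_cauchy x : increasing x -> cauchyR (fun n _ => x n).
Proof.
move=> [Hx mx bx] n; apply: contrapT => C.
have A k : exists m, io k <= io m /\ x k + e2 n < x m.
  apply: contrapT => B; apply: C; exists k => m m' km km'.
  have B' i : io k <= io i -> x i <= x k + e2 n.
    by move=> ki; rewrite leNgt; apply/negP => L; apply: B; exists i.
  have := B' _ km; have := B' _ km'; have := mx _ _ km; have := mx _ _ km' => ? ? ? ? j.
  by have := e2_gt0 j; lra.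
have : forall j, exists m, io j * e2 n <= x m.
  apply: S1_ind; first by apply: S1_ex; apply: S1_of_D1; rec.
    by exists d0; rewrite io0 mul0r; have := bx d0; lra.
  move=> j [m IH]; have [m' [_ L]] := A m; exists m'; rewrite ioD io1 mulrDl mul1r; lra.
move/(_ (exp2 n)) => [m]; rewrite /e2 mulfV ?gt_eqF ?exp2_gt0 // => L.
by have := bx m; lra.
Qed.

Lemma mk_constseq (x : D -> K) : isK1 x -> exists X, Mis_realseq X /\ forall n k, vg X (pair n k) = x n.
Proof.
by move=> Hx; apply: mk_realseq => [|n]; [rewrite /isK2; rec | exact: reg_cst].
Qed.

Lemma leR_cst (q q' : K) : leR (fun _ : D => q) (fun _ => q') <-> q <= q'.
Proof.
split=> [L|L k]; last by have := e2_gt0 k; lra.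
rewrite leNgt; apply/negP => L'.
have : q' < q' by apply/(lo_cst); apply: (leR_lo (reg_cst q) (reg_cst q') L); apply/lo_cst.
by rewrite ltxx.
Qed.

Lemma in01_cst (X : set) : Mis_real X -> Min01 (Mset X) <-> leR (fun _ => 0) (vg X) /\ leR (vg X) (fun _ => 1).
Proof.
move=> [HX _]; rewrite /Min01 (Mle_E (den_0) (den_set HX)) (Mle_E (den_set HX) (den_1)).
exact: iff_refl.
Qed.

Lemma constseq_bounded x X : increasing x -> Mis_realseq X ->
  (forall n k, vg X (pair n k) = x n) -> Mbounded X /\ forall n, Min01 (Mrow X n).
Proof.
move=> [_ _ bx] HX E.
have B n : leR (fun _ => 0) (fun k => vg X (pair n k)) /\ leR (fun k => vg X (pair n k)) (fun _ => 1).
  rewrite (_ : (fun k => vg X (pair n k)) = fun _ => x n); last exact: funext.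
  by have := bx n => ?; split; apply/leR_cst; lra.
split; last first.
  by move=> n; rewrite /Min01 (Mle_E (den_0) (den_row n HX)) (Mle_E (den_row n HX) (den_1)); exact: B.
have [a [Ha Ea]] := mk_const (0 : K); have [b [Hb Eb]] := mk_const (1 : K).
exists a; split=> //; exists b; split=> // n.
rewrite (Mle_set_row n Ha HX) (Mle_row_set n HX Hb).
by rewrite Ea Eb; exact: B.
Qed.

Lemma monotone_convergence_lub : Mmonotone_convergence -> increasing_lub.
Proof.
move=> H x Ix; have [Hx mx _] := Ix; have [X [HX E]] := mk_constseq Hx.
have [b b'] := constseq_bounded Ix HX E.
have [|z [Hz L]] := H X HX b _ b'.
  left=> m n mn; apply/(Mle_E (den_row m HX) (den_row n HX)).
  rewrite (_ : (fun k => vg X (pair m k)) = fun _ => x m); last exact: funext.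
  rewrite (_ : (fun k => vg X (pair n k)) = fun _ => x n); last exact: funext.
  by apply/leR_cst; apply: mx; apply: ltW; apply/io_lt.
exists (vg z); apply: limR_lub => //; [exact: (K1_vg (proj1 Hz)) | exact: real_reg|].
move/(Mlimit_E HX Hz): L; congr (limR _ _).
by apply: funext => n; apply: funext.
Qed.

Lemma cauchy_convergence_lub : Mcauchy_convergence -> increasing_lub.
Proof.
move=> H x Ix; have [Hx mx _] := Ix; have [X [HX E]] := mk_constseq Hx.
have EX : (fun n k => vg X (pair n k)) = (fun n _ => x n) by apply: funext => n; apply: funext.
have [|z [Hz L]] := H X HX.
  by apply/(Mcauchy_E HX); rewrite EX; exact: increasing_cauchy.
exists (vg z); apply: limR_lub => //; [exact: (K1_vg (proj1 Hz)) | exact: real_reg|].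
by move/(Mlimit_E HX Hz): L; rewrite EX.
Qed.

(** Comparison with rational upper bounds is enough by density, and any upper bound is at least 1/2,
    which keeps the test points used later nonnegative. *)
Lemma mk_lub x f : increasing x -> isK1 f -> reg f -> (forall s, leR (fun _ => x s) f) ->
  (forall q, 1 / 2 <= q -> (forall s, x s <= q) -> leR f (fun _ => q)) -> is_lub x f.
Proof.
move=> [Hx mx bx] Hf Rf A B; split=> // [s /hi_open [q [L Hq]]|q Lq].
  by have := lo_hi Rf (proj1 (@leR_cstl f (x s) Rf) (A s) q L) Hq; rewrite ltxx.
apply: contrapT => N.
have N' s : x s <= q by rewrite leNgt; apply/negP => L; apply: N; exists s.
have := B q ltac:(by have := bx d0; have := N' d0; lra) N'.
by move=> /(proj1 (@leR_cstr f q Rf)) /(_ q Lq); rewrite ltxx.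
Qed.

Lemma sequence_sup_lub : Msequence_sup -> increasing_lub.
Proof.
move=> H x Ix; have [Hx mx _] := Ix; have [X [HX E]] := mk_constseq Hx.
have EX n : (fun k => vg X (pair n k)) = (fun _ => x n) by apply: funext.
have [b b'] := constseq_bounded Ix HX E.
have [z [Hz [S1 S2]]] := H X HX b; have Dz := den_set (proj1 Hz); have Rz := real_reg Hz.
exists (vg z); apply: mk_lub => //; first exact: (K1_vg (proj1 Hz)).
  move=> s; have [y [Hy Ey]] := mk_const (x s); have Dy := den_set (proj1 Hy).
  rewrite -Ey; apply/(Mle_E Dy Dz); apply: S1 => //.
  by exists s; rewrite /Meq (Mle_E Dy (den_row s HX)) (Mle_E (den_row s HX) Dy) Ey EX; split; exact: leR_refl.
move=> q _ B; have [y [Hy Ey]] := mk_const q; have Dy := den_set (proj1 Hy).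
rewrite -Ey; apply/(Mle_E Dz Dy); apply: S2 => // v Hv [n [/(Mle_set_row n Hv HX) L _]].
apply/(Mle_E (den_set (proj1 Hv)) Dy); rewrite Ey; rewrite EX in L.
apply: (leR_trans _ _ _ L); [exact: real_reg | exact: reg_cst | exact: reg_cst |].
by apply/leR_cst.
Qed.

Definition inO (Q Q' : set) (f : D -> K) : Prop := exists n, lo f (vg Q n) /\ hi f (vg Q' n).

Lemma lo_ltR (f : D -> K) q : reg f -> ltR (fun _ => q) f <-> lo f q.
Proof.
move=> Rf; split=> [/ltRP -[|//|q' [/hi_cst L H]]|/lo_open [q' [L H]]]; first exact: reg_cst.
  by apply: lo_le H; exact: ltW.
by apply/ltRP; [exact: reg_cst|by []|exists q'; split=> //; apply/hi_cst].
Qed.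
Lemma hi_ltR (f : D -> K) q : reg f -> ltR f (fun _ => q) <-> hi f q.
Proof.
move=> Rf; split=> [/ltRP -[//||q' [H /lo_cst L]]|/hi_open [q' [L H]]]; first exact: reg_cst.
  by apply: hi_le H; exact: ltW.
by apply/ltRP; [by []|exact: reg_cst|exists q'; split=> //; apply/lo_cst].
Qed.

Lemma Min_open_E (Q Q' X : set) : Mis_ratseq Q -> Mis_ratseq Q' -> Mis_real X ->
  Min_open Q Q' (Mset X) <-> inO Q Q' (vg X).
Proof.
move=> /den_set [a [Ea Ha]] /den_set [b [Eb Hb]] HX; have RX := real_reg HX.
have DX := den_set (proj1 HX).
apply: exists_iff => n; rewrite Ea Eb; have [a0 <-] := Ha n; have [b0 <-] := Hb n.
by rewrite (Mlt_E (den_const a0) DX) (Mlt_E DX (den_const b0)) lo_ltR // hi_ltR.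
Qed.

Lemma Min_open01_E (Q Q' X : set) : Mis_ratseq Q -> Mis_ratseq Q' -> Mis_real X ->
  Min_open01 Q Q' (Mset X) <->
  (leR (fun _ => 0) (vg X) /\ leR (vg X) (fun _ => 1)) /\ inO Q Q' (vg X).
Proof. by move=> HQ HQ' HX; rewrite /Min_open01 in01_cst // Min_open_E. Qed.

Lemma inO_open (Q Q' : set) f : reg f -> inO Q Q' f -> exists n, forall g, reg g -> clo g f (e2 n) -> inO Q Q' g.
Proof.
move=> Rf [m [[j Hj] [k Hk]]].
have [n1 H1] := @e2_small (f j - (vg Q m + e2 j)) ltac:(by lra).
have [n2 H2] := @e2_small (vg Q' m - (f k + e2 k)) ltac:(by lra).
exists (n1 +' n2) => g Rg C; exists m.
have {}H1 := H1 (n1 +' n2) ltac:(by rewrite ioD; io_pos; lra).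
have {}H2 := H2 (n1 +' n2) ltac:(by rewrite ioD; io_pos; lra).
move: (n1 +' n2) => n in C H1 H2 *.
have := C n; have := reg2 Rf j n; have := reg2 Rf n k; have := e2_gt0 n => ? ? ? ?.
by split; exists n; lra.
Qed.

Lemma MOpen_inO (Q Q' : set) (P : set -> Prop) :
  (forall X, Mis_real X -> P X <-> inO Q Q' (vg X)) -> MOpen P.
Proof.
move=> EP x Hx /(EP x Hx) /(inO_open (real_reg Hx)) [n Hn].
have [E [HE Ev]] := mk_const (e2 n); exists E; split=> //; split.
  by apply/Mpos_E => //; rewrite Ev; exact: e2_pos.
move=> y Hy N; apply/(EP y Hy); apply: Hn; first exact: real_reg.
apply: near_clo; [exact: real_reg|exact: real_reg|].
by rewrite -Ev; apply/(Mnear_E (den_set (proj1 Hy)) (den_set (proj1 Hx)) (den_set (proj1 HE))).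
Qed.

(** Membership of a real [s] in an open set is [exists w, T w s] with [T] bounded:
    the entries of [s] that place it in an interval are below [w]. *)
Lemma open_D0 (Q Q' : set) : Mis_ratseq Q -> Mis_ratseq Q' ->
  exists T : env -> set -> Prop, isD0 M T /\
  forall r X, Mis_real X -> (exists w, T (scons w r) X) <-> inO Q Q' (vg X).
Proof.
move=> HQ HQ'; have [p [q [Hp Hq E]]] := unpair.
pose vc c := (io (p (p c)) - io (q (p c))) / (io (q c) + 1).
have Hvc : isK1 vc.
  exists (fun r => p (p (r 0%N))), (fun r => q (p (r 0%N))), (fun r => q (r 0%N) +' d1); split; rec.
  by move=> r; rewrite ioD io1; have := io_ge0 (q (r 0%N)); split=> //; lra.
have KQ := K1_vg HQ; have KQ' := K1_vg HQ'.
(* The comparisons with the endpoints are Delta^0_1 but not bounded formulas. Stored in the sets Z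
   and Z', they enter T as membership statements; [vc c] is the value of the rational with code
   c. *)
have [Z HZ] := @D1_set (fun z => vg Q (p z) + e2 (p (q z)) < vc (q (q z))) ltac:(by rewrite /isP1; rec).
have [Z' HZ'] := @D1_set (fun z => vc (q (q z)) + e2 (p (q z)) < vg Q' (p z)) ltac:(by rewrite /isP1; rec).
exists (fun r s => exists n, n <' r 0%N /\ exists k, k <' r 0%N /\ exists c, c <' r 0%N /\
  exists j, j <' r 0%N /\ exists d, d <' r 0%N /\
  (((k +' c) *' (k +' c) +' k \inn s) /\ (((j +' d) *' (j +' d) +' j \inn s) /\
  (pair n (pair k c) \inn Z /\ pair n (pair j d) \inn Z')))); split.
  rewrite /pair; repeat first [apply: isD0_and | apply: isD0_bex; first exact: isTm_var].
  - by apply: isD0_memvar; do !constructor.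
  - by apply: isD0_memvar; do !constructor.
  - by apply: isD0_mem; do !constructor.
  - by apply: isD0_mem; do !constructor.
move=> r X HX; have EX := ratseq_entry (proj1 HX).
have V k c : pair k c \inn X -> vg X k = vc c.
  move=> H; have [[a [b [d F]]] U] := EX k.
  rewrite (U _ _ (conj H F)) /vc; have := F => /rtP - /(_ (EX k)); rewrite /vg => ->.
  have [-> ->] := E (pair a b) d; have [-> ->] := E a b.
  by rewrite /val /= ioD io1.
have W n k c : [/\ p (pair n (pair k c)) = n, p (q (pair n (pair k c))) = k & q (q (pair n (pair k c))) = c].
  by have [-> ->] := E n (pair k c); have [-> ->] := E k c.
split.
  move=> [w [n [_ [k [_ [c [_ [j [_ [d [_ [A [B [/HZ C /HZ' F]]]]]]]]]]]]]].
  exists n; move: C F; have [-> -> ->] := W n k c; have [-> -> ->] := W n j d.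
  by rewrite -(V _ _ A) -(V _ _ B); split; [exists k|exists j].
move=> [n [[k Hk] [j Hj]]].
have [[a [b [c A]]] _] := EX k; have [[a' [b' [c' B]]] _] := EX j.
exists (n +' k +' pair (pair a b) c +' j +' pair (pair a' b') c' +' d1) => /=.
have L1 := io_ge0 (pair (pair a b) c); have L2 := io_ge0 (pair (pair a' b') c').
move: (pair (pair a b) c) (pair (pair a' b') c') A B L1 L2 => x y A B L1 L2.
exists n; split; first by dlra.
exists k; split; first by dlra.
exists x; split; first by dlra.
exists j; split; first by dlra.
exists y; split; first by dlra.
split=> //; split=> //; split.
  by apply/HZ; have [-> -> ->] := W n k x; rewrite -(V _ _ A).
by apply/HZ'; have [-> -> ->] := W n j y; rewrite -(V _ _ B).
Qed.

Lemma open_Sigma1 (Q Q' : set) : Mis_ratseq Q -> Mis_ratseq Q' ->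
  exists Psi rho sigma, Sigma1 Psi /\
  forall X, Mis_real X -> msat Psi rho sigma X <-> inO Q Q' (vg X).
Proof.
move=> HQ HQ'; have [T [HT ET]] := open_D0 HQ HQ'.
have [N [rho [sigma HN]]] := rep_raise _ _ (isD0_representable _ (rset R) _ HT).
(* The extra argument guarantees that index 0, which is to be quantified, is not a parameter. *)
have [p [Dp Ep]] := HN (N + 1)%coq_nat ltac:(lia).
exists (ExNum p), (fun i => envcat M (N + 1)%coq_nat (fun _ => d0) rho (S i)), sigma; split.
  by exists p.
move=> X HX; rewrite /msat /= -(ET (fun _ => d0) X HX); apply: exists_iff => w; rewrite -Ep.
rewrite (_ : scons w _ = envcat M (N + 1)%coq_nat (scons w (fun=> d0)) rho) //.
apply: funext => i; rewrite /envcat; case: i => [|i] /=; first by case: Nat.ltb_spec => //; lia.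
by [].
Qed.

(** * Specker sequences against open and closed sets *)

Section Reversals.
Variable x : D -> K.
Hypothesis Ix : increasing x.

(** The intervals are (-1, x n): the left endpoint -1 makes their traces on [0,1] initial segments
    that contain 0. *)
Lemma below_codes : exists Q Q' : set, [/\ Mis_ratseq Q, Mis_ratseq Q' &
  forall f, reg f -> leR (fun _ => 0) f -> inO Q Q' f <-> exists n, hi f (x n)].
Proof.
have [Hx _ _] := Ix.
have [Q [HQ EQ]] := @mk_ratseq (fun _ => -1) (K_const _).
have [Q' [HQ' EQ']] := mk_ratseq Hx.
exists Q, Q'; split=> // f Rf f0; apply: exists_iff => n; rewrite EQ EQ'.
by split=> [[]//|H]; split=> //; apply: (proj1 (@leR_cstl f 0 Rf) f0); lra.
Qed.

(** An upper bound of [x] all of whose lower rationals are in the open set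
    [{y | exists n, y < x n}] is the least one. *)
Lemma no_lub_progress (f : D -> K) : isK1 f -> reg f -> leR (fun _ => 0) f -> leR f (fun _ => 1) ->
  ~ (exists n, hi f (x n)) ->
  (forall q, 0 <= q -> q <= 1 -> lo f q -> exists n, q < x n) -> is_lub x f.
Proof.
move=> Hf Rf f0 f1 N A; have [_ _ bx] := Ix.
split=> // [s H|q Lq]; first by apply: N; exists s.
have [q0|q0] := lerP 0 q.
  by apply: A => //; apply: ltW; apply: (proj1 (@leR_cstr f 1 Rf) f1).
by exists d0; have := bx d0; lra.
Qed.

Lemma not_top : ~ (exists n, hi (fun _ => 1) (x n)).
Proof. by move=> [n /hi_cst]; have [_ _ bx] := Ix; have := bx n; lra. Qed.

Lemma in01_real (X : set) : Mis_real X -> Min01 (Mset X) ->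
  [/\ isK1 (vg X), reg (vg X), leR (fun _ => 0) (vg X) & leR (vg X) (fun _ => 1)].
Proof.
by move=> HX /(in01_cst HX) [A B]; split=> //; [exact: (K1_vg (proj1 HX))|exact: real_reg].
Qed.

(** A real outside P all of whose predecessors lie in P is an upper bound of x with every smaller
    rational below some term, hence a least upper bound. *)
Lemma prog_below (P : set -> Prop) : (~ exists f, is_lub x f) ->
  (forall X, Mis_real X -> Min01 (Mset X) -> P X <-> exists n, hi (vg X) (x n)) -> MProg P.
Proof.
move=> N EP X HX X01 A; apply/(EP X HX X01); apply: contrapT => B.
have [KX RX X0 X1] := in01_real HX X01.
apply: N; exists (vg X); apply: no_lub_progress => // q q0 q1 Lq.
have [Y [HY EY]] := mk_const q.
have Y01 : Min01 (Mset Y) by apply/(in01_cst HY); rewrite EY; split; apply/leR_cst.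
have /(EP Y HY Y01) [n] : P Y.
  by apply: A => //; apply/(Mlt_set HY HX); rewrite EY lo_ltR.
by rewrite EY => /hi_cst L; exists n.
Qed.

Lemma full_below (P : set -> Prop) :
  (forall X, Mis_real X -> Min01 (Mset X) -> P X <-> exists n, hi (vg X) (x n)) ->
  ~ (forall X, Mis_real X -> Min01 (Mset X) -> P X).
Proof.
move=> EP A; have [Y [HY EY]] := mk_const (1 : K).
have Y01 : Min01 (Mset Y) by apply/(in01_cst HY); rewrite EY; split; apply/leR_cst.
by have /(EP Y HY Y01) := A Y HY Y01; rewrite EY; exact: not_top.
Qed.

Lemma OI4_lub_of : MOI4 -> exists f, is_lub x f.
Proof.
move=> H; apply: contrapT => N; have [Q [Q' [HQ HQ' EO]]] := below_codes.
have EP X : Mis_real X -> Min01 (Mset X) -> Min_open01 Q Q' (Mset X) <-> exists n, hi (vg X) (x n).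
  move=> HX X01; have [KX RX X0 X1] := in01_real HX X01.
  by rewrite Min_open01_E // EO //; split=> [[]|].
apply: (full_below (P := fun X => Min_open01 Q Q' (Mset X)) EP); apply: H => //.
exact: (prog_below (P := fun X => Min_open01 Q Q' (Mset X)) N EP).
Qed.

Lemma Sigma1_below : exists Psi rho sigma, [/\ Sigma1 Psi, MOpen (msat Psi rho sigma) &
  forall X, Mis_real X -> Min01 (Mset X) -> msat Psi rho sigma X <-> exists n, hi (vg X) (x n)].
Proof.
have [Q [Q' [HQ HQ' EO]]] := below_codes.
have [Psi [rho [sigma [HP EP]]]] := open_Sigma1 HQ HQ'.
exists Psi, rho, sigma; split=> //; first exact: MOpen_inO EP.
move=> X HX X01; have [KX RX X0 X1] := in01_real HX X01.
by rewrite EP // EO.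
Qed.

Lemma OI1_lub_of : holds M (schema Sigma1 OI1) -> exists f, is_lub x f.
Proof.
move=> H; apply: contrapT => N; have [Psi [rho [sigma [HP OP EP]]]] := Sigma1_below.
apply: (full_below EP); have /sem_OI1 := H _ (ex_intro _ Psi (conj HP erefl)) rho sigma; apply.
by split=> //; exact: prog_below EP.
Qed.

(** The statement of induction with sequences fixes one code of 0, whereas [mk_const] leaves the
    code open. *)
Lemma zero_real : exists z : set, [/\ Mis_real z, vg z = (fun _ => 0) &
  forall k, pair k (pair (pair d0 d0) d0) \inn z].
Proof.
have [X HX] := @D1_set (fun z => exists k, k <' z +' d1 /\ z = pair k (pair (pair d0 d0) d0))
  ltac:(by rewrite /isP1; apply: (D1_bex (f := fun r => r 0%N +' d1)); rec).
have HX' k : pair k (pair (pair d0 d0) d0) \inn X.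
  by apply/HX; exists k; split=> //; apply: le_ltS; exact: le_pair1.
have HQ : Mis_ratseq X.
  split; first by move=> z /HX [k [_ ->]]; exists k, d0, d0, d0.
  split; first by move=> k; exists d0, d0, d0.
  by move=> k q q' [/HX [j [_ /pair_inj [_ ->]]] /HX [i [_ /pair_inj [_ ->]]]].
have V : vg X = fun _ => 0.
  apply: funext => k; have := HX' k => /rtP - /(_ (ratseq_entry HQ k)); rewrite /vg => ->.
  by rewrite /val /= io0 subrr mul0r.
exists X; split=> //; split=> //; apply/(Mmodulus_E (den_set HQ)); rewrite V; exact: reg_cst.
Qed.

Lemma OI3_lub_of : holds M (schema Sigma1 OI3) -> exists f, is_lub x f.
Proof.
move=> H; apply: contrapT => N; have [Psi [rho [sigma [HP OP EP]]]] := Sigma1_below.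
have [Hx mx bx] := Ix.
apply: (full_below EP); have /sem_OI3 := H _ (ex_intro _ Psi (conj HP erefl)) rho sigma; apply.
split=> //; split.
  have [z [Hz Ez A]] := zero_real; exists z; split=> //; split=> //.
  have z01 : Min01 (Mset z) by apply/(in01_cst Hz); rewrite Ez; split; apply/leR_cst.
  by apply/(EP z Hz z01); exists d0; rewrite Ez; apply/hi_cst; have := bx d0; lra.
(* If the limit X were outside, it would be the least upper bound: a rational below X is passed by a
   term of the sequence, and that term lies below some x n. *)
move=> X HX X01 Y HY B L C; apply/(EP X HX X01); apply: contrapT => A.
have [KX RX X0 X1] := in01_real HX X01.
apply: N; exists (vg X); apply: no_lub_progress => // q q0 q1 [j Lq].
have [i Hi] := @e2_small (vg X j - (q + e2 j)) ltac:(by lra); have {}Hi := Hi i (lexx _).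
have /(Mlimit_E HY HX) /(_ i) [k /(_ k (lexx _) i) Hk] := L.
have [y [[Hy Ry] Py]] := C k.
have Ey : vg y = fun l => vg Y (pair k l).
  apply: funext => l; have [[a [b [c F]]] U] := realseq_entry HY k l.
  rewrite /vg; have := F => /rtP - /(_ (realseq_entry HY k l)) ->.
  have /rtP - /(_ (ratseq_entry (proj1 Hy) l)) -> // : pair l (pair (pair a b) c) \inn y by apply/Ry.
have y01 : Min01 (Mset y).
  have [B1 B2] := B k; apply/(in01_cst Hy); rewrite Ey; split.
    exact/(Mle_E (den_0) (den_row k HY)).
  have /(Mle_E (den_row k HY) (den_set (proj1 HX))) B3 := B2.
  by apply: leR_trans B3 X1; [exact: realseq_reg| |exact: reg_cst].
have /(EP y Hy y01) [n /(hi_lt (real_reg Hy)) /(_ i)] := Py.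
rewrite Ey => F; exists n.
by have := reg2 RX j i; have := e2_gt0 i; lra.
Qed.

Lemma open_sup_lub_of : Mopen_sup -> exists f, is_lub x f.
Proof.
move=> H; have [Q [Q' [HQ HQ' EO]]] := below_codes; have [Hx mx bx] := Ix.
have cst01 q (Y : set) : Mis_real Y -> vg Y = (fun _ => q) -> 0 <= q -> q <= 1 ->
   (exists n, q < x n) -> Min_open01 Q Q' (Mset Y).
  move=> HY EY q0 q1 [n L]; apply/(Min_open01_E HQ HQ' HY).
  have A : leR (fun _ => 0) (vg Y) by rewrite EY; apply/leR_cst.
  split; first by split=> //; rewrite EY; apply/leR_cst.
  by apply/EO => //; [exact: real_reg | exists n; rewrite EY; apply/hi_cst].
have [|s [Hs [S1 S2]]] := H Q Q' HQ HQ'.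
  have [Y [HY EY]] := mk_const (0 : K); exists Y; split=> //; apply: (cst01 0) => //.
  by exists d0; have := bx d0; lra.
have Rs := real_reg Hs; have Ds := den_set (proj1 Hs).
exists (vg s); apply: mk_lub => //; first exact: (K1_vg (proj1 Hs)).
  move=> n; apply/(leR_cstl _ Rs) => q L.
  have [q' [Lq [q0 Lx]]] : exists q', q < q' /\ 0 <= q' /\ q' < x n.
    have [A|A] := lerP 0 q; first by exists ((q + x n) / 2); lra.
    by exists 0; have := bx n; lra.
  have [Y [HY EY]] := mk_const q'.
  have /(Mle_E (den_set (proj1 HY)) Ds) : Mle (Mset Y) (Mset s).
    apply: S1 => //; apply: (cst01 q') => //; last by exists n.
    by have := bx n; lra.
  by rewrite EY => /(leR_cstl _ Rs); apply.
move=> q qh B; have [Y [HY EY]] := mk_const q.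
rewrite -EY; apply/(Mle_E Ds (den_set (proj1 HY))); apply: S2 => // z Hz.
move=> /(Min_open01_E HQ HQ' Hz) [[z0 z1] /(EO _ (real_reg Hz) z0) [n Hn]].
apply/(Mle_set Hz HY); rewrite EY.
apply/(leR_cstr _ (real_reg Hz)) => q' L; have := lo_hi (real_reg Hz) L Hn; have := B n; lra.
Qed.

(** The closed set consists of the upper bounds of x in [0,1], so its infimum is the supremum of
    x. *)
Lemma closed_inf_lub_of : Mclosed_inf -> exists f, is_lub x f.
Proof.
move=> H; have [Q [Q' [HQ HQ' EO]]] := below_codes; have [Hx mx bx] := Ix.
have cst01 q (Y : set) : Mis_real Y -> vg Y = (fun _ => q) -> 0 <= q -> q <= 1 ->
   (forall n, x n <= q) -> Min_closed01 Q Q' (Mset Y).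
  move=> HY EY q0 q1 L; have A : leR (fun _ => 0) (vg Y) by rewrite EY; apply/leR_cst.
  split; first by apply/(in01_cst HY); rewrite EY; split; apply/leR_cst.
  move=> /(Min_open_E HQ HQ' HY) /(EO _ (real_reg HY) A) [n]; rewrite EY => /hi_cst.
  by have := L n; lra.
have [Y1 [HY1 EY1]] := mk_const (1 : K).
have C1 : Min_closed01 Q Q' (Mset Y1) by apply: (cst01 1) => // n; have := bx n; lra.
have [|s [Hs [S1 S2]]] := H Q Q' HQ HQ'; first by exists Y1.
have Rs := real_reg Hs; have Ds := den_set (proj1 Hs).
exists (vg s); apply: mk_lub => //; first exact: (K1_vg (proj1 Hs)).
  move=> n; have [Y [HY EY]] := mk_const (x n).
  rewrite -EY; apply/(Mle_E (den_set (proj1 HY)) Ds); apply: S2 => // z Hz [z01 nO].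
  have [Kz Rz z0 z1] := in01_real Hz z01.
  apply/(Mle_set HY Hz); rewrite EY.
  apply/nltR => /(@hi_ltR _ (x n) Rz) Hn; apply: nO; apply/(Min_open_E HQ HQ' Hz).
  by apply/EO => //; exists n.
move=> q qh B; have [q1|q1] := lerP q 1.
  have [Y [HY EY]] := mk_const q.
  rewrite -EY; apply/(Mle_E Ds (den_set (proj1 HY))); apply: S1 => //.
  by apply: (cst01 q) => //; lra.
have /(Mle_E Ds (den_set (proj1 HY1))) := S1 _ HY1 C1; rewrite EY1 => L.
apply: leR_trans L _; [by []|exact: reg_cst|exact: reg_cst|by apply/leR_cst; lra].
Qed.
End Reversals.

(** * Consequences of comprehension *)

Section Arithmetical.

Fixpoint tuple (N : nat) (r : env) : D :=
  match N with O => d0 | S N => pair (r 0%N) (tuple N (fun i => r (S i))) end.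

Lemma isTm_tuple N : isTm M (tuple N).
Proof.
elim: N => [|N IH] /=; first exact: isTm_const.
have H := isTm_shift _ _ IH; have V := isTm_var M 0.
by rewrite /pair; do !apply: isTm_add => //; apply: isTm_mul; apply: isTm_add.
Qed.

Lemma tuple_inj N : forall r r', tuple N r = tuple N r' -> forall i, (i < N)%coq_nat -> r i = r' i.
Proof.
elim: N => [|N IH] r r' /=; first by lia.
move=> /pair_inj [E /IH H] [|i] L //; apply: (H i); lia.
Qed.

Lemma tuple_ext N : forall r r', (forall i, (i < N)%coq_nat -> r i = r' i) -> tuple N r = tuple N r'.
Proof.
elim: N => [|N IH] r r' H //=; rewrite H; last by lia.
by congr pair; apply: IH => i L; apply: H; lia.
Qed.

Lemma S1_exN N : forall Q, isS1 Q -> isS1 (fun r => exists v, Q (envcat M N v r)).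
Proof.
elim: N => [|N IH] Q HQ.
  apply: S1_ext HQ => r.
  have E v : envcat M 0 v r = r by apply: funext => i; rewrite /envcat /= Nat.sub_0_r.
  by split=> [H|[v]]; [exists r|]; rewrite E.
apply: (@S1_ext (fun r => exists x, exists v, Q (envcat M N v (scons x r)))).
  move=> r; split=> [[x [v H]]|[v H]].
    exists (fun i => if Nat.eqb i N then x else v i).
    rewrite (_ : envcat _ _ _ _ = envcat M N v (scons x r)) //.
    apply: funext => i; rewrite /envcat.
    case: (Nat.ltb_spec i (S N)) => A; case: (Nat.ltb_spec i N) => B; case: (Nat.eqb_spec i N) => C //; try lia.
      by rewrite C Nat.sub_diag.
    by have -> : (i - N = S (i - S N))%coq_nat by lia.
  have E : envcat M (S N) v r = envcat M N v (scons (v N) r) := cons_list_S v N r.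
  by exists (v N), v; rewrite -E.
apply: S1_ex; apply: S1_ext (IH _ HQ) => r.
by rewrite (_ : scons _ _ = r) //; apply: funext => -[].
Qed.

Hypothesis CA : Sigma1_CA.

(** [Sigma1_CA] concerns predicates of one number. The finitely many relevant variables are coded by
    [tuple], and membership in the resulting set is Delta^0_1. *)
Lemma S1_D1 (P : env -> Prop) : isS1 P -> isD1 P.
Proof.
move=> HP; have [N HN] : exists N, forall r r', (forall i, (i < N)%coq_nat -> r i = r' i) -> P r <-> P r'.
  have [Q [HQ E]] := HP; have [N HN] := isD0_finite _ _ HQ; exists N => r r' H.
  rewrite !E; apply: exists_iff => m; apply: (HN _ _ (rset R)) => -[|i] L //=; apply: H; lia.
have [X HX] : exists X, forall n, n \inn X <-> exists v, n = tuple N v /\ P v.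
  apply: CA; apply: (@S1_ext (fun r => exists v, (fun r => tuple N r = r N /\ P r) (envcat M N v r))).
    move=> r; apply: exists_iff => v.
    have E i : (i < N)%coq_nat -> envcat M N v r i = v i.
      by move=> L; rewrite /envcat; case: Nat.ltb_spec => //; lia.
    rewrite (tuple_ext E) (HN _ _ E) {1}/envcat Nat.ltb_irrefl Nat.sub_diag.
    by split=> -[].
  apply: (@S1_exN N (fun r => tuple N r = r N /\ P r)); apply: S1_and => //; apply: S1_D0; apply: isD0_eq; [exact: isTm_tuple|exact: isTm_var].
apply: (@D1_ext (fun r => tuple N r \inn X)); last by apply: D1_mem; apply: R_T; exact: isTm_tuple.
move=> r; rewrite HX; split=> [[v [E Pv]]|Pr]; last by exists r.
by apply/(HN r v) => // i; exact: tuple_inj.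
Qed.

Lemma D1_ex P : isD1 (fun r => P (fun i => r (S i)) (r 0%N)) -> isD1 (fun r => exists x, P r x).
Proof. by move=> H; apply: S1_D1; apply: S1_ex; case: H. Qed.

Lemma D1_all P : isD1 (fun r => P (fun i => r (S i)) (r 0%N)) -> isD1 (fun r => forall x, P r x).
Proof.
move=> H; apply: (@D1_ext (fun r => ~ exists x, ~ P r x)).
  by move=> r; split=> [A x|A [x]]; [apply: contrapT => B; apply: A; exists x | apply].
by apply: D1_not; apply: (@D1_ex (fun r x => ~ P r x)); apply: D1_not.
Qed.

(** Every number quantifier is absorbed by one more use of comprehension, so all levels of the
    arithmetical hierarchy collapse to Delta^0_1 with set parameters. *)
Lemma sat_D1 p : Arithmetical p -> forall (F : nat -> env -> D) sigma, (forall i, isTm M (F i)) ->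
  isD1 (fun r => sat M (fun i => F i r) sigma p).
Proof.
elim: p => [s t|s t|t X||p IHp q IHq|p IHp q IHq|p IHp q IHq|p IHp|p IHp|p IHp|p IHp] //= A F sigma HF.
- by apply: D1_eq; apply: R_T; exact: isTm_eval.
- by apply: D1_lt; apply: R_T; exact: isTm_eval.
- by apply: D1_mem; apply: R_T; exact: isTm_eval.
- exact: D1_const.
- by apply: D1_imp; [apply: IHp|apply: IHq]; case: A.
- by apply: D1_and; [apply: IHp|apply: IHq]; case: A.
- by apply: D1_or; [apply: IHp|apply: IHq]; case: A.
- apply: (@D1_all (fun r x => sat M (scons x (fun i => F i r)) sigma p)).
  by have := IHp A _ sigma (isTm_up M F HF); apply: D1_ext => r; rewrite scons_eval.
- apply: (@D1_ex (fun r x => sat M (scons x (fun i => F i r)) sigma p)).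
  by have := IHp A _ sigma (isTm_up M F HF); apply: D1_ext => r; rewrite scons_eval.
Qed.

Lemma CA_ACA : holds M (schema Arithmetical arithmetical_comprehension).
Proof.
move=> _ [p [Ap ->]] rho sigma.
rewrite /arithmetical_comprehension /close /=.
have [X HX] : exists X, forall n, n \inn X <-> forall k, sat M (scons n (scons k rho)) sigma p.
  apply: D1_set; apply: (@D1_all (fun r k => sat M (scons (r 0%N) (scons k rho)) sigma p)).
  have := @sat_D1 p Ap (scons (fun r => r 1%N) (scons (fun r => r 0%N) (fun i _ => rho i))) sigma.
  have H i : isTm M (scons (fun r => r 1%N) (scons (fun r => r 0%N) (fun i _ => rho i)) i).
    by case: i => [|[|i]]; [exact: isTm_var|exact: isTm_var|exact: isTm_const].
  by move/(_ H); apply: D1_ext => r; rewrite !scons_eval.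
exists X => n; split=> [/HX H k|H]; first exact: (proj2 (sat_plug2 p n k rho sigma [X])).
by apply/HX => k; have := H k; rewrite (sat_plug2 p n k rho sigma [X]).
Qed.

Lemma D1_lo (f : env -> D -> K) (q : env -> K) : isK q ->
  isK (fun r => f (fun i => r (S i)) (r 0%N)) -> isD1 (fun r => lo (f r) (q r)).
Proof.
move=> [a [b [c [Ha Hb Hc E]]]] Hf; apply: D1_ex.
have Hq : isK (fun r => q (fun i => r (S i))).
  exists (fun r => a (fun i => r (S i))), (fun r => b (fun i => r (S i))), (fun r => c (fun i => r (S i))).
  by split; [exact: R_shift|exact: R_shift|exact: R_shift|move=> r; exact: E].
by rec.
Qed.

(** The k-th approximation is the last point of A on the grid c + i * 2^-k. It exists because c is
    in A while everything beyond c + b is outside, so at most b * 2^k steps are tried. Only the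
    values of A on the grids have to be definable. *)
Lemma cut_real (A : K -> Prop) c b : A c -> (forall q q', q <= q' -> A q' -> A q) ->
  (forall q, A q -> q <= c + io b) -> isP2 (fun i k => A (c + io i * e2 k)) ->
  exists f : D -> K, [/\ isK1 f, reg f, forall q, lo f q -> A q & forall q, hi f q -> ~ A q].
Proof.
move=> Ac Al Ab HA.
have [g [Hg Eg]] := @R_choice (fun r i => A (c + io i * e2 (r 0%N)) /\ ~ A (c + io (i +' d1) * e2 (r 0%N)))
  ltac:(by apply: D1_and; [apply: (D1_app2 HA); rec | apply: D1_not; apply: (@D1_app2 (fun i k => A (c + io i * e2 k)) (fun r => r 0%N +' d1)); [exact: HA|rec|rec]])
  ltac:(move=> r; set k := r 0%N;
    have [|i [Hi Li]] := @D1_least (fun i => ~ A (c + io (i +' d1) * e2 k)) (b *' exp2 k)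
      ltac:(by apply: D1_not; apply: (@D1_app2 (fun i k => A (c + io i * e2 k)) (fun r => r 0%N +' d1)); [exact: HA|rec|rec]);
    [ by move=> /Ab; rewrite ioD ioM io1 mulrDl mul1r -mulrA /e2 mulfV ?gt_eqF ?exp2_gt0 // mulr1;
         have := e2_gt0 k; rewrite /e2; lra
    | exists i; split=> //; have [->|[j Ej]] := io_0or i; [by rewrite io0 mul0r addr0|];
      by apply: contrapT; rewrite Ej; apply: Li; clear -Ej; dlra ]).
pose f k := c + io (g (fun _ => k)) * e2 k.
have Hf : isK1 f.
  by have := R1_diag Hg => H; rewrite /isK1 /f; apply: K_add; [rec|apply: K_mul; [apply: K_io; exact: H|rec]].
have A1 k : A (f k) by case: (Eg (fun _ => k)).
have A2 k : ~ A (f k + e2 k).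
  by have [_] := Eg (fun _ => k); rewrite ioD io1 mulrDl mul1r addrA.
have L k j : f j < f k + e2 k.
  by rewrite ltNge; apply/negP => H; apply: (A2 k); exact: Al H (A1 j).
exists f; split=> //.
- by move=> k j /e2_le; have := L k j; have := L j k; lra.
- by move=> q [k H]; apply: Al (A1 k); have := e2_gt0 k; lra.
- by move=> q [k H] /(Al (f k + e2 k)) H'; apply: (A2 k); apply: H'; exact: ltW.
Qed.

Definition eventually_above (x : D -> D -> K) (q : K) : Prop :=
  exists m, forall n, io m <= io n -> lo (x n) q.

(** The cut is that of the lower limit; the last hypothesis excludes oscillation, so that the upper
    limit agrees with it. *)
Lemma lim_exists (x : D -> D -> K) c b : isK2 x -> (forall n, reg (x n)) ->
  eventually_above x c -> (forall q, eventually_above x q -> q <= c + io b) ->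
  (forall q q', q < q' -> ~ eventually_above x q -> exists m, forall n, io m <= io n -> ~ lo (x n) q') ->
  exists f, [/\ isK1 f, reg f & limR x f].
Proof.
move=> Hx Rx Ac Ab An.
have [||f [Hf Rf F1 F2]] := @cut_real (eventually_above x) c b Ac _ Ab.
- by move=> q q' L [m H]; exists m => n mn; apply: lo_le L _; exact: H.
- apply: D1_ex; apply: D1_all; apply: D1_imp; first by rec.
  by apply: (@D1_lo (fun r => x (r 0%N))); rec.
- exists f; split=> // n.
  have [j Hj] := @e2_small _ (e2_gt0 n); have {}Hj := Hj j (lexx _); have E := e2_gt0 j.
  have [m1 H1] := F1 (f j - 2 * e2 j) ltac:(by exists j; lra).
  have [m2 H2] := An (f j + 2 * e2 j) (f j + 3 * e2 j) ltac:(by lra) (F2 (f j + 2 * e2 j) ltac:(by exists j; lra)).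
  have [k [k1 k2]] := io_max m1 m2; exists k => m km i.
  have := lo_lt (Rx m) (H1 m (le_trans k1 km)) i; have := nlo (H2 m (le_trans k2 km)) i.
  by have := reg2 Rf i j; have := reg2 Rf j i; have := e2_gt0 i; lra.
Qed.

Lemma CA_cauchy : Mcauchy_convergence.
Proof.
move=> X HX /(Mcauchy_E HX); set x := fun n k => _ => C.
have Hx : isK2 x := K2_vg HX; have Rx : forall n, reg (x n) := realseq_reg HX.
have [k0 C0] := C d0.
(* At j = 0 closeness within 1 reads 1 + 4 * 1 = 5; the base point x k0 0 - 10 and the width 20
   below leave a margin around this range. *)
have B m : io k0 <= io m -> x k0 d0 - 5 <= x m d0 /\ x m d0 <= x k0 d0 + 5.
  by move=> L; have := C0 _ _ L (lexx _) d0; rewrite e2_0; lra.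
have [N HN] := @io_arch 20.
have [|||f [Hf Rf L]] := @lim_exists x (x k0 d0 - 10) N Hx Rx.
- by exists k0 => n /B; rewrite /lo => ?; exists d0; rewrite e2_0; lra.
- move=> q [m H]; have [n [mn kn]] := io_max m k0.
  by have := lo_lt (Rx n) (H n mn) d0; have := B n kn; rewrite e2_0; lra.
- move=> q q' L NA; have [n Hn] := @e2_small (q' - q) ltac:(by lra); have {}Hn := Hn n (lexx _).
  have [k Hk] := C n; exists k => m km /(lo_lt (Rx m)) Lm.
  apply: NA; exists k => i ki; apply: contrapT => /nlo Li.
  by have := Li n; have := Lm n; have := Hk m i km ki n; lra.
have [z [Hz Ez]] := mk_real Hf Rf; exists z; split=> //.
by apply/(Mlimit_E HX Hz); rewrite Ez.
Qed.

Lemma CA_monotone : Mmonotone_convergence.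
Proof.
move=> X HX _ Mo B01; set x := fun n k => vg X (pair n k).
have Hx : isK2 x := K2_vg HX; have Rx : forall n, reg (x n) := realseq_reg HX.
have B n : leR (fun _ => 0) (x n) /\ leR (x n) (fun _ => 1).
  by have [A B] := B01 n; split; [exact/(Mle_E (den_0) (den_row n HX)) | exact/(Mle_E (den_row n HX) (den_1))].
have mono : (forall m n, io m <= io n -> leR (x m) (x n)) \/ (forall m n, io m <= io n -> leR (x n) (x m)).
  case: Mo => H; [left|right] => m n; rewrite le_eqVlt => /orP [/eqP /io_inj ->|/io_lt /H];
    by [exact: leR_refl | move/(Mle_E (den_row _ HX) (den_row _ HX))].
have [|||f [Hf Rf L]] := @lim_exists x (-1) (d1 +' d1 +' d1) Hx Rx.
- by exists d0 => n _; apply: (proj1 (leR_cstl 0 (Rx n)) (proj1 (B n))); lra.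
- move=> q [m /(_ m (lexx _)) H]; have := proj1 (leR_cstr 1 (Rx m)) (proj2 (B m)) q H.
  by rewrite !ioE; lra.
- move=> q q' L NA; have {}NA m : exists n, io m <= io n /\ ~ lo (x n) q.
    apply: contrapT => C; apply: NA; exists m => n mn; apply: contrapT => D'; apply: C; by exists n.
  (* An increasing sequence that is not eventually above q is never above it; a decreasing one stays
     below as soon as one term fails to be above. *)
  case: mono => mono.
    exists d0 => m _ H; have [n [mn]] := NA m; case.
    by apply: (leR_lo (Rx m) (Rx n) (mono _ _ mn)); apply: lo_le H; exact: ltW.
  have [n [_ Hn]] := NA d0; exists n => m nm H; apply: Hn.
  by apply: (leR_lo (Rx m) (Rx n) (mono _ _ nm)); apply: lo_le H; exact: ltW.
have [z [Hz Ez]] := mk_real Hf Rf; exists z; split=> //.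
by apply/(Mlimit_E HX Hz); rewrite Ez.
Qed.

Lemma cut_above (f g : D -> K) (A : K -> Prop) : reg g -> (forall q, hi g q -> ~ A q) -> reg f ->
  (forall q, lo f q -> A q) -> leR f g.
Proof.
move=> Rg Hg Rf Hf; apply: leR_of_lo => // q /lo_open [q' [L /Hf Aq]].
by have [//|/Hg] := lo_or_hi g L.
Qed.

Lemma CA_sup : Msequence_sup.
Proof.
move=> X HX [a [Ha [b [Hb B]]]]; set x := fun n k => vg X (pair n k).
have Hx : isK2 x := K2_vg HX; have Rx : forall n, reg (x n) := realseq_reg HX.
have Ra := real_reg Ha; have Rb := real_reg Hb.
have {}B n : leR (vg a) (x n) /\ leR (x n) (vg b).
  by have [B1 B2] := B n; split; [exact/(Mle_set_row n Ha HX) | exact/(Mle_row_set n HX Hb)].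
pose A q := exists n, lo (x n) q; pose c := vg a d0 - 2.
have [N HN] := @io_arch (vg b d0 + 2 - c).
have [||||s [Hs Rs S1 S2]] := @cut_real A c N.
- by exists d0; apply: (leR_lo Ra (Rx d0) (proj1 (B d0))); exists d0; rewrite /c e2_0; lra.
- by move=> q q' L [n H]; exists n; exact: lo_le H.
- move=> q [n /(leR_lo (Rx n) Rb (proj2 (B n))) /(lo_lt Rb) /(_ d0)]; rewrite e2_0; lra.
- by apply: D1_ex; apply: (@D1_lo (fun r => x (r 0%N))); rec.
have [z [Hz Ez]] := mk_real Hs Rs; have Dz := den_set (proj1 Hz); exists z; split=> //; split.
  move=> y Hy [n [/(Mle_set_row n Hy HX) L _]].
  apply/(Mle_E (den_set (proj1 Hy)) Dz); rewrite Ez.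
  apply: (leR_trans _ (Rx n) _ L) => //; first exact: real_reg.
  by apply: (cut_above (A := A)) => // q; exists n.
move=> y Hy U; have Ry := real_reg Hy; apply/(Mle_E Dz (den_set (proj1 Hy))); rewrite Ez.
apply: leR_of_lo => // q /S1 [n L].
have [v [Hv Ev]] : exists v, Mis_real v /\ vg v = x n.
  by apply: mk_real => //; rewrite /isK1; rec.
apply: (leR_lo (Rx n) Ry _ L); rewrite -Ev.
apply/(Mle_set Hv Hy); apply: U => //; exists n.
rewrite /Meq (Mle_set_row n Hv HX) (Mle_row_set n HX Hv) Ev.
by split; exact: leR_refl.
Qed.

Lemma CA_open_sup : Mopen_sup.
Proof.
move=> Q Q' HQ HQ' [x [Hx /(Min_open01_E HQ HQ' Hx) [[x0 x1] [n0 [xa xb]]]]].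
have KQ := K1_vg HQ; have KQ' := K1_vg HQ'; have Rx := real_reg Hx.
(* The last three conditions say that the n-th interval meets (0,1), the first two that q is below
   the supremum of that intersection. Everything is stated about endpoints, so A is Sigma^0_1. *)
pose A q := exists n, (q < 1 /\ q < vg Q' n) /\ (vg Q n < vg Q' n /\ (vg Q n < 1 /\ 0 < vg Q' n)).
have Az z q : reg z -> leR (fun _ => 0) z -> leR z (fun _ => 1) -> inO Q Q' z -> lo z q -> A q.
  move=> Rz z0 z1 [n [La Hb]] Lq; exists n.
  split; first by split; [exact: (proj1 (leR_cstr 1 Rz) z1) | exact: lo_hi Lq Hb].
  split; first exact: lo_hi La Hb.
  split; first exact: (proj1 (leR_cstr 1 Rz) z1).
  by have [q' [L H]] := hi_open Hb; have := hi_lt Rz H; have := proj1 (leR_cstl 0 Rz) z0;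
    move=> F G; rewrite ltNge; apply/negP => N; have := lo_hi Rz (F q' ltac:(by lra)) H; rewrite ltxx.
have [||||s [Hs Rs S1 S2]] := @cut_real A (-1) (d1 +' d1 +' d1).
- apply: (Az (vg x)) => //; first by exists n0.
  by apply: (proj1 (leR_cstl 0 Rx) x0); lra.
- by move=> q q' L [n [[A1 A2] A3]]; exists n; split=> //; lra.
- by move=> q [n [[L _] _]]; rewrite !ioE; lra.
- by apply: D1_ex; rec.
have [z [Hz Ez]] := mk_real Hs Rs; have Dz := den_set (proj1 Hz); exists z; split=> //; split.
  move=> y Hy /(Min_open01_E HQ HQ' Hy) [[y0 y1] yO]; have Ry := real_reg Hy.
  apply/(Mle_E (den_set (proj1 Hy)) Dz); rewrite Ez.
  by apply: (cut_above (A := A)) => // q; exact: Az.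
move=> y Hy U; have Ry := real_reg Hy; apply/(Mle_E Dz (den_set (proj1 Hy))); rewrite Ez.
apply: leR_of_lo => // q /S1 [n [[q1 qb] [ab [a1 b0]]]].
(* A rational point of the open set above q, between max(0, q, Q n) and min(1, Q' n). *)
have [p [qp [p0 [p1 [ap pb]]]]] : exists p, q < p /\ (0 <= p /\ (p <= 1 /\ (vg Q n < p /\ p < vg Q' n))).
  have [u [u1 u2]] : exists u, u <= 1 /\ u <= vg Q' n /\ 0 < u /\ q < u /\ vg Q n < u.
    by have [L|L] := lerP 1 (vg Q' n); [exists 1|exists (vg Q' n)]; lra.
  have [l l1] : exists l, 0 <= l /\ q <= l /\ vg Q n <= l /\ l < u.
    have [L|L] := lerP q (vg Q n); have [L'|L'] := lerP 0 q; have [L''|L''] := lerP 0 (vg Q n);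
      by [exists (vg Q n); lra | exists q; lra | exists 0; lra].
  by exists ((l + u) / 2); lra.
have [v [Hv Ev]] := mk_const p.
have /(Mle_set Hv Hy) : Mle (Mset v) (Mset y).
  apply: U => //; apply/(Min_open01_E HQ HQ' Hv); rewrite Ev; split; first by split; apply/leR_cst.
  by exists n; split; [apply/lo_cst|apply/hi_cst].
by rewrite Ev => /(leR_cstl _ Ry); apply.
Qed.
End Arithmetical.

(** * The least real outside a Sigma^0_1 class *)

Section Minimum.

Lemma isTm_mono f : isTm M f -> forall r r', (forall i, io (r i) <= io (r' i)) -> io (f r) <= io (f r').
Proof.
elim=> [i|d|g h _ IHg _ IHh|g h _ IHg _ IHh] r r' L //=.
- by rewrite !ioD; have := IHg _ _ L; have := IHh _ _ L; lra.
- by rewrite !ioM ler_pM ?io_ge0 //; [exact: IHg|exact: IHh].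
Qed.

(** The use principle: a bounded formula inspects its set variable only up to a bound given by a
    term in its number variables. *)
Lemma isD0_use T : isD0 M T -> exists B, isTm M B /\ forall r s s',
  (forall z, io z <= io (B r) -> z \inn s <-> z \inn s') -> T r s <-> T r s'.
Proof.
have two P Q (HP : exists B, isTm M B /\ forall r s s',
    (forall z, io z <= io (B r) -> z \inn s <-> z \inn s') -> P r s <-> P r s')
   (HQ : exists B, isTm M B /\ forall r s s',
    (forall z, io z <= io (B r) -> z \inn s <-> z \inn s') -> Q r s <-> Q r s') :
   exists B, isTm M B /\ forall r s s',
    (forall z, io z <= io (B r) -> z \inn s <-> z \inn s') -> (P r s <-> P r s') /\ (Q r s <-> Q r s').
  have [B [HB HP']] := HP; have [B' [HB' HQ']] := HQ; exists (fun r => B r +' B' r).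
  split; first by apply: isTm_add.
  move=> r s s' H; split; [apply: HP'|apply: HQ'] => z L; apply: H; rewrite ioD;
    [have := io_ge0 (B' r)|have := io_ge0 (B r)]; lra.
have one f P : isTm M f -> (exists B, isTm M B /\ forall r s s',
    (forall z, io z <= io (B r) -> z \inn s <-> z \inn s') ->
    P (fun i => r (S i)) s (r 0%N) <-> P (fun i => r (S i)) s' (r 0%N)) ->
   exists B, isTm M B /\ forall r s s',
    (forall z, io z <= io (B r) -> z \inn s <-> z \inn s') ->
    forall x, x <' f r -> P r s x <-> P r s' x.
  (* Terms are monotone, so the bound for all x below f r is obtained by evaluating at f r. *)
  move=> Hf [B [HB HP]]; exists (fun r => B (scons (f r) r)); split.
    have := @isTm_subst M B (scons f (fun i r => r i)).
    have HF i : isTm M (scons f (fun i r => r i) i) by case: i => [|i] //; exact: isTm_var.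
    move/(_ HF HB); rewrite (_ : (fun r => B (fun i => _)) = (fun r => B (scons (f r) r))) //.
    by apply: funext => r; congr B; apply: funext => -[].
  move=> r s s' H x xf; apply: (HP (scons x r)) => z L; apply: H; apply: le_trans L _.
  by apply: isTm_mono => // -[|i] //=; apply: ltW; apply/io_lt.
elim=> [f g Hf Hg|f g Hf Hg|f X Hf|f Hf||P Q _ IHP _ IHQ|P Q _ IHP _ IHQ|P Q _ IHP _ IHQ
  |f P Hf _ IH|f P Hf _ IH|P Q E _ [B [HB H]]].
- by exists (fun _ => d0); split; [exact: isTm_const|].
- by exists (fun _ => d0); split; [exact: isTm_const|].
- by exists (fun _ => d0); split; [exact: isTm_const|].
- by exists f; split=> // r s s'; apply.
- by exists (fun _ => d0); split; [exact: isTm_const|].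
- by have [B [HB H]] := two _ _ IHP IHQ; exists B; split=> // r s s' /H [-> ->].
- by have [B [HB H]] := two _ _ IHP IHQ; exists B; split=> // r s s' /H [-> ->].
- by have [B [HB H]] := two _ _ IHP IHQ; exists B; split=> // r s s' /H [-> ->].
- have [B [HB H]] := one _ _ Hf IH; exists B; split=> // r s s' /H E.
  by split=> A x xf; apply/(E x xf); exact: A.
- have [B [HB H]] := one _ _ Hf IH; exists B; split=> // r s s' /H E.
  by split=> -[x [xf A]]; exists x; split=> //; apply/(E x xf).
- by exists B; split=> // r s s' /H; rewrite !E.
Qed.

(** The set variable is replaced by the member with index y of a uniformly Delta^0_1 family, so that
    quantification over the family becomes quantification over numbers. *)
Lemma isD0_family (V : D -> D -> Prop) (sy : D -> set) : isP2 V -> (forall y z, z \inn sy y <-> V y z) ->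
  forall T, isD0 M T -> isD1 (fun r => T (fun i => r (S i)) (sy (r 0%N))).
Proof.
move=> HV EV T.
have swap P : isD1 P -> isD1 (fun r => P (scons (r 1%N) (scons (r 0%N) (fun i => r (S (S i)))))).
  move=> HP; have := @D1_subst P (scons (fun r => r 1%N) (scons (fun r => r 0%N) (fun i r => r (S (S i))))).
  have HF i : isTm M (scons (fun r => r 1%N) (scons (fun r => r 0%N) (fun i r => r (S (S i)))) i).
    by case: i => [|[|i]]; apply: isTm_var.
  move/(_ HF HP); apply: D1_ext => r.
  rewrite (_ : (fun i => _) = scons (r 1%N) (scons (r 0%N) (fun i => r (S (S i))))) //.
  by apply: funext => -[|[]].
elim=> [f g Hf Hg|f g Hf Hg|f X Hf|f Hf||P Q _ IHP _ IHQ|P Q _ IHP _ IHQ|P Q _ IHP _ IHQ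
  |f P Hf _ IH|f P Hf _ IH|P Q E _ IH].
- by apply: D1_eq; apply: R_T; exact: isTm_shift.
- by apply: D1_lt; apply: R_T; exact: isTm_shift.
- by apply: D1_mem; apply: R_T; exact: isTm_shift.
- apply: (@D1_ext (fun r => V (r 0%N) (f (fun i => r (S i))))); first by move=> r; rewrite EV.
  by apply: (D1_app2 HV); apply: R_T; [exact: isTm_var|exact: isTm_shift].
- exact: D1_const.
- exact: D1_imp.
- exact: D1_and.
- exact: D1_or.
- apply: (@D1_ball (fun r => f (fun i => r (S i))) (fun r x => P (fun i => r (S i)) (sy (r 0%N)) x)).
    by apply: R_T; exact: isTm_shift.
  exact: (swap _ IH).
- apply: (@D1_bex (fun r => f (fun i => r (S i))) (fun r x => P (fun i => r (S i)) (sy (r 0%N)) x)).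
    by apply: R_T; exact: isTm_shift.
  exact: (swap _ IH).
- by apply: D1_ext IH => r; rewrite E.
Qed.

(** [fl i n k] is the truncation to [k] binary digits of the string of length [n]
    coded by [i]. *)
Lemma floor_exists : exists fl : D -> D -> D -> D, isR3 fl /\
  forall i n k, io (fl i n k) * io (exp2 n) <= io i * io (exp2 k) /\
                io i * io (exp2 k) < (io (fl i n k) + 1) * io (exp2 n).
Proof.
have Ex (r : env) : exists t, r 0%N *' exp2 (r 2%N) <' (t +' d1) *' exp2 (r 1%N) /\
    ~ (r 0%N *' exp2 (r 2%N) <' t *' exp2 (r 1%N)).
  move: (r 0%N *' exp2 (r 2%N)) (r 1%N) => a n.
  have [||t [Ht Lt]] := @D1_least (fun t => a <' (t +' d1) *' exp2 n) a.
  - by rewrite /isP1; rec.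
  - have e1 : 1 <= io (exp2 n) by have := exp2_gt0 n; rewrite -(io0 R) => /io_lt /io_S; rewrite io0 add0r.
    by apply/io_lt; rewrite ioM ioD io1; have := ler_wpM2l (io_ge0 a) e1; lra.
  exists t; split=> //; have [->|[t' Et]] := io_0or t.
    by apply/io_ltn; rewrite ioM io0 mul0r; exact: io_ge0.
  by rewrite Et; apply: Lt; clear -Et; dlra.
have [g [Hg Eg]] := @R_choice (fun r t => r 0%N *' exp2 (r 2%N) <' (t +' d1) *' exp2 (r 1%N) /\
    ~ (r 0%N *' exp2 (r 2%N) <' t *' exp2 (r 1%N))) ltac:(by rec) Ex.
pose F i n k := g (scons i (scons n (fun _ => k))).
exists F; split.
  have := @R_subst g (fun i r => match i with 0 => r 0 | 1 => r 1 | _ => r 2 end%N) _ Hg.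
  rewrite /isR3 /F; have -> : (fun r => g (scons (r 0%N) (scons (r 1%N) (fun _ => r 2%N)))) =
    (fun r : env => g (fun i => match i with 0 => r 0 | 1 => r 1 | _ => r 2 end%N)).
    by apply: funext => r; congr g; apply: funext => -[|[]].
  by apply=> -[|[|i]]; exact: isTm_var.
move=> i n k; have [/= /io_lt A /io_ltn B] := Eg (scons i (scons n (fun _ => k))).
by rewrite /F; move: A B; rewrite !ioM ioD io1.
Qed.

Definition fl : D -> D -> D -> D := sval (cid floor_exists).
Lemma R3_fl : isR3 fl. Proof. by rewrite /fl; case: cid => f []. Qed.
Lemma flP (i n k : D) : io (fl i n k) * e2 k <= io i * e2 n /\ io i * e2 n < (io (fl i n k) + 1) * e2 k.
Proof.
have [A B] : io (fl i n k) * io (exp2 n) <= io i * io (exp2 k) /\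
             io i * io (exp2 k) < (io (fl i n k) + 1) * io (exp2 n) by rewrite /fl; case: cid => f [].
rewrite /e2 ler_pdivrMr ?exp2_gt0 // mulrAC ler_pdivlMr ?exp2_gt0 //; split=> //.
by rewrite ltr_pdivrMr ?exp2_gt0 // mulrAC ltr_pdivlMr ?exp2_gt0.
Qed.

Lemma exp2D (i j : D) : io (exp2 (i +' j)) = io (exp2 i) * io (exp2 j).
Proof.
rewrite -ioM; congr io; move: j; apply: S1_ind; first by apply: S1_of_D1; rec.
  by rewrite exp2_0 (_ : i +' d0 = i); dlra.
by move=> j IH; rewrite (_ : i +' (j +' d1) = i +' j +' d1) ?exp2_S ?IH; dlra.
Qed.

(** [t * e2 j] is an integer multiple of [e2 n]. *)
Lemma e2_multiple (j n i t : D) : io j <= io n -> io i * e2 n < io t * e2 j -> (io i + 1) * e2 n <= io t * e2 j.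
Proof.
move=> /io_sub [m Em]; have {Em} -> : n = j +' m by dlra.
have E : e2 j = io (exp2 m) * e2 (j +' m).
  by rewrite /e2 exp2D invfM mulrCA mulfV ?mulr1 // gt_eqF ?exp2_gt0.
rewrite E mulrA ltr_pM2r ?e2_gt0 // ler_pM2r ?e2_gt0 // -ioM => /io_lt /io_S //.
Qed.

Lemma fl_unique (i n k t : D) : io t * e2 k <= io i * e2 n -> io i * e2 n < (io t + 1) * e2 k -> fl i n k = t.
Proof.
have [A B] := flP i n k => C F; have E := e2_gt0 k.
have L (u v : D) : io u * e2 k < (io v + 1) * e2 k -> io u <= io v.
  by rewrite ltr_pM2r // => H; rewrite leNgt; apply/negP => /io_lt /io_S; lra.
apply: io_inj; apply/eqP; rewrite eq_le; apply/andP; split; apply: L.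
  exact: le_lt_trans A F.
exact: le_lt_trans C B.
Qed.

Lemma fl_id i n : fl i n n = i.
Proof. by apply: fl_unique => //; rewrite ltr_pM2r ?e2_gt0 //; lra. Qed.

(** Points of the coarse grid also lie on the finer one, so by [e2_multiple] the fine cell is
    contained in the coarse cell. *)
Lemma fl_fl i n m k : io k <= io m -> fl (fl i n m) m k = fl i n k.
Proof.
move=> km; have [A B] := flP i n k; have [C F] := flP i n m.
have H : (io (fl i n m) + 1) * e2 m <= (io (fl i n k) + 1) * e2 k.
  rewrite -[X in _ <= (_ + X) * _](io1 R) -ioD; apply: e2_multiple => //.
  by rewrite ioD io1; exact: le_lt_trans C B.
apply: fl_unique; last by apply: lt_le_trans H; rewrite ltr_pM2r ?e2_gt0 //; lra.
rewrite leNgt; apply/negP => /(e2_multiple km) L.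
by have := le_lt_trans A F; lra.
Qed.

Lemma fl_mono (i i' n k : D) : io i <= io i' -> io (fl i n k) <= io (fl i' n k).
Proof.
move=> L; have [A _] := flP i n k; have [_ B] := flP i' n k; have E := e2_gt0 k.
have : io (fl i n k) * e2 k < (io (fl i' n k) + 1) * e2 k.
  by apply: le_lt_trans A _; apply: le_lt_trans B; rewrite ler_pM2r ?e2_gt0.
by rewrite ltr_pM2r // => H; rewrite leNgt; apply/negP => /io_lt /io_S; lra.
Qed.

Lemma lt_exp2 (i n : D) : i <' exp2 n <-> io i * e2 n < 1.
Proof. by rewrite io_lt /e2 ltr_pdivrMr ?exp2_gt0 // mul1r. Qed.

Lemma fl_lt (i n k : D) : i <' exp2 n -> fl i n k <' exp2 k.
Proof. by move=> /lt_exp2 L; apply/lt_exp2; apply: le_lt_trans L; case: (flP i n k). Qed.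

(** A path through the binary tree: [l n] is the number with the first n binary digits, and the last
    condition makes these initial segments cohere. *)
Definition digits (l : D -> D) : Prop := [/\ isR1 l, forall k, l k <' exp2 k &
  forall j n, io j <= io n -> fl (l n) n j = l j].

(** The canonical k-th entry t / 2^k. Codes of rationals store the denominator minus one, hence e +
    1 = 2^k. *)
Definition entry_of (t k z : D) : Prop := exists e, e <' z +' d1 /\
  (z = pair k (pair (pair t d0) e) /\ e +' d1 = exp2 k).

Lemma entry_ofE t k z : entry_of t k z <-> exists e, z = pair k (pair (pair t d0) e) /\ e +' d1 = exp2 k.
Proof.
split=> [[e [_ [A B]]]|[e [-> B]]]; exists e => //; split=> //; apply: le_ltS.
by apply: le_trans (le_pair2 _ _); exact: le_pair2.
Qed.

Lemma D1_entry_of f g h : isR f -> isR g -> isR h -> isD1 (fun r => entry_of (f r) (g r) (h r)).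
Proof.
apply: (@D1_app3 entry_of); rewrite /isP3 /entry_of.
by apply: (D1_bex (f := fun r => r 2%N +' d1)); rec.
Qed.

Lemma exp2_pred (k : D) : exists e, e +' d1 = exp2 k.
Proof.
have [E|[e ->]] := io_0or (exp2 k); last by exists e.
by have := exp2_gt0 k; rewrite E io0 ltxx.
Qed.

Lemma digit_set (l : D -> D) : isR1 l -> exists X : set,
  [/\ Mis_ratseq X, forall k, vg X k = io (l k) * e2 k &
   forall z, z \inn X <-> exists k, k <' z +' d1 /\ entry_of (l k) k z].
Proof.
move=> Hl; have [X HX] := @D1_set (fun z => exists k, k <' z +' d1 /\ entry_of (l k) k z)
  ltac:(by apply: (D1_bex (f := fun r => r 0%N +' d1)); [rec|apply: D1_entry_of; rec]).
have HX' k e : e +' d1 = exp2 k -> pair k (pair (pair (l k) d0) e) \inn X.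
  by move=> He; apply/HX; exists k; split; [apply: le_ltS; exact: le_pair1|apply/entry_ofE; exists e].
have HR : Mis_ratseq X.
  split; first by move=> z /HX [k [_ /entry_ofE [e [-> _]]]]; exists k, (l k), d0, e.
  split; first by move=> k; have [e He] := exp2_pred k; exists (l k), d0, e; exact: HX'.
  move=> k q q' [/HX [j [_ /entry_ofE [e [/pair_inj [<- ->] He]]]] /HX [j' [_ /entry_ofE [e' [/pair_inj [<- ->] He']]]]].
  by congr pair; dlra.
exists X; split=> // k; have [e He] := exp2_pred k.
have := HX' k e He => /rtP - /(_ (ratseq_entry HR k)); rewrite /vg => ->.
by rewrite /val /= He io0 subr0.
Qed.

Lemma digits_reg (l : D -> D) : digits l -> reg (fun k => io (l k) * e2 k).
Proof.
move=> [_ _ C] k j kj; have [A B] := flP (l j) j k; rewrite (C _ _ kj) in A B.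
by have := e2_gt0 k; lra.
Qed.

Lemma digits_real (l : D -> D) : digits l -> exists X : set,
  [/\ Mis_real X, Min01 (Mset X), vg X = (fun k => io (l k) * e2 k) &
   forall z, z \inn X <-> exists k, k <' z +' d1 /\ entry_of (l k) k z].
Proof.
move=> Dl; have [Hl L C] := Dl; have [X [HX /funext EX HE]] := digit_set Hl.
have RX : Mis_real X by split=> //; apply/(Mmodulus_E (den_set HX)); rewrite EX; exact: digits_reg.
exists X; split=> //; apply/(in01_cst RX); rewrite EX.
split=> k; have := e2_gt0 k; have /lt_exp2 := L k; have := mulr_ge0 (io_ge0 (l k)) (ltW (e2_gt0 k)); lra.
Qed.

Hypothesis CA : Sigma1_CA.

(** Binary digits cannot be read off a regular sequence recursively, as comparison with a dyadic
    point is only Sigma^0_1; comprehension decides it. *)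
Lemma real_digits (z : D -> K) : isK1 z -> reg z -> leR (fun _ => 0) z -> leR z (fun _ => 1) ->
  exists l, [/\ digits l, leR z (fun k => io (l k) * e2 k) & leR (fun k => io (l k) * e2 k) z].
Proof.
move=> Hz Rz z0 z1.
(* The cell i * e2 k < z <= (i + 1) * e2 k, with the ends of [0,1] settled by the two disjunctions.
   A positive dyadic point therefore gets the expansion ending in ones. *)
pose P (k i : D) := (i = d0 \/ lo z (io i * e2 k)) /\
  ((i +' d1 = exp2 k \/ ~ lo z ((io i + 1) * e2 k)) /\ i <' exp2 k).
have HP : isP2 P.
  have H : isP2 (fun k i => lo z (io i * e2 k)) by apply: (D1_lo CA (f := fun _ => z)); rec.
  have H' : isP2 (fun k i => lo z ((io i + 1) * e2 k)) by apply: (D1_lo CA (f := fun _ => z)); rec.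
  by rewrite /isP2 /P; rec.
have Ex k : exists i, P k i.
  have [||i [Hi Li]] := @D1_least (fun i => i +' d1 = exp2 k \/ ~ lo z ((io i + 1) * e2 k)) (sval (cid (exp2_pred k))).
  - by apply: D1_or; [rec|apply: D1_not; apply: (D1_lo CA (f := fun _ => z)); rec].
  - by left; exact: svalP (cid (exp2_pred k)).
  exists i; split; last first.
    split=> //; have [e He] := exp2_pred k.
    have [L|[->|L]] := io_case i e; [by dlra|by dlra|].
    by case: (Li e L); left.
  have [->|[j Ej]] := io_0or i; first by left.
  right; apply: contrapT => N; apply: (Li j); first by clear -Ej; dlra.
  by right; move: N; rewrite Ej ioD io1.
have Un k i i' : P k i -> P k i' -> i = i'.
  have L u v : P k u -> P k v -> ~ u <' v.
    move=> [_ [B _]] [A [_ F]] uv; case: B => [E|B]; first by clear A; dlra.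
    case: A => [E|A]; first by clear B; dlra.
    apply: B; apply: lo_le A; rewrite ler_pM2r ?e2_gt0 //.
    by move: uv => /io_S.
  move=> Pi Pi'; have [/(L _ _ Pi Pi')//|[//|/(L _ _ Pi' Pi)//]] := io_case i i'.
pose l k := sval (cid (Ex k)); have Hl k : P k (l k) := svalP (cid (Ex k)).
have Rl : isR1 l.
  apply: (@S1_ext (fun r => P (r 1%N) (r 0%N))).
    by move=> r; split=> [H|<-//]; exact: Un (Hl _) H.
  by apply: S1_of_D1; rec.
have Dl : digits l.
  split=> // [k|j n jn]; first by have [_ [_ ?]] := Hl k.
  apply: (Un j) => //; have [A [B F]] := Hl n; set t := fl _ _ _.
  have [T1 T2] := flP (l n) n j; rewrite -/t in T1 T2.
  have ET : (io (l n) + 1) * e2 n <= (io t + 1) * e2 j.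
    by rewrite -[X in _ <= (_ + X) * _](io1 R) -ioD; apply: e2_multiple => //; rewrite ioD io1.
  split.
    case: A => [E|A]; last by right; exact: lo_le A.
    left; apply: io_inj; rewrite io0; apply/eqP; rewrite eq_le io_ge0 andbT.
    by rewrite -(pmulr_lle0 _ (e2_gt0 j)); apply: le_trans T1 _; rewrite E io0 mul0r.
  have Tl : t <' exp2 j by exact: fl_lt.
  split=> //; case: B => [E|B]; [left|right]; last by move=> H; apply: B; exact: lo_le H.
  have : io (exp2 j) <= io t + 1.
    have E1 : (io (l n) + 1) * e2 n = 1.
      by rewrite -(io1 R) -ioD E /e2 mulfV ?io1 // gt_eqF ?exp2_gt0.
    by move: ET; rewrite E1 /e2 ler_pdivlMr ?exp2_gt0 // mul1r.
  by move: Tl => /io_S ? ?; apply: io_inj; rewrite ioD io1; lra.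
exists l; split=> // k; have [A [B F]] := Hl k; have E := e2_gt0 k.
  case: B => [B|/nlo /(_ k)]; last by lra.
  have N1 : ~ lo z 1 by move=> /(proj1 (leR_cstr 1 Rz) z1); rewrite ltxx.
  have := nlo N1 k; have : (io (l k) + 1) * e2 k = 1.
    by rewrite -(io1 R) -ioD B /e2 mulfV ?io1 // gt_eqF ?exp2_gt0.
  by lra.
case: A => [->|/(lo_lt Rz) /(_ k)]; last by lra.
by have := z0 k; rewrite io0; lra.
Qed.

Section Closed.
Variables (T : env -> set -> Prop) (P : set -> Prop).
Hypothesis HT : isD0 M T.
Hypothesis EP : forall X, Mis_real X -> P X <-> exists w, T (scons w (fun _ => d0)) X.
Hypothesis Pext : forall X Y, Mis_real X -> Mis_real Y ->
  leR (vg X) (vg Y) -> leR (vg Y) (vg X) -> P X -> P Y.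

(** A string that is not covered has a child that is not covered, so the leftmost such strings of
    all lengths cohere to a path. No initial segment of this path is bad, so P fails there; a path
    further left enters a covered string and hence a bad one. *)
Lemma min_exists X0 : Mis_real X0 -> Min01 (Mset X0) -> ~ P X0 ->
  exists Y, [/\ Mis_real Y, Min01 (Mset Y), ~ P Y &
    forall Z, Mis_real Z -> Min01 (Mset Z) -> ltR (vg Z) (vg Y) -> P Z].
Proof.
have Hfl := R3_fl; have [B [HB UB]] := isD0_use HT.
have [p [q [Hp Hq Epq]]] := unpair.
(* For y = pair i n this is the canonical code of i * 2^-n: the string i of length n continued by
   zeros. *)
pose V y z := exists k, k <' z +' d1 /\ entry_of (fl (p y) (q y) k) k z.
have HV : isP2 V.
  by rewrite /isP2 /V; apply: (D1_bex (f := fun r => r 1%N +' d1)); [rec|apply: D1_entry_of; rec].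
have SV y : exists X : set, forall z, z \inn X <-> V y z.
  by apply: D1_set; apply: (@D1_app2 V (fun _ => y)) => //; rec.
pose sy y : set := sval (cid (SV y)); have Esy y z : z \inn sy y <-> V y z := svalP (cid (SV y)) z.
have VE i n z : z \inn sy (pair i n) <-> exists k, k <' z +' d1 /\ entry_of (fl i n k) k z.
  by rewrite Esy /V; have [-> ->] := Epq i n.
pose b w := B (scons w (fun _ => d0)).
have Hb : isR1 b.
  apply: R_T; have := @isTm_subst M B (scons (fun r => r 0%N) (fun _ _ => d0)).
  have HF i : isTm M (scons (fun r => r 0%N) (fun _ _ => d0) i) by case: i => [|i]; [exact: isTm_var|exact: isTm_const].
  move/(_ HF HB); rewrite (_ : (fun r => B (fun i => _)) = (fun r => b (r 0%N))) //.
  by apply: funext => r; rewrite scons_eval.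
pose tt w y := T (scons w (fun _ => d0)) (sy y).
have Htt : isP2 tt.
  have := isD0_family HV Esy HT => /(@D1_subst _ (scons (fun r => r 1%N) (scons (fun r => r 0%N) (fun _ _ => d0)))).
  have HF i : isTm M (scons (fun r => r 1%N) (scons (fun r => r 0%N) (fun _ _ => d0)) i).
    by case: i => [|[|i]]; [exact: isTm_var|exact: isTm_var|exact: isTm_const].
  by move/(_ HF); apply: D1_ext => r; rewrite /tt /= !scons_eval.
(* The use b w is at most n. Elements z <= n of a canonical code belong to entries k <= n, which the
   string fixes, so badness passes to every extension. *)
pose bad i n := exists w, ~ n <' b w /\ tt w (pair i n).
have Hbad : isP2 bad by apply: (D1_ex CA); rec.
have agree i n i' n' : (forall k, io k <= io n -> fl i n k = fl i' n' k) ->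
    forall z, io z <= io n -> z \inn sy (pair i n) <-> z \inn sy (pair i' n').
  by move=> H z L; rewrite !VE; split=> -[k [kz E]]; exists k; split=> //;
    move: E; rewrite H //; move: kz => /io_S; rewrite ioD io1; lra.
have bad_up i n m : io m <= io n -> bad (fl i n m) m -> bad i n.
  move=> mn [w [/io_ltn bw tw]]; exists w; split; first by apply/io_ltn; exact: le_trans bw mn.
  apply: (proj1 (UB _ _ _ _) tw) => z Lz; apply: agree; last exact: le_trans Lz bw.
  by move=> k km; exact: fl_fl.
(* The extensions of length n range over a bounded set of numbers, so the condition stays
   existential in n. *)
pose cov i j := exists n, ~ n <' j /\ forall i', i' <' exp2 n -> fl i' n j = i -> bad i' n.
have Hcov : isP2 cov.
  apply: (D1_ex CA); apply: D1_and; first by rec.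
  by apply: (@D1_ball (fun r => exp2 (r 0%N))); rec.
have bad_cov i j : bad i j -> cov i j.
  by move=> H; exists j; split; [apply/io_ltn|move=> i' _; rewrite fl_id => ->].
have cov_ext i j n : io j <= io n -> cov (fl i n j) j -> cov i n.
  move=> jn [m [/io_ltn jm H]]; have [n' [nn' mn']] := io_max n m.
  exists n'; split; first by apply/io_ltn.
  move=> i' Li' Ei'; apply: (bad_up _ _ m) => //; apply: H; first exact: fl_lt.
  by rewrite fl_fl // -Ei' fl_fl.
(* The children of i are 2 i and 2 i + 1. If both are covered, the larger of the two lengths works
   for i, as badness is inherited. *)
have cov_join i j : i <' exp2 j -> (forall i', i' <' exp2 (j +' d1) -> fl i' (j +' d1) j = i -> cov i' (j +' d1)) -> cov i j.
  move=> Li H; apply: contrapT => NC.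
  have E2 : e2 (j +' d1) = e2 j / 2 := e2_S j; have E := e2_gt0 j.
  have LE : (io i + 1) * e2 j <= 1.
    by move: Li => /io_S; rewrite /e2 ler_pdivrMr ?exp2_gt0 // mul1r.
  have F0 : fl (i +' i) (j +' d1) j = i by apply: fl_unique; rewrite ioD E2; lra.
  have F1 : fl (i +' i +' d1) (j +' d1) j = i by apply: fl_unique; rewrite !ioD io1 E2; lra.
  have [|n0 [/io_ltn jn0 H0]] := H _ _ F0; first by apply/lt_exp2; rewrite ioD E2; lra.
  have [|n1 [/io_ltn jn1 H1]] := H _ _ F1; first by apply/lt_exp2; rewrite !ioD io1 E2; lra.
  have [n [nn0 nn1]] := io_max n0 n1; apply: NC; exists n.
  have jn : io j + 1 <= io n by apply: le_trans nn0; move: jn0; rewrite ioD io1.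
  split; first by apply/io_ltn; lra.
  move=> i' Li' Ei'; pose t := fl i' n (j +' d1).
  have Et : fl t (j +' d1) j = i by rewrite /t fl_fl // ioD io1; lra.
  have [A A'] := flP t (j +' d1) j; rewrite Et E2 in A A'.
  have [T0|T1] : t = i +' i \/ t = i +' i +' d1.
    have e2' : 0 < e2 j / 2 by lra.
    have U : io t < io (i +' i +' d1 +' d1).
      by rewrite -(ltr_pM2r e2') !ioD io1; lra.
    have U' : io (i +' i) <= io t.
      by rewrite -(ler_pM2r e2') !ioD; lra.
    move: U => /io_lt /io_S U; have [L|[->|L]] := io_case t (i +' i); [by exfalso; dlra|by left|].
    by right; clear -U L; move: L => /io_S L; apply: io_inj; rewrite !ioD io1 in U L *; lra.
  - by apply: (bad_up _ _ n0) => //; apply: H0; [exact: fl_lt|rewrite fl_fl].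
  - by apply: (bad_up _ _ n1) => //; apply: H1; [exact: fl_lt|rewrite fl_fl].
have digits_P l X : digits l -> Mis_real X -> (forall z, z \inn X <-> exists k, k <' z +' d1 /\ entry_of (l k) k z) ->
    P X <-> exists n, bad (l n) n.
  move=> [_ _ Cl] HX EX.
  have AG n z : io z <= io n -> z \inn X <-> z \inn sy (pair (l n) n).
    move=> zn; rewrite EX VE; split=> -[k [kz E]]; exists k; split=> //; move: E; rewrite Cl //;
      by move: kz => /io_S; rewrite ioD io1; lra.
  rewrite EP //; split=> [[w Tw]|[n [w [/io_ltn bw tw]]]].
    exists (b w); exists w; split; first by apply/io_ltn.
    by apply: (proj1 (UB _ _ _ _) Tw) => z Lz; exact: AG.
  by exists w; apply: (proj2 (UB _ _ _ _) tw) => z Lz; apply: AG; exact: le_trans Lz bw.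
(* An arbitrary code is traded for the canonical code of an equal real; [Pext] transfers P. *)
have digits_of X : Mis_real X -> Min01 (Mset X) -> exists l, [/\ digits l,
    P X <-> exists n, bad (l n) n, leR (vg X) (fun k => io (l k) * e2 k) & leR (fun k => io (l k) * e2 k) (vg X)].
  move=> HX X01; have [KX RX X0' X1'] := in01_real HX X01.
  have [l [Dl L1 L2]] := real_digits KX RX X0' X1'; exists l; split=> //.
  have [Y [HY Y01 EY EY']] := digits_real Dl; rewrite -(digits_P _ _ Dl HY EY').
  by split; apply: Pext => //; rewrite EY.
move=> HX0 X001 NP; have [d [Dd dP _ _]] := digits_of X0 HX0 X001.
(* No initial segment of the digits of X0 is covered, since covering would make a longer one bad. *)
have Nc j : exists i, i <' exp2 j /\ ~ cov i j.
  exists (d j); have [_ Ld Cd] := Dd; split=> // -[n [/io_ltn jn H]].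
  by apply: NP; apply/dP; exists n; apply: H => //; exact: Cd.
have HN : isP2 (fun j i => i <' exp2 j /\ ~ cov i j) by rewrite /isP2; rec.
have Lj j : exists i, (i <' exp2 j /\ ~ cov i j) /\ forall k, k <' i -> ~ (k <' exp2 j /\ ~ cov k j).
  have [i Hi] := Nc j; apply: (D1_least (P := fun i => i <' exp2 j /\ ~ cov i j)) Hi.
  by apply: (@D1_app2 _ (fun _ => j) _ HN); rec.
pose l j := sval (cid (Lj j)).
have [l1 l2 l3] : [/\ forall j, l j <' exp2 j, forall j, ~ cov (l j) j &
    forall j i, i <' l j -> i <' exp2 j -> cov i j].
  split=> j; have [[A1 A2] A3] := svalP (cid (Lj j)); rewrite -/(l j) in A1 A2 A3 => //.
  by move=> i Li Li'; apply: contrapT => N; exact: (A3 i Li).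
have Rl : isR1 l.
  apply: (@S1_ext (fun r => (r 0%N <' exp2 (r 1%N) /\ ~ cov (r 0%N) (r 1%N)) /\
      forall k, k <' r 0%N -> ~ (k <' exp2 (r 1%N) /\ ~ cov k (r 1%N)))).
    move=> r; split=> [[[A1 A2] A3]|<-]; last exact: svalP (cid (Lj (r 1%N))).
    have [L|[//|L]] := io_case (r 0%N) (l (r 1%N)).
      by case: A2; exact: l3.
    by case: (A3 _ L).
  apply: S1_of_D1; apply: D1_and; first by rec.
  by apply: (@D1_ball (fun r => r 0%N)); rec.
have Dl : digits l.
  split=> // j n jn; set i := fl (l n) n j.
  have Li : i <' exp2 j by exact: fl_lt.
  have Ni : ~ cov i j by move=> /(cov_ext _ _ _ jn) /l2.
  have [L|[//|L]] := io_case i (l j); first by case: Ni; exact: l3.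
  exfalso.
  (* In the remaining case [l j] is left of the truncation i of [l n]. Going down from [l j] through
     strings that are not covered gives one of length n; it is not left of [l n], so by monotonicity
     of truncation i is at most [l j]. *)
  have : forall m, exists i', i' <' exp2 (j +' m) /\ (fl i' (j +' m) j = l j /\ ~ cov i' (j +' m)).
    apply: S1_ind; first by apply: S1_ex; apply: S1_of_D1; rec.
      by rewrite (_ : j +' d0 = j); [exists (l j); rewrite fl_id | dlra].
    move=> m [i' [Li' [E NC]]]; rewrite (_ : j +' (m +' d1) = j +' m +' d1); last by dlra.
    apply: contrapT => N; apply: NC; apply: cov_join => // i'' Li'' E''.
    apply: contrapT => NC; apply: N; exists i''; split=> //; split=> //.
    by rewrite -E -E'' fl_fl // ioD; have := io_ge0 m; lra.
  have [m Em] := io_sub jn; have En : n = j +' m by clear -Em; dlra.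
  move=> /(_ m); rewrite -En => -[i' [Li' [E NC]]].
  have nL : io (l n) <= io i' by apply/io_ltn => H; apply: NC; exact: l3.
  by have := fl_mono n j nL; rewrite E -/i; move: L => /io_lt; lra.
have [Y [HY Y01 EY EY']] := digits_real Dl; exists Y; split=> //.
  by move=> /(digits_P _ _ Dl HY EY') [n /bad_cov /l2].
move=> Z HZ Z01 ZY; have [d' [Dd' dP' Z1 Z2]] := digits_of Z HZ Z01; apply/dP'.
have RZ := real_reg HZ; have Rd := digits_reg Dd'; have RY := real_reg HY.
(* Otherwise Z would not be below Y. At such a j the digits of Z are left of the leftmost string
   that is not covered, hence covered. *)
have [j Hj] : exists j, d' j <' l j.
  apply: contrapT => N; apply: (proj2 (nltR (vg Y) (vg Z)) _ ZY).
  apply: (leR_trans RY Rd RZ _ Z2) => k; rewrite EY.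
  have /io_ltn L : ~ d' k <' l k by move=> H; apply: N; exists k.
  by have := ler_wpM2r (ltW (e2_gt0 k)) L; have := e2_gt0 k; lra.
have [_ Ld Cd] := Dd'; have [n [/io_ltn jn H]] := l3 j (d' j) Hj (Ld j).
by exists n; apply: H => //; exact: Cd.
Qed.
End Closed.
End Minimum.

(** * Open induction from comprehension *)

Section Induction.
Hypothesis CA : Sigma1_CA.

(** A formula may distinguish codes of the same real, but an equal real lies in every neighbourhood,
    so an open P cannot. *)
Lemma MOpen_ext (P : set -> Prop) : MOpen P -> forall X Y, Mis_real X -> Mis_real Y ->
  leR (vg X) (vg Y) -> leR (vg Y) (vg X) -> P X -> P Y.
Proof.
move=> OP X Y HX HY L L' /(OP X HX) [E [HE [/(Mpos_E HE) /(pos_lo (real_reg HE)) [n Hn] H]]].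
apply: H => //; apply/(Mnear_E (den_set (proj1 HY)) (den_set (proj1 HX)) (den_set (proj1 HE))).
apply: (clo_near _ _ _ _ (e2_gt0 n) Hn); try exact: real_reg.
by move=> j; have := L j; have := L' j; have := e2_gt0 j; lra.
Qed.

Lemma Sigma1_D0 Psi rho sigma : Sigma1 Psi -> exists T, isD0 M T /\
  forall r X, msat Psi rho sigma X <-> exists w, T (scons w r) X.
Proof.
move=> [p [Dp ->]].
have := @Delta0_isD0 M p Dp (scons (fun r => r 0%N) (fun i _ => rho i))
  (scons None (fun j => Some (sigma j))).
have HF i : isTm M (scons (fun r => r 0%N) (fun i _ => rho i) i).
  by case: i => [|i]; [exact: isTm_var|exact: isTm_const].
move/(_ HF) => HT; eexists; split; first exact: HT.
move=> r X; rewrite /msat /=; apply: exists_iff => w.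
rewrite (_ : (fun i => scons _ _ i _) = scons w rho); last by apply: funext => -[].
by rewrite (_ : (fun j => _) = scons X sigma) //; apply: funext => -[].
Qed.

(** The row must keep its own rational codes, since [Mis_row] compares codes rather than values. *)
Lemma row_real (X : set) (n : D) : Mis_realseq X ->
  exists y, Mis_row X n y /\ vg y = fun k => vg X (pair n k).
Proof.
move=> HX; have E := realseq_entry HX n.
have [Y HY] := @D1_set (fun z => exists k, k <' z +' d1 /\ exists q, q <' z +' d1 /\
    (z = pair k q /\ pair (pair n k) q \inn X))
  ltac:(rewrite /isP1; apply: (D1_bex (f := fun r => r 0%N +' d1)); first (by rec);
        apply: (D1_bex (f := fun r => r 1%N +' d1)); rec).
have HY' k q : pair k q \inn Y <-> pair (pair n k) q \inn X.
  rewrite HY; split=> [[k' [_ [q' [_ [/pair_inj [-> ->]]]]]]//|H].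
  exists k; split; first by apply: le_ltS; exact: le_pair1.
  by exists q; split; first by apply: le_ltS; exact: le_pair2.
have RY : Mis_ratseq Y.
  split.
    move=> z /HY [k [_ [q [_ [-> H]]]]]; have [[a [b [c F]]] U] := E k.
    by exists k, a, b, c; rewrite (U _ _ (conj H F)).
  split=> [k|k q q']; last by rewrite !HY'; case: (E k) => _; apply.
  by have [[a [b [c F]]] _] := E k; exists a, b, c; apply/HY'.
have V : vg Y = fun k => vg X (pair n k).
  apply: funext => k; have [[a [b [c F]]] _] := E k.
  rewrite /vg; have := F => /rtP - /(_ (E k)) ->.
  by have /rtP - /(_ (ratseq_entry RY k)) -> // : pair k (pair (pair a b) c) \inn Y by apply/HY'.
exists Y; split=> //; split; last by move=> k q; split=> /HY'.
by split=> //; apply/(Mmodulus_E (den_set RY)); rewrite V; exact: realseq_reg.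
Qed.

Section Minimal.
Variables (P : set -> Prop) (T : env -> set -> Prop).
Hypothesis OP : MOpen P.
Hypothesis HT : isD0 M T.
Hypothesis EP : forall r X, Mis_real X -> P X <-> exists w, T (scons w r) X.

Lemma open_min X : Mis_real X -> Min01 (Mset X) -> ~ P X ->
  exists Y, [/\ Mis_real Y, Min01 (Mset Y), ~ P Y &
    forall Z, Mis_real Z -> Min01 (Mset Z) -> Mlt (Mset Z) (Mset Y) -> P Z].
Proof.
move=> HX X01 NP.
have [Y [HY Y01 NY H]] := min_exists CA HT (EP (fun _ => d0)) (MOpen_ext OP) HX X01 NP.
by exists Y; split=> // Z HZ Z01 /(Mlt_set HZ HY); exact: H.
Qed.

Lemma open_MOI1 : MProg P -> forall X, Mis_real X -> Min01 (Mset X) -> P X.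
Proof.
move=> Pr X HX X01; apply: contrapT => /(open_min HX X01) [Y [HY Y01 NY H]].
by apply: NY; exact: Pr.
Qed.

(** A least counterexample Y would be the limit of a sequence from P, contrary to closure under
    limits. *)
Lemma open_MOI3 : Mat_zero P -> MLCC P -> forall X, Mis_real X -> Min01 (Mset X) -> P X.
Proof.
move=> [z [Hz [z0 Pz]]] LCC X HX X01; apply: contrapT => /(open_min HX X01) [Y [HY Y01 NY H]].
have [KY RY Y0 Y1] := in01_real HY Y01.
have Ez : vg z = fun _ => 0.
  apply: funext => k; have := z0 k => /rtP - /(_ (ratseq_entry (proj1 Hz) k)); rewrite /vg => ->.
  by rewrite /val /= subrr mul0r.
(* The term [vg Y m - 2 * e2 m] is strictly below the real Y and tends to it; cutting off at 0 keeps
   the sequence in [0,1]. *)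
pose x m : K := if `[< vg Y m - 2 * e2 m < 0 >] then 0 else vg Y m - 2 * e2 m.
have Hx : isK1 x by rewrite /isK1 /x; rec.
have xP m : (x m = 0 /\ vg Y m - 2 * e2 m < 0) \/ (x m = vg Y m - 2 * e2 m /\ 0 <= x m).
  rewrite /x; case: asboolP => L; [by left|right].
  by split=> //; rewrite leNgt; apply/negP.
have x0 m : 0 <= x m by case: (xP m) => -[-> //].
have xY m : leR (fun _ => x m) (vg Y).
  case: (xP m) => -[E _]; first by rewrite E.
  by rewrite E; apply/leR_cstl => // q L; exists m; have := e2_gt0 m; lra.
have [S [HS ES]] := mk_constseq Hx.
have ES' n : (fun k => vg S (pair n k)) = fun _ => x n by apply: funext.
apply: NY; apply: (LCC Y HY Y01 S HS).
- move=> n; rewrite (Mle_E (den_0) (den_row n HS)) (Mle_E (den_row n HS) (den_set (proj1 HY))) ES'.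
  by split=> //; apply/leR_cst.
- apply/(Mlimit_E HS HY) => n; have [k Hk] := @e2_small _ (e2_gt0 n).
  exists k => m /Hk L j; rewrite ES; have := e2_gt0 j; have := e2_gt0 m; have := e2_gt0 n.
  have := xY m j; have := reg2 RY j m; have : vg Y m - 2 * e2 m <= x m by case: (xP m) => -[-> ?]; lra.
  by lra.
- move=> n; have [y [Hy Ey]] := row_real n HS; exists y; split=> //.
  have Ry : Mis_real y by case: Hy.
  rewrite ES' in Ey; have y01 : Min01 (Mset y).
    apply/(in01_cst Ry); rewrite Ey; split; first by apply/leR_cst.
    exact: leR_trans (reg_cst _) RY (reg_cst _) (xY n) Y1.
  (* A term that was cut off equals 0, where P holds by hypothesis; any other lies strictly below Y,
     where minimality gives P. *)
  case: (xP n) => -[En Ln].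
    by apply: (MOpen_ext OP Hz) Pz => //; rewrite Ez Ey En; exact: leR_refl.
  apply: H => //; apply/(Mlt_set Ry HY); rewrite Ey.
  by apply/lo_ltR => //; exists n; rewrite En; have := e2_gt0 n; lra.
Qed.
End Minimal.

Lemma CA_OI1 : holds M (schema Sigma1 OI1).
Proof.
move=> _ [Psi [HP ->]] rho sigma; apply/sem_OI1 => -[OP Pr].
have [T [HT ET]] := Sigma1_D0 rho sigma HP.
by apply: (open_MOI1 OP HT _ Pr) => r X _; exact: ET.
Qed.

Lemma CA_OI3 : holds M (schema Sigma1 OI3).
Proof.
move=> _ [Psi [HP ->]] rho sigma; apply/sem_OI3 => -[OP [Z L]].
have [T [HT ET]] := Sigma1_D0 rho sigma HP.
by apply: (open_MOI3 OP HT _ Z L) => r X _; exact: ET.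
Qed.

Lemma coded_min (Q Q' : set) : Mis_ratseq Q -> Mis_ratseq Q' ->
  forall X, Mis_real X -> Min01 (Mset X) -> ~ Min_open Q Q' (Mset X) ->
  exists Y, [/\ Mis_real Y, Min01 (Mset Y), ~ Min_open Q Q' (Mset Y) &
    forall Z, Mis_real Z -> Min01 (Mset Z) -> Mlt (Mset Z) (Mset Y) -> Min_open Q Q' (Mset Z)].
Proof.
move=> HQ HQ'; have [T [HT ET]] := open_D0 HQ HQ'.
apply: (open_min (P := fun X => Min_open Q Q' (Mset X)) _ HT).
  by apply: (MOpen_inO (Q := Q) (Q' := Q')) => X HX; exact: Min_open_E.
by move=> r X HX; rewrite ET // Min_open_E.
Qed.

Lemma CA_OI4 : MOI4.
Proof.
move=> Q Q' HQ HQ' Pr X HX X01; split=> //.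
apply: contrapT => /(coded_min HQ HQ' HX X01) [Y [HY Y01 NY H]].
by apply: NY; have [] := Pr Y HY Y01 (fun Z HZ Z01 ZY => conj Z01 (H Z HZ Z01 ZY)).
Qed.

Lemma CA_closed_inf : Mclosed_inf.
Proof.
move=> Q Q' HQ HQ' [X [HX [X01 NX]]].
(* The infimum is attained: it is the least real outside the complementary open set. *)
have [Y [HY Y01 NY H]] := coded_min HQ HQ' HX X01 NX.
exists Y; split=> //; split=> [Z HZ [Z01 NZ]|Z HZ L]; last by apply: L.
apply/(Mle_set HY HZ); apply/nltR.
by move=> /(Mlt_set HZ HY) /(H Z HZ Z01).
Qed.
End Induction.
End ModelOfRCA0.

(** * The equivalence of all statements *)

Definition statements : list theory :=
  [ schema Arithmetical arithmetical_comprehension;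
    sentence monotone_convergence;
    sentence cauchy_convergence;
    sentence sequence_sup;
    sentence closed_inf;
    sentence open_sup;
    schema Sigma1 OI1;
    schema Sigma1 OI3;
    sentence OI4 ].

Lemma statements_CA (R : rca) S : In S statements -> holds (rM R) S <-> Sigma1_CA R.
Proof.
case=> [<-|[<-|[<-|[<-|[<-|[<-|[<-|[<-|[<-|[]]]]]]]]]]; split.
- exact: ACA_Sigma1_CA.
- exact: CA_ACA.
- by move=> /sem_monotone_convergence /monotone_convergence_lub /increasing_lub_CA.
- by move=> CA; apply/sem_monotone_convergence; exact: CA_monotone.
- by move=> /sem_cauchy_convergence /cauchy_convergence_lub /increasing_lub_CA.
- by move=> CA; apply/sem_cauchy_convergence; exact: CA_cauchy.
- by move=> /sem_sequence_sup /sequence_sup_lub /increasing_lub_CA.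
- by move=> CA; apply/sem_sequence_sup; exact: CA_sup.
- by move=> /sem_closed_inf H; apply: increasing_lub_CA => x Ix; exact: closed_inf_lub_of.
- by move=> CA; apply/sem_closed_inf; exact: CA_closed_inf.
- by move=> /sem_open_sup H; apply: increasing_lub_CA => x Ix; exact: open_sup_lub_of.
- by move=> CA; apply/sem_open_sup; exact: CA_open_sup.
- by move=> H; apply: increasing_lub_CA => x Ix; exact: OI1_lub_of.
- exact: CA_OI1.
- by move=> H; apply: increasing_lub_CA => x Ix; exact: OI3_lub_of.
- exact: CA_OI3.
- by move=> /sem_OI4 H; apply: increasing_lub_CA => x Ix; exact: OI4_lub_of.
- by move=> CA; apply/sem_OI4; exact: CA_OI4.
Qed.

Lemma rca_of_model M (s0 : sets M) : holds M RCA0 -> exists R : rca, rM R = M.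
Proof.
move=> HM; have [K [io [H1 H2 [H3 H4] H5 [H6 H7 H8]]]] := ordered_field (PaModel (holds_pa_minus s0 HM)).
by exists (Rca s0 HM H1 H2 H3 H4 H5 H6 H7 H8).
Qed.

Theorem theorem6 :
  ForallPairs (provably_equivalent_over RCA0)
    [ schema Arithmetical arithmetical_comprehension;
      sentence monotone_convergence;
      sentence cauchy_convergence;
      sentence sequence_sup;
      sentence closed_inf;
      sentence open_sup;
      schema Sigma1 OI1;
      schema Sigma1 OI3;
      sentence OI4 ].
Proof.
move=> S S' HS HS'; apply: equivalent_of_models => M HM.
(* Without sets in the model there is no valuation of set variables, and every theory holds
   vacuously. *)
have [[s0 _]|N] := pselect (exists s : sets M, True); last first.
  by split=> _ p _ rho sigma; case: N; exists (sigma 0%N).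
have [R <-] := rca_of_model s0 HM.
by rewrite (statements_CA R HS) (statements_CA R HS').
Qed.
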